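(* Let $f \in \mathbf{U}$ be of type $x^{l+}$ for some integer $l \ge 1$. Then $(f(p))_{p \in \mathcal{P}}$ is uniformly distributed mod $1$.
   Context: A Hardy field is a subfield of the ring of germs at $+\infty$ of continuous real functions on $\mathbb{R}$ which is closed under differentiation; $\mathbf{U}$ is the union of all Hardy fields. For an integer $l\ge 0$, $f$ is of type $x^{l+}$ if $\lim_{x\to\infty} x^l/f(x) = \lim_{x\to\infty} f(x)/x^{l+1} = 0$. $\mathcal{P}$ is the set of primes in increasing order, and $(f(p))_{p\in\mathcal{P}}$ denotes $(f(p_n))_{n\in\mathbb{N}}$ where $p_n$ is the $n$-th prime. *)

(* Defs.v *)
From HB Require Import structures.
From mathcomp Require Import all_boot all_order all_algebra.
From mathcomp Require Import all_classical all_reals all_analysis.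
From mathcomp Require Import ring_quotient.

Set Implicit Arguments.
Unset Strict Implicit.
Unset Printing Implicit Defensive.

Import Order.TTheory GRing.Theory Num.Theory.
Import numFieldNormedType.Exports.

Local Open Scope classical_set_scope.
Local Open Scope ring_scope.

Section ContinuousFunctions.
Variable R : realType.

Definition contfun : {pred R -> R} := mem [set f : R -> R | continuous f].

Let contfun_Sub (f : R -> R) (fP : f \in contfun) : continuousType R R :=
  HB.pack f (isContinuous.Build R R f (set_mem fP)).

Let contfun_rect (K : continuousType R R -> Type) :
  (forall f (fP : f \in contfun), K (contfun_Sub fP)) -> forall u, K u.
Proof.
move=> Ksub u.
have fP : (u : R -> R) \in contfun by rewrite inE; exact: cts_fun.
suff -> : u = contfun_Sub fP by [].
by apply/continuousEP.
Qed.

Let contfun_valP (f : R -> R) (fP : f \in contfun) :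
  contfun_Sub fP = f :> (R -> R).
Proof. by []. Qed.

HB.instance Definition _ :=
  isSub.Build (R -> R) (fun f => f \in contfun) (continuousType R R)
    contfun_rect contfun_valP.

Lemma contfun_subring_closed : subring_closed contfun.
Proof.
split=> [|f g|f g]; rewrite !inE /=.
- by move=> x; apply: cvg_cst.
- by move=> fc gc x; apply: cvgB; [exact: fc|exact: gc].
- by move=> fc gc x; apply: cvgM; [exact: fc|exact: gc].
Qed.
HB.instance Definition _ :=
  GRing.isSubringClosed.Build (R -> R) contfun contfun_subring_closed.
HB.instance Definition _ :=
  [SubChoice_isSubComNzRing of continuousType R R by <:].

End ContinuousFunctions.

Section Germs.
Variable R : realType.
Implicit Types f g : continuousType R R.

Definition germ0 : {pred continuousType R R} :=
  fun f => `[< \forall x \near +oo, f x = 0 >].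

Lemma germ0_idealr_closed : idealr_closed germ0.
Proof.
split.
- by apply/asboolP; apply: nearW.
- apply/negP => /asboolP h.
  have [x /=] := @filter_ex _ _ (@proper_pinfty_nbhs R) _ h.
  by move/eqP; rewrite oner_eq0.
- move=> a f g /asboolP f0 /asboolP g0; apply/asboolP.
  near=> x.
  have -> : (a * f + g) x = a x * f x + g x by [].
  have -> : f x = 0 by near: x.
  have -> : g x = 0 by near: x.
  by rewrite mulr0 addr0.
Unshelve. all: by end_near. Qed.

HB.instance Definition _ :=
  isIdealr.Build (continuousType R R) germ0 germ0_idealr_closed.

Definition germ := {ideal_quot germ0}.

Definition to_germ (f : continuousType R R) : germ := \pi_germ%qT f.

Lemma to_germP f g :
  to_germ f = to_germ g <-> \forall x \near +oo, f x = g x.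
Proof.
have E : (to_germ f == to_germ g) = (f - g \in germ0).
  by rewrite Quotient.idealrBE.
split=> [/eqP|fg].
  rewrite E => /asboolP; apply: filterS => x.
  by move/eqP; rewrite subr_eq0 => /eqP.
apply/eqP; rewrite E; apply/asboolP; apply: filterS fg => x fgx.
by have -> : (f - g) x = f x - g x by []; rewrite fgx subrr.
Qed.

(* Two representatives that agree on a half-line have the same derivative on
   its interior, so the relation does not depend on the choice of f and g. *)
Definition is_germ_derive (u v : germ) : Prop :=
  exists f g : continuousType R R,
    [/\ to_germ f = u, to_germ g = v &
        \forall x \near +oo, is_derive (x : R) (1 : R) (f : R -> R) (g x)].

Definition hardy_field (H : set germ) : Prop :=
  [/\ subring_closed (mem H),
      forall u, H u -> u != 0 -> exists2 v, H v & u * v = 1 &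
      forall u, H u -> exists2 v, H v & is_germ_derive u v].

Definition hardy_union : set germ := \bigcup_(H in hardy_field) H.

End Germs.

Section GrowthAndDistribution.
Variable R : realType.

(* The first clause makes the quotient meaningful near +oo: division by 0
   yields 0, so without it f = 0 would satisfy both limits. *)
Definition of_type_xplus (l : nat) (f : R -> R) : Prop :=
  [/\ \forall x \near +oo, f x != 0,
      x ^+ l / f x @[x --> +oo] --> (0 : R) &
      f x / x ^+ l.+1 @[x --> +oo] --> (0 : R)].

Definition frac_part (x : R) : R := x - (Num.floor x)%:~R.

Definition uniformly_distributed_mod1 (x : nat -> R) : Prop :=
  forall a b : R, 0 <= a -> a < b -> b <= 1 ->
    (#|[set n : 'I_N | a <= frac_part (x n) < b]%SET|%:R / N%:R : R)
      @[N --> \oo] --> b - a.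

End GrowthAndDistribution.

Lemma next_prime_subproof m : exists p, (m < p)%N && prime p.
Proof. by have [p mp pp] := prime_above m; exists p; rewrite mp. Qed.

Definition next_prime (m : nat) : nat := ex_minn (next_prime_subproof m).

(* Indexed from 0: nth_prime 0 = 2. *)
Definition nth_prime (n : nat) : nat := iter n.+1 next_prime 0.

Lemma nth_prime_prime n : prime (nth_prime n).
Proof.
by rewrite /nth_prime iterS /next_prime; case: ex_minnP => p /andP[].
Qed.

Lemma ltn_nth_primeS n : (nth_prime n < nth_prime n.+1)%N.
Proof.
rewrite /nth_prime [in ltnRHS]iterS {2}/next_prime.
by case: ex_minnP => p /andP[].
Qed.

Lemma nth_prime_surj p : prime p -> exists n, nth_prime n = p.
Proof.
move=> pp; have le_iter n : (n <= iter n next_prime 0)%N.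
  elim: n => // n IHn; rewrite iterS {1}/next_prime.
  by case: ex_minnP => q /andP[+ _] _; apply: leq_ltn_trans.
have [n] : exists n, (p <= iter n next_prime 0)%N by exists p.
elim: n => [|n IHn]; first by rewrite leqn0 => /eqP p0; rewrite p0 in pp.
case: (leqP p (iter n next_prime 0)) => [/IHn//|lt_p le_p].
exists n; apply/eqP; rewrite eqn_leq le_p andbT.
rewrite /nth_prime iterS {1}/next_prime; case: ex_minnP => q _; apply.
by rewrite lt_p.
Qed.

(* Main.v *)
(* By Weyl's criterion it suffices that the mean of cos (2 pi (h f(p_i) + phi))
   over the first n primes p_i tends to 0 for all h >= 1 and phi; restricting to
   real cosines with an arbitrary phase phi avoids complex exponentials.
   In a Hardy field f varies regularly: for some theta in [l, l + 1] the
   derivatives satisfy x f^(k+1)(x) / f^(k)(x) -> theta - k for all k > l.  So the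
   size of f^(k) on [X, 2X] is X^(theta - k + o(1)) and Weyl differencing on blocks
   where f is close to a polynomial of degree k gives a power saving in sums of
   cos (2 pi f(n)), and likewise in sums of cos (2 pi (f(d n) - f(d' n))).
   These are the Type I and Type II estimates that Vaughan's identity, in the form
   Lambda 1_(n > U) = mu * (Lambda 1_(m > U) * 1), needs to bound the sum of
   Lambda(n) cos (2 pi f(n)) over X < n <= 2 X by o(X); prime powers and the weight
   ln p are then removed by partial summation and Chebyshev's lower bound. *)
Require Import Defs.
From mathcomp Require Import all_boot all_order all_algebra.
From mathcomp Require Import all_classical all_reals all_analysis.
From mathcomp Require Import ring lra zify.

Set Implicit Arguments.
Unset Strict Implicit.
Unset Printing Implicit Defensive.

Import Order.TTheory GRing.Theory Num.Theory.
Import numFieldNormedType.Exports.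

Local Open Scope classical_set_scope.
Local Open Scope ring_scope.

(** * Hardy fields and regular variation *)

Section HardyFunctions.
Variable R : realType.
Implicit Types (f g h : R -> R) (H : set (germ R)).

(** The obstacle is growth that hugs an integer power, such as x^l ln x or x^(l+1) / ln x: some
    derivative h of f then varies slowly, and x h' / h -> 0 says nothing about the index of h'. The
    remedy is to study the derivative of h / h' instead: it lies in the Hardy field, hence has a
    limit in [-oo, +oo], and the growth of f restricts that limit. Quotients and derivatives of
    representatives are only known to be continuous near +oo, so membership is tracked up to
    eventual equality by [hardy_fun]. No single order of differencing suits all blocks: a dilated
    sum of length X^m sees a k-th derivative of size X^(theta - k m), which must be small, yet not
    far below X^(-m). A finite list of orders, selected by m, covers all lengths from X^m0 to X. The
    condition l >= 1 enters through the differences f(d n) - f(d' n): their k-th derivative carries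
    a factor close to theta, and theta >= l keeps it away from 0. *)

Definition hardy_fun H h : Prop :=
  exists2 c : continuousType R R, H (to_germ c) & \forall x \near +oo, h x = c x.

Lemma near_pinftyP (P : set R) :
  (\forall x \near +oo, P x) <-> exists2 A : R, 1 <= A & forall x, A <= x -> P x.
Proof.
split=> [[A [_ AP]]|[A _ AP]]; last first.
  exists A; split; first exact: num_real.
  by move=> x /ltW; exact: AP.
exists (Num.max 1 (A + 1)) => [|x]; first by rewrite le_max lexx.
by rewrite ge_max => /andP[_ Ax]; apply: AP; rewrite (lt_le_trans _ Ax)// ltrDl.
Qed.

Lemma to_germB (c d : continuousType R R) : to_germ (c - d) = to_germ c - to_germ d.
Proof. by rewrite /to_germ !piE. Qed.

Lemma to_germM (c d : continuousType R R) : to_germ (c * d) = to_germ c * to_germ d.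
Proof. by rewrite /to_germ !piE. Qed.

Lemma to_germ1 : to_germ 1 = 1 :> germ R.
Proof. by rewrite /to_germ !piE. Qed.

Lemma to_germ0 : to_germ 0 = 0 :> germ R.
Proof. by rewrite /to_germ !piE. Qed.

Lemma to_germ_surj (u : germ R) : exists c, to_germ c = u.
Proof. by exists (repr u); rewrite /to_germ reprK. Qed.

Lemma eventually_neq0_sign f : continuous f ->
  (\forall x \near +oo, f x != 0) ->
  (\forall x \near +oo, 0 < f x) \/ (\forall x \near +oo, f x < 0).
Proof.
move=> cf /near_pinftyP[A A1 fA].
have same x : A <= x -> 0 < f A * f x.
  move=> Ax; rewrite lt_neqAle eq_sym mulf_neq0 ?fA//=.
  rewrite leNgt; apply/negP => s.
  have [||c] := @IVT R f A x 0 Ax.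
  - by apply: continuous_subspaceT => y; exact: cf.
  - have [fA0|fA0] := leP (f A) 0.
      have fx0 : 0 <= f x by rewrite leNgt; apply/negP => h; nra.
      by rewrite (min_l (le_trans fA0 fx0)) (max_r (le_trans fA0 fx0)) fA0.
    have fx0 : f x <= 0 by rewrite leNgt; apply/negP => h; nra.
    have h := le_trans fx0 (ltW fA0).
    by rewrite (min_r h) (max_l h) fx0 ltW.
  - by rewrite in_itv/= => /andP[Ac _]; apply/eqP; exact: fA.
have := fA A (lexx _); rewrite neq_lt => /orP[] s; [right|left].
- by apply/near_pinftyP; exists A => // x /same; nra.
- by apply/near_pinftyP; exists A => // x /same; nra.
Qed.

(** A nonzero germ has an inverse in the field, so its representative has no zeros near +oo;
    continuity then fixes the sign. All monotonicity below comes from this. *)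
Lemma hardy_fun_sign H h : hardy_field H -> hardy_fun H h ->
  [\/ \forall x \near +oo, h x = 0, \forall x \near +oo, 0 < h x |
      \forall x \near +oo, h x < 0].
Proof.
move=> [_ Hinv _] [c Hc hc].
have [c0|c0] := eqVneq (to_germ c) 0.
  move: c0; rewrite -to_germ0 => /to_germP c0; constructor 1.
  by apply: filterS2 hc c0 => x -> ->.
have [v Hv] := Hinv _ Hc c0; have [d <-] := to_germ_surj v.
rewrite -to_germM -to_germ1 => /to_germP cd.
have [||s|s] := @eventually_neq0_sign c.
- by move=> x; exact: cts_fun.
- apply: filterS cd => x; have -> : (c * d) x = c x * d x by [].
  by have -> : (1 : continuousType R R) x = 1 by []; apply: contra_eqN => /eqP->; rewrite mul0r eq_sym oner_eq0.
- by constructor 2; apply: filterS2 hc s => x ->.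
- by constructor 3; apply: filterS2 hc s => x ->.
Qed.

Lemma hardy_funB H f g : hardy_field H -> hardy_fun H f -> hardy_fun H g ->
  hardy_fun H (fun x => f x - g x).
Proof.
move=> [[_ HB _] _ _] [c Hc fc] [d Hd gd]; exists (c - d).
  rewrite to_germB; have := HB (to_germ c) (to_germ d).
  by rewrite /in_mem/= => h; apply/asboolP; apply: h; apply/asboolP.
by apply: filterS2 fc gd => x -> ->.
Qed.

Lemma hardy_funM H f g : hardy_field H -> hardy_fun H f -> hardy_fun H g ->
  hardy_fun H (fun x => f x * g x).
Proof.
move=> [[_ _ HM] _ _] [c Hc fc] [d Hd gd]; exists (c * d).
  rewrite to_germM; have := HM (to_germ c) (to_germ d).
  by rewrite /in_mem/= => h; apply/asboolP; apply: h; apply/asboolP.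
by apply: filterS2 fc gd => x -> ->.
Qed.

Lemma hardy_funN H f : hardy_field H -> hardy_fun H f -> hardy_fun H (fun x => - f x).
Proof.
move=> HH Hf; have := hardy_funB HH (hardy_funB HH Hf Hf) Hf.
by under eq_fun do rewrite subrr sub0r.
Qed.

Lemma hardy_fun_div H f g : hardy_field H -> hardy_fun H f -> hardy_fun H g ->
  (\forall x \near +oo, g x != 0) -> hardy_fun H (fun x => f x / g x).
Proof.
move=> HH Hf [c Hc gc] g0.
suff HV : hardy_fun H (fun x => (g x)^-1) by exact: (hardy_funM HH Hf HV).
case: HH => _ Hinv _.
have c0 : to_germ c != 0.
  apply/eqP; rewrite -to_germ0 => /to_germP c0.
  have [x] : exists x, g x != 0 /\ g x = 0.
    apply: (@filter_ex _ (pinfty_nbhs R)).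
    by apply: filterS3 g0 gc c0 => x g0 gc c0; split; rewrite // gc c0.
  by move=> [/eqP].
have [v Hv] := Hinv _ Hc c0; have [d Ed] := to_germ_surj v.
rewrite -Ed in Hv *; rewrite -to_germM -to_germ1 => /to_germP cd.
exists d => //; apply: filterS3 g0 gc cd => x g0 gc cd.
by apply: (mulfI g0); rewrite divff// gc -[LHS]/((1 : continuousType R R) x) -cd.
Qed.

Lemma hardy_fun_derive H f : hardy_field H -> hardy_fun H f ->
  exists2 g, hardy_fun H g & \forall x \near +oo, is_derive (x : R) (1 : R) f (g x).
Proof.
move=> [_ _ HD] [c Hc /near_pinftyP[A _ fc]].
have [v Hv [f1 [g [Ef Eg fg]]]] := HD _ Hc.
exists g; first by exists g; [rewrite Eg|exact: nearW].
move/to_germP: Ef => /near_pinftyP[B _ f1c].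
near=> x; have fgx : is_derive x 1 f1 (g x) by near: x.
apply: near_eq_is_derive fgx.
have xAB : Num.max A B < x by near: x; apply: nbhs_pinfty_gt; exact: num_real.
near=> y; have yAB : Num.max A B < y by near: y; exact: lt_nbhsr.
have /andP[? ?] : (A < y) && (B < y) by rewrite -gt_max.
by rewrite fc ?f1c// ltW.
Unshelve. all: by end_near. Qed.

End HardyFunctions.

(** * Limits of x h' / h in a Hardy field *)

Section RegularVariation.
Variable R : realType.
Implicit Types (f g h u : R -> R).

Notation near_derive f g := (\forall x \near +oo, is_derive (x : R) (1 : R) f (g x)).

Lemma mvt_half_line f g (A : R) : (forall x, A <= x -> is_derive (x : R) (1 : R) f (g x)) ->
  forall x y, A <= x -> x <= y ->
  exists2 c, x <= c <= y & f y - f x = g c * (y - x).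
Proof.
move=> fg x y Ax xy.
have [||c] := @MVT_segment R f g x y xy.
- by move=> z; rewrite in_itv/= => /andP[xz _]; apply: fg; rewrite (le_trans Ax)// ltW.
- apply: derivable_within_continuous => z; rewrite in_itv/= => /andP[xz _].
  by apply: ex_derive; apply: fg; rewrite (le_trans Ax).
- by rewrite in_itv/= => cxy E; exists c.
Qed.

Lemma near_pinfty_ge (A : R) : \forall x \near +oo, A <= x.
Proof. by apply: nbhs_pinfty_ge; exact: num_real. Qed.

(** By the mean value theorem on [A, x] the mean slope is at most [a]; the slack [b - a] absorbs the
    constant f A - a A once x is large. *)
Lemma derive_ub f g (a b : R) : near_derive f g ->
  (\forall x \near +oo, g x <= a) -> a < b -> \forall x \near +oo, f x <= b * x.
Proof.
move=> fg ga ab; have [A A1 H] := (near_pinftyP _).1 (filterI fg ga).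
near=> x; have Ax : A <= x by near: x; exact: near_pinfty_ge.
have [c /andP[Ac _] E] := mvt_half_line (fun x Ax => (H x Ax).1) (lexx A) Ax.
have gc := (H c Ac).2.
have : (f A - a * A) / (b - a) <= x by near: x; exact: near_pinfty_ge.
by rewrite ler_pdivrMr ?subr_gt0//; nra.
Unshelve. all: by end_near. Qed.

Lemma derive_lb f g (a b : R) : near_derive f g ->
  (\forall x \near +oo, a <= g x) -> b < a -> \forall x \near +oo, b * x <= f x.
Proof.
move=> fg ga ab; have [A A1 H] := (near_pinftyP _).1 (filterI fg ga).
near=> x; have Ax : A <= x by near: x; exact: near_pinfty_ge.
have [c /andP[Ac _] E] := mvt_half_line (fun x Ax => (H x Ax).1) (lexx A) Ax.
have gc := (H c Ac).2.
have : (f A - a * A) / (b - a) <= x by near: x; exact: near_pinfty_ge.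
by rewrite ler_ndivrMr ?subr_lt0//; nra.
Unshelve. all: by end_near. Qed.

(** L'Hopital's rule with denominator x. It is applied to quotients h / h', whose derivatives have
    limits because they lie in a Hardy field. *)
Lemma derive_cvg_ratio f g (c : R) : near_derive f g ->
  g x @[x --> +oo] --> c -> f x / x @[x --> +oo] --> c.
Proof.
move=> fg /cvgrPdist_le gc; apply/cvgrPdist_le => e e0.
have e20 : 0 < e / 2 by rewrite divr_gt0.
have U : \forall x \near +oo, f x <= (c + e) * x.
  apply: (@derive_ub f g (c + e / 2)) => //; last by lra.
  by apply: filterS (gc _ e20) => x; rewrite ler_norml => /andP[]; lra.
have L : \forall x \near +oo, (c - e) * x <= f x.
  apply: (@derive_lb f g (c - e / 2)) => //; last by lra.
  by apply: filterS (gc _ e20) => x; rewrite ler_norml => /andP[]; lra.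
apply: filterS3 (near_pinfty_ge 1) U L => x x1 U L.
have x0 : 0 < x by lra.
rewrite ler_norml; apply/andP; split.
  by rewrite lerBrDl -lerBrDr opprK addrC ler_pdivrMr//; lra.
by rewrite lerBlDl -lerBlDr ler_pdivlMr.
Qed.

Lemma derive_ge0_mono f g (A : R) : (forall x, A <= x -> is_derive (x : R) (1 : R) f (g x)) ->
  (forall x, A <= x -> 0 <= g x) -> forall x y, A <= x -> x <= y -> f x <= f y.
Proof.
move=> fg g0 x y Ax xy; have [c /andP[xc _] E] := mvt_half_line fg Ax xy.
by rewrite -subr_ge0 E mulr_ge0 ?subr_ge0// g0// (le_trans Ax).
Qed.

Lemma derive_le0_mono f g (A : R) : (forall x, A <= x -> is_derive (x : R) (1 : R) f (g x)) ->
  (forall x, A <= x -> g x <= 0) -> forall x y, A <= x -> x <= y -> f y <= f x.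
Proof.
move=> fg g0 x y Ax xy; have [c /andP[xc _] E] := mvt_half_line fg Ax xy.
by rewrite -subr_le0 E mulr_le0_ge0 ?subr_ge0// g0// (le_trans Ax).
Qed.

Lemma mono_cvg f (A : R) : (forall x y, A <= x -> x <= y -> f x <= f y) ->
  (exists c : R, f x @[x --> +oo] --> c) \/ f x @[x --> +oo] --> +oo.
Proof.
move=> fm; have [B|B] := pselect (exists K, forall x, A <= x -> f x <= K).
  left; case: B => K fK.
  pose S := [set f x | x in [set x | A <= x]].
  have Sub : has_sup S.
    by split; [exists (f A); exists A => //=|exists K => _ [x Ax <-]; exact: fK].
  exists (sup S); apply/cvgrPdist_le => e e0.
  have [_ [y Ay <-] fy] := sup_adherent e0 Sub.
  apply: filterS (near_pinfty_ge y) => x yx.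
  have fx : f x <= sup S.
    by apply: ub_le_sup; [case: Sub|exists x => //=; exact: le_trans yx].
  have := fm _ _ Ay yx; rewrite ler_norml => ?; apply/andP; split; lra.
right; apply/cvgryPge => K.
have [y Ay fy] : exists2 y, A <= y & K <= f y.
  apply: contrapT => h; apply: B; exists K => x Ax; rewrite leNgt; apply/negP => Kx.
  by apply: h; exists x => //; exact: ltW.
by apply: filterS (near_pinfty_ge y) => x yx; exact: le_trans (fm _ _ Ay yx).
Qed.

(** The derivative lies in the field too, so it has a constant sign near +oo and h is eventually
    monotone. *)
Lemma hardy_fun_limit (H : set (germ R)) h : hardy_field H -> hardy_fun H h ->
  [\/ exists c : R, h x @[x --> +oo] --> c, h x @[x --> +oo] --> +oo |
      h x @[x --> +oo] --> -oo].
Proof.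
move=> HH Hh; have [g Hg hg] := hardy_fun_derive HH Hh.
have [s|s] : (\forall x \near +oo, 0 <= g x) \/ (\forall x \near +oo, g x <= 0).
  by have [s|s|s] := hardy_fun_sign HH Hg; [left|left|right];
    apply: filterS s => x; [move->|exact: ltW|exact: ltW].
  have [A _ HA] := (near_pinftyP _).1 (filterI hg s).
  have [] := @mono_cvg h A; last 2 first.
  - by constructor 1.
  - by constructor 2.
  exact: (derive_ge0_mono (fun x Ax => (HA x Ax).1) (fun x Ax => (HA x Ax).2)).
have [A _ HA] := (near_pinftyP _).1 (filterI hg s).
have [] := @mono_cvg (fun x => - h x) A.
- by move=> x y Ax xy; rewrite lerN2;
    exact: (derive_le0_mono (fun x Ax => (HA x Ax).1) (fun x Ax => (HA x Ax).2)).
- move=> [c hc]; constructor 1; exists (- c).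
  rewrite (_ : h = (fun x => - - h x)); first exact: cvgN hc.
  by apply/funext => x; rewrite opprK.
- move=> hc; constructor 3; apply/cvgrNyPle => K.
  by move/cvgryPge : hc => /(_ (- K)); apply: filterS => x; rewrite lerN2.
Qed.

(* If [g' = g / u] with [u >= - b x], [b < 1], then [F + a x g] is eventually
   decreasing for a suitable [a], which bounds the antiderivative [F] of [g]. *)
Lemma antiderivative_bounded F g g' (b : R) : 0 < b < 1 ->
  near_derive F g -> near_derive g g' -> (\forall x \near +oo, 0 < g x) ->
  (\forall x \near +oo, x * g' x <= - g x / b) ->
  ~ F x @[x --> +oo] --> +oo.
Proof.
move=> /andP[b0 b1] Fg gg g0 xg /cvgryPge Foo.
pose a := b / (1 - b).
have a0 : 0 < a by rewrite divr_gt0// subr_gt0.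
have aE : a / b = 1 + a by rewrite /a; field; rewrite !gt_eqF// subr_gt0.
have [A A1 HA] := (near_pinftyP _).1 (filterI (filterI Fg gg) (filterI g0 xg)).
pose G := fun x => F x + a * (x * g x).
have dG x : A <= x -> is_derive (x : R) (1 : R) G (g x + a * (g x + x * g' x)).
  move=> Ax; have [[dF dg] _] := HA x Ax.
  have d1 : is_derive (x : R) (1 : R) (fun x : R => x * g x) (x *: g' x + g x *: 1).
    exact: (@is_deriveM _ _ id g).
  apply: is_derive_eq; rewrite /GRing.scale/=; ring.
have Gm : forall x y, A <= x -> x <= y -> G y <= G x.
  apply: (derive_le0_mono dG) => x Ax.
  have [_ [gx xgx]] := HA x Ax.
  have : a * (x * g' x) <= a * (- g x / b) by rewrite ler_pM2l.
  have -> : a * (- g x / b) = - g x * (a / b) by ring.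
  by rewrite aE mulrDr; lra.
have [x [Ax Fx]] : exists x, A <= x /\ G A + 1 <= F x.
  apply: (@filter_ex _ (pinfty_nbhs R)).
  by apply: filterI; [exact: near_pinfty_ge|exact: Foo].
have := Gm _ _ (lexx A) Ax; rewrite {1}/G.
have [_ [gx _]] := HA x Ax.
have x0 : 0 < x by lra.
have := mulr_gt0 a0 (mulr_gt0 x0 gx); lra.
Qed.

Lemma near_eq_cvg_to f g (c : R) : (\forall x \near +oo, f x = g x) ->
  f x @[x --> +oo] --> c -> g x @[x --> +oo] --> c.
Proof.
by move=> fg; apply: cvg_trans; apply: near_eq_cvg; apply: filterS fg => x ->.
Qed.

Lemma cvg0_of_ratio g g' (c : R) : (\forall x \near +oo, 0 < g x) ->
  g x @[x --> +oo] --> (0 : R) -> x * g' x / g x @[x --> +oo] --> c ->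
  x * g' x @[x --> +oo] --> (0 : R).
Proof.
move=> g0 gc rc.
apply: (@near_eq_cvg_to (fun x => x * g' x / g x * g x)).
  by apply: filterS g0 => x gx; rewrite divfK// gt_eqF.
by rewrite -(mulr0 c); exact: cvgM rc gc.
Qed.

(** With [a / b = a - 1] the function g - a x g' is nondecreasing, and it is positive because g' <
    0. Both of its terms tend to 0, a contradiction. *)
Lemma decay_not_fast g g' g'' (b : R) : 1 < b ->
  near_derive g g' -> near_derive g' g'' -> (\forall x \near +oo, 0 < g x) ->
  (\forall x \near +oo, g' x < 0) -> g x @[x --> +oo] --> (0 : R) ->
  x * g' x / g x @[x --> +oo] --> (0 : R) ->
  (\forall x \near +oo, x * g'' x <= - g' x / b) -> False.
Proof.
move=> b1 gg gg' g0 g'0 gc rc xg.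
have xgc := cvg0_of_ratio g0 gc rc.
pose a := b / (b - 1).
have a0 : 0 < a by rewrite divr_gt0//; lra.
have aE : a / b = a - 1 by rewrite /a; field; rewrite !gt_eqF//; lra.
have [A A1 HA] := (near_pinftyP _).1 (filterI (filterI gg gg') (filterI (filterI g0 g'0) xg)).
pose G := fun x => g x - a * (x * g' x).
have dG x : A <= x -> is_derive (x : R) (1 : R) G (g' x - a * (g' x + x * g'' x)).
  move=> Ax; have [[dF dg] _] := HA x Ax.
  have d1 : is_derive (x : R) (1 : R) (fun x : R => x * g' x) (x *: g'' x + g' x *: 1).
    exact: (@is_deriveM _ _ id g').
  apply: is_derive_eq; rewrite /GRing.scale/=; ring.
have Gm : forall x y, A <= x -> x <= y -> G x <= G y.
  apply: (derive_ge0_mono dG) => x Ax.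
  have [_ [[gx g'x] xgx]] := HA x Ax.
  have : a * (x * g'' x) <= a * (- g' x / b) by rewrite ler_pM2l.
  have -> : a * (- g' x / b) = - g' x * (a / b) by ring.
  by rewrite aE mulrBr; lra.
have GA : 0 < G A.
  have [_ [[gx g'x] _]] := HA A (lexx A).
  have A0 : 0 < A by lra.
  have : A * g' A < 0 by rewrite pmulr_rlt0.
  by rewrite /G; nra.
have Gc : G x @[x --> +oo] --> (0 : R).
  have -> : 0 = 0 - a * 0 :> R by rewrite mulr0 subr0.
  by apply: cvgB => //; apply: cvgMl_tmp.
have G2 : 0 < G A / 2 by rewrite divr_gt0.
have [x [Ax]] : exists x, A <= x /\ `|0 - G x| <= G A / 2.
  apply: (@filter_ex _ (pinfty_nbhs R)); apply: filterI; first exact: near_pinfty_ge.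
  by move/cvgrPdist_le : Gc; exact.
by rewrite sub0r normrN ler_norml => /andP[_]; have := Gm _ _ (lexx A) Ax; lra.
Qed.

(** Here [a / b = 1 + a] makes g + a x g' nondecreasing. It is positive at a large point A because x
    g' / g -> 0, yet it tends to 0. *)
Lemma decay_not_slow g g' g'' (b : R) : 0 < b < 1 ->
  near_derive g g' -> near_derive g' g'' -> (\forall x \near +oo, 0 < g x) ->
  g x @[x --> +oo] --> (0 : R) ->
  x * g' x / g x @[x --> +oo] --> (0 : R) ->
  (\forall x \near +oo, - g' x / b <= x * g'' x) -> False.
Proof.
move=> /andP[b0 b1] gg gg' g0 gc rc xg.
have xgc := cvg0_of_ratio g0 gc rc.
pose a := b / (1 - b).
have a0 : 0 < a by rewrite divr_gt0//; lra.
have aE : a / b = 1 + a by rewrite /a; field; rewrite !gt_eqF//; lra.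
have aV : 0 < (2 * a)^-1 by rewrite invr_gt0 mulr_gt0.
have rc2 : \forall x \near +oo, - (2 * a)^-1 <= x * g' x / g x.
  move/cvgrPdist_le : rc => /(_ _ aV); apply: filterS => x.
  by rewrite sub0r normrN ler_norml => /andP[].
have [A A1 HA] := (near_pinftyP _).1
  (filterI (filterI gg gg') (filterI (filterI g0 rc2) xg)).
pose G := fun x => g x + a * (x * g' x).
have dG x : A <= x -> is_derive (x : R) (1 : R) G (g' x + a * (g' x + x * g'' x)).
  move=> Ax; have [[dF dg] _] := HA x Ax.
  have d1 : is_derive (x : R) (1 : R) (fun x : R => x * g' x) (x *: g'' x + g' x *: 1).
    exact: (@is_deriveM _ _ id g').
  apply: is_derive_eq; rewrite /GRing.scale/=; ring.
have Gm : forall x y, A <= x -> x <= y -> G x <= G y.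
  apply: (derive_ge0_mono dG) => x Ax.
  have [_ [[gx g'x] xgx]] := HA x Ax.
  have : a * (- g' x / b) <= a * (x * g'' x) by rewrite ler_pM2l.
  have -> : a * (- g' x / b) = - g' x * (a / b) by ring.
  by rewrite aE mulrDr; lra.
have Gc : G x @[x --> +oo] --> (0 : R).
  have -> : 0 = 0 + a * 0 :> R by rewrite mulr0 addr0.
  by apply: cvgD => //; apply: cvgMl_tmp.
have GA : 0 < G A.
  have [_ [[gx g'x] _]] := HA A (lexx A).
  move: g'x; rewrite ler_pdivlMr// => h.
  have : a * (- (2 * a)^-1 * g A) <= a * (A * g' A) by rewrite ler_pM2l.
  have -> : a * (- (2 * a)^-1 * g A) = - (g A / 2) by field; rewrite gt_eqF.
  by rewrite /G; lra.
have G2 : 0 < G A / 2 by rewrite divr_gt0.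
have [x [Ax]] : exists x, A <= x /\ `|0 - G x| <= G A / 2.
  apply: (@filter_ex _ (pinfty_nbhs R)); apply: filterI; first exact: near_pinfty_ge.
  by move/cvgrPdist_le : Gc; exact.
by rewrite sub0r normrN ler_norml => /andP[_]; have := Gm _ _ (lexx A) Ax; lra.
Qed.

Lemma cvg_inv_ratio f g (c : R) : c != 0 -> f x / g x / x @[x --> +oo] --> c ->
  x * g x / f x @[x --> +oo] --> c^-1.
Proof.
move=> c0 /(cvgV c0); apply: near_eq_cvg_to; apply: nearW => x.
by rewrite !invfM !invrK; ring.
Qed.

Lemma lt0_neq0_near f : (\forall x \near +oo, f x < 0) -> \forall x \near +oo, f x != 0.
Proof. by apply: filterS => x fx; rewrite lt_eqF. Qed.

Lemma gt0_neq0_near f : (\forall x \near +oo, 0 < f x) -> \forall x \near +oo, f x != 0.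
Proof. by apply: filterS => x fx; rewrite gt_eqF. Qed.

(** The derivative of u = g / g' has a limit c in [-oo, +oo], and the index is 1 / c, read as 0 at
    -oo. A limit above -1 would make g decay at least as fast as some x^(-1/b) with b < 1, which
    keeps its antiderivative F bounded. *)
Lemma decreasing_index (H : set (germ R)) F g g' : hardy_field H ->
  hardy_fun H g -> hardy_fun H g' -> near_derive F g -> near_derive g g' ->
  (\forall x \near +oo, 0 < g x) -> (\forall x \near +oo, g' x < 0) ->
  F x @[x --> +oo] --> +oo ->
  exists2 c : R, -1 <= c <= 0 & x * g' x / g x @[x --> +oo] --> c.
Proof.
move=> HH Hg Hg' Fg gg g0 g'0 Foo.
have Hu := hardy_fun_div HH Hg Hg' (lt0_neq0_near g'0).
have [u' Hu' uu'] := hardy_fun_derive HH Hu.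
have noslow (b : R) : 0 < b < 1 -> ~ \forall x \near +oo, - b <= u' x.
  move=> /andP[b0 b1] ub.
  (* Passing from u' to u costs a little, so b is replaced by the midpoint of b and 1. *)
  have := @derive_lb _ u' (- b) (- ((b + 1) / 2)) uu' ub => /(_ ltac:(lra)) ug.
  apply: (@antiderivative_bounded F g g' ((b + 1) / 2)) Foo => //.
    by apply/andP; split; lra.
  have b2 : 0 < (b + 1) / 2 by lra.
  apply: filterS2 g'0 ug => x g'x; rewrite ler_ndivlMr// => ug.
  by rewrite ler_pdivlMr//; lra.
have [[c uc]|uc|uc] := hardy_fun_limit HH Hu'.
- have c1 : c <= -1.
    rewrite leNgt; apply/negP => c1.
    have [b /andP[b0 b1] bc] : exists2 b : R, 0 < b < 1 & - b < c.
      have [c0|c0] := ltP c 0; last by exists 2^-1; [apply/andP; split|]; lra.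
      by exists ((1 - c) / 2); [apply/andP; split|]; lra.
    apply: (@noslow b); first by rewrite b0.
    have cb : 0 < c + b by lra.
    move/cvgrPdist_le : uc => /(_ _ cb); apply: filterS => x.
    by rewrite ler_norml => /andP[]; lra.
  exists c^-1; last first.
    by apply: cvg_inv_ratio; [rewrite lt_eqF//; lra|exact: derive_cvg_ratio uc].
  rewrite invr_le0 (le_trans c1) ?andbT; last by lra.
  by rewrite -[leLHS]invrN1 lef_nV2 ?negrE//; lra.
- by exfalso; apply: (@noslow 2^-1); [apply/andP; split; lra|move/cvgryPge : uc].
- exists 0; first by rewrite lexx lerN10.
  apply/cvgrPdist_le => e e0.
  have u1 : \forall x \near +oo, u' x <= - (e^-1 + 1) by move/cvgrNyPle : uc.
  have := @derive_ub _ u' _ (- e^-1) uu' u1 => /(_ ltac:(lra)) ug.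
  apply: filterS (filterI (filterI g0 g'0) (filterI (near_pinfty_ge 1) ug)).
  move=> x [[gx g'x] [x1 /=]]; rewrite ler_ndivrMr// => xg.
  have {}xg : - (x * g' x) <= e * g x.
    have := ler_wpM2l (ltW e0) xg.
    by have -> : e * (- e^-1 * x * g' x) = - (x * g' x) by field; rewrite gt_eqF.
  have x0 : 0 < x by lra.
  have xg' : x * g' x < 0 by rewrite pmulr_rlt0.
  have eg : 0 < e * g x by exact: mulr_gt0.
  rewrite sub0r normrN ler_norml ler_pdivlMr// ler_pdivrMr//; apply/andP; split; lra.
Qed.

(** Index 0 for g does not determine the index of g', so the limit of v' for v = g' / g'' is
    examined directly: [decay_not_fast] excludes limits below -1 and [decay_not_slow] limits above
    -1. *)
Lemma slow_decrease_next_index (H : set (germ R)) g g' g'' : hardy_field H ->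
  hardy_fun H g' -> hardy_fun H g'' -> near_derive g g' -> near_derive g' g'' ->
  (\forall x \near +oo, 0 < g x) -> (\forall x \near +oo, g' x < 0) ->
  g x @[x --> +oo] --> (0 : R) -> x * g' x / g x @[x --> +oo] --> (0 : R) ->
  x * g'' x / g' x @[x --> +oo] --> (-1 : R).
Proof.
move=> HH Hg' Hg'' gg gg' g0 g'0 gc rc.
have g''0 : \forall x \near +oo, 0 < g'' x.
  (* A nonpositive g'' would keep g' below a negative constant and drive g to -oo. *)
  have bad : ~ \forall x \near +oo, g'' x <= 0.
    move=> s; have [A A1 HA] := (near_pinftyP _).1 (filterI gg' (filterI s g'0)).
    have g'A : g' A < 0 by have [_ []] := HA A (lexx A).
    have ub : \forall x \near +oo, g' x <= g' A.
      apply/near_pinftyP; exists A => // x.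
      exact: (derive_le0_mono (fun x Ax => (HA x Ax).1)
                (fun x Ax => (HA x Ax).2.1) (lexx A)).
    have := @derive_ub _ g' (g' A) (g' A / 2) gg ub => /(_ ltac:(lra)) ug.
    have [x [x1 [gx]]] : exists x, 1 <= x /\ (0 < g x /\ g x <= g' A / 2 * x).
      apply: (@filter_ex _ (pinfty_nbhs R)).
      by apply: filterI; [exact: near_pinfty_ge|exact: filterI].
    nra.
  have [s|//|s] := hardy_fun_sign HH Hg''; exfalso; apply: bad.
    by apply: filterS s => x ->.
  by apply: filterS s => x /ltW.
have Hv := hardy_fun_div HH Hg' Hg'' (gt0_neq0_near g''0).
have [v' Hv' vv'] := hardy_fun_derive HH Hv.
have nofast (b : R) : 1 < b -> ~ \forall x \near +oo, v' x <= - b.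
  move=> b1 vb.
  have := @derive_ub _ v' (- b) (- ((b + 1) / 2)) vv' vb => /(_ ltac:(lra)) vg.
  have b2 : 1 < (b + 1) / 2 by lra.
  apply: (decay_not_fast b2 gg gg' g0 g'0 gc rc).
  apply: filterS2 g''0 vg => x g''x; rewrite ler_pdivrMr// => vg.
  by rewrite ler_pdivlMr//; lra.
have noslow (b : R) : 0 < b < 1 -> ~ \forall x \near +oo, - b <= v' x.
  move=> /andP[b0 b1] vb.
  have := @derive_lb _ v' (- b) (- ((b + 1) / 2)) vv' vb => /(_ ltac:(lra)) vg.
  have b2 : 0 < (b + 1) / 2 < 1 by apply/andP; split; lra.
  apply: (decay_not_slow b2 gg gg' g0 gc rc).
  have [b3 _] := andP b2.
  apply: filterS2 g''0 vg => x g''x; rewrite ler_pdivlMr// => vg.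
  by rewrite ler_pdivrMr//; lra.
have [[c vc]|vc|vc] := hardy_fun_limit HH Hv'.
- have -> : -1 = c^-1 :> R.
    suff -> : c = -1 by rewrite invrN1.
    apply/eqP; rewrite eq_le; apply/andP; split; rewrite leNgt; apply/negP => h.
      have [b /andP[b0 b1] bc] : exists2 b : R, 0 < b < 1 & - b < c.
        have [c0|c0] := ltP c 0; last by exists 2^-1; [apply/andP; split|]; lra.
        by exists ((1 - c) / 2); [apply/andP; split|]; lra.
      apply: (@noslow b); first by rewrite b0.
      have cb : 0 < c + b by lra.
      move/cvgrPdist_le : vc => /(_ _ cb); apply: filterS => x.
      by rewrite ler_norml => /andP[]; lra.
    apply: (@nofast ((1 - c) / 2)); first by lra.
    have cb : 0 < (-1 - c) / 2 by lra.
    move/cvgrPdist_le : vc => /(_ _ cb); apply: filterS => x.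
    by rewrite ler_norml => /andP[]; lra.
  have vx := derive_cvg_ratio vv' vc.
  have [c0|c0] := eqVneq c 0; last exact: cvg_inv_ratio.
  exfalso; apply: (@noslow 2^-1); first by apply/andP; split; lra.
  have h2 : 0 < 2^-1 :> R by lra.
  move/cvgrPdist_le : vc => /(_ _ h2); apply: filterS => x.
  by rewrite c0 ler_norml => /andP[]; lra.
- by exfalso; apply: (@noslow 2^-1); [apply/andP; split; lra|move/cvgryPge : vc].
- by exfalso; apply: (@nofast 2); [lra|move/cvgrNyPle : vc].
Qed.

(** For u = h / h' we have u / x -> 1 / c. The limit of u' exists in [-oo, +oo] and by L'Hopital
    must be 1 / c; since u' = 1 - h h'' / h'^2, the index of h' is (1 - 1 / c) c = c - 1. *)
Lemma next_index (H : set (germ R)) h h' h'' (c : R) : hardy_field H ->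
  hardy_fun H h -> hardy_fun H h' -> near_derive h h' -> near_derive h' h'' ->
  c < 0 -> (\forall x \near +oo, h x != 0) ->
  x * h' x / h x @[x --> +oo] --> c ->
  (\forall x \near +oo, h' x != 0) /\ x * h'' x / h' x @[x --> +oo] --> c - 1.
Proof.
move=> HH Hh Hh' hh' hh'' c0 h0 hc.
have h'0 : \forall x \near +oo, h' x != 0.
  have cN : 0 < - c / 2 by lra.
  move/cvgrPdist_le : (hc) => /(_ _ cN); apply: filterS => x.
  rewrite ler_norml => /andP[h1 h2]; apply: contraTneq isT => h'x.
  by move: h1; rewrite h'x mulr0 mul0r; lra.
split=> //.
have Hu := hardy_fun_div HH Hh Hh' h'0.
have [w Hw uw] := hardy_fun_derive HH Hu.
have wE : \forall x \near +oo, w x = 1 - h x * h'' x / h' x ^+ 2.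
  apply: filterS (filterI (filterI hh' hh'') (filterI h'0 uw)).
  move=> x [[d1 d2] [h'x d3]].
  have d4 := @is_deriveV _ h' x _ _ h'x d2.
  have d5 := @is_deriveM _ _ h (fun y => (h' y)^-1) x 1 _ _ d1 d4.
  rewrite -(@derive_val _ _ _ _ _ _ _ d3) (@derive_val _ _ _ _ _ _ _ d5).
  by rewrite /GRing.scale/=; field.
have c1 : c != 0 by rewrite lt_eqF.
have ux : h x / h' x / x @[x --> +oo] --> c^-1.
  apply: (@near_eq_cvg_to (fun x => (x * h' x / h x)^-1)); last exact: cvgV c1 hc.
  by apply: nearW => x; rewrite !invfM invrK; ring.
have near1 : \forall x \near +oo, `|c^-1 - h x / h' x / x| <= 1.
  by move/cvgrPdist_le : ux; apply.
have [[d wd]|wd|wd] := hardy_fun_limit HH Hw.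
- have dE := norm_cvg_unique (derive_cvg_ratio uw wd) ux; rewrite dE in wd.
  have -> : c - 1 = (1 - c^-1) * c by field.
  apply: (@near_eq_cvg_to (fun x => (1 - w x) * (x * h' x / h x))).
    by apply: filterS3 h0 h'0 wE => x hx h'x ->; field; rewrite h'x.
  by apply: cvgM => //; apply: cvgB => //; exact: cvg_cst.
- have w1 : \forall x \near +oo, c^-1 + 3 <= w x by move/cvgryPge : wd.
  have := @derive_lb _ w _ (c^-1 + 2) uw w1 => /(_ ltac:(lra)) uu.
  have [x [x1 []]] : exists x, 1 <= x /\ (`|c^-1 - h x / h' x / x| <= 1 /\
      (c^-1 + 2) * x <= h x / h' x).
    apply: (@filter_ex _ (pinfty_nbhs R)).
    by apply: filterI; [exact: near_pinfty_ge|exact: filterI].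
  have x0 : 0 < x by lra.
  by rewrite -ler_pdivlMr// ler_norml => /andP[]; lra.
- have w1 : \forall x \near +oo, w x <= c^-1 - 3 by move/cvgrNyPle : wd.
  have := @derive_ub _ w _ (c^-1 - 2) uw w1 => /(_ ltac:(lra)) uu.
  have [x [x1 []]] : exists x, 1 <= x /\ (`|c^-1 - h x / h' x / x| <= 1 /\
      h x / h' x <= (c^-1 - 2) * x).
    apply: (@filter_ex _ (pinfty_nbhs R)).
    by apply: filterI; [exact: near_pinfty_ge|exact: filterI].
  have x0 : 0 < x by lra.
  by rewrite -ler_pdivrMr// ler_norml => /andP[]; lra.
Qed.
End RegularVariation.

(** * Regular variation of all derivatives of order above l *)

Section HardyChain.
Variable R : realType.
Implicit Types (f g h u : R -> R) (H : set (germ R)).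

Notation near_derive f g := (\forall x \near +oo, is_derive (x : R) (1 : R) f (g x)).

(** The two limits of [of_type_xplus] for positive functions, without quotients: in this form they
    pass from h to h' with l lowered by one. *)
Definition grows (l : nat) h : Prop :=
  (forall K, \forall x \near +oo, K * x ^+ l <= h x) /\
  (forall e, 0 < e -> \forall x \near +oo, h x <= e * x ^+ l.+1).

Lemma near_pinfty_double (P : R -> Prop) :
  (\forall x \near +oo, P x) -> \forall x \near +oo, P (2 * x).
Proof.
move=> /near_pinftyP[A A1 AP]; apply: filterS (near_pinfty_ge A) => x Ax.
by apply: AP; lra.
Qed.

Lemma near_mono H h h' : hardy_field H -> hardy_fun H h' -> near_derive h h' ->
  exists2 A : R, 1 <= A &
  (forall x y, A <= x -> x <= y -> h x <= h y) \/
  (forall x y, A <= x -> x <= y -> h y <= h x).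
Proof.
move=> HH Hh' hh'.
have [s|s] : (\forall x \near +oo, 0 <= h' x) \/ (\forall x \near +oo, h' x <= 0).
  by have [s|s|s] := hardy_fun_sign HH Hh'; [left|left|right];
    apply: filterS s => x; [move->|exact: ltW|exact: ltW].
- have [A A1 HA] := (near_pinftyP _).1 (filterI hh' s); exists A => //; left.
  exact: (derive_ge0_mono (fun x Ax => (HA x Ax).1) (fun x Ax => (HA x Ax).2)).
- have [A A1 HA] := (near_pinftyP _).1 (filterI hh' s); exists A => //; right.
  exact: (derive_le0_mono (fun x Ax => (HA x Ax).1) (fun x Ax => (HA x Ax).2)).
Qed.

(** h' is monotone because h'' lies in the field, and it cannot decrease since h would then be O(x).
    An increasing h' is compared with mean slopes of h: over [A, x] from below, over [x, 2 x] from
    above. *)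
Lemma grows_derive H h h' h'' l : hardy_field H -> hardy_fun H h'' ->
  near_derive h h' -> near_derive h' h'' -> grows l.+1 h -> grows l h'.
Proof.
move=> HH Hh'' hh' hh'' [lo up].
have [B B1 mono] := near_mono HH Hh'' hh''.
have [A0 A01 HA0] := (near_pinftyP _).1 hh'.
pose A := Num.max A0 B.
have A1 : 1 <= A by rewrite le_max A01.
have BA : B <= A by rewrite le_max lexx orbT.
have mv x y : A <= x -> x <= y -> exists2 c, x <= c <= y & h y - h x = h' c * (y - x).
  by move=> Ax; apply: mvt_half_line HA0 _ _ _; rewrite (le_trans _ Ax)// le_max lexx.
have {mono} inc : forall x y, A <= x -> x <= y -> h' x <= h' y.
  case: mono => [mono x y Ax|mono]; first by apply: mono; rewrite (le_trans BA).
  exfalso; pose K := `|h A| + `|h' A| + 1.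
  have K0 : 0 <= K by rewrite /K !addr_ge0.
  have [x [Ax]] : exists x, A <= x /\ K * x ^+ l.+1 <= h x.
    by apply: (@filter_ex _ (pinfty_nbhs R)); apply: filterI; [exact: near_pinfty_ge|exact: lo].
  have [c /andP[Ac cx] E] := mv _ _ (lexx A) Ax.
  have hc := mono _ _ BA Ac.
  have x1 : 1 <= x := le_trans A1 Ax.
  have : K * x <= K * x ^+ l.+1 by rewrite ler_wpM2l// ler_eXnr.
  have : h' c * (x - A) <= `|h' A| * x.
    rewrite (@le_trans _ _ (`|h' A| * (x - A)))//.
      by rewrite ler_wpM2r ?subr_ge0// (le_trans hc)// ler_norm.
    by rewrite ler_wpM2l//; lra.
  have : `|h A| <= `|h A| * x by rewrite ler_peMr.
  by have := ler_norm (h A); rewrite /K; lra.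
have bnd x : A <= x -> h x - h A <= h' x * (x - A).
  move=> Ax; have [c /andP[Ac cx] ->] := mv _ _ (lexx A) Ax.
  by rewrite ler_wpM2r ?subr_ge0// inc.
split=> [K|e e0].
  pose K' := `|K| + `|h A| + 1.
  apply: filterS2 (near_pinfty_ge A) (lo K') => x Ax hx.
  have x1 : 1 <= x := le_trans A1 Ax.
  have x0 : 0 < x by lra.
  have xl : 1 <= x ^+ l by rewrite exprn_ege1.
  have xl1 : 1 <= x ^+ l.+1 by rewrite exprn_ege1.
  have hA : h A <= `|h A| * x ^+ l.+1.
    by rewrite (le_trans (ler_norm _))// ler_peMr.
  have key : (`|K| + 1) * x ^+ l.+1 <= h' x * (x - A).
    by apply: le_trans (bnd x Ax); rewrite /K' in hx; lra.
  have xA : 0 <= x - A by rewrite subr_ge0.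
  have key0 : 0 < (`|K| + 1) * x ^+ l.+1.
    by rewrite mulr_gt0 ?exprn_gt0// ltr_wpDl.
  have h'0 : 0 <= h' x.
    by rewrite leNgt; apply/negP => h'x; have := mulr_le0_ge0 (ltW h'x) xA; lra.
  have : (`|K| + 1) * x ^+ l.+1 <= h' x * x by nra.
  rewrite exprSr mulrA ler_pM2r// => /(le_trans _); apply.
  by rewrite ler_wpM2r ?(le_trans _ xl)//; have := ler_norm K; lra.
(* The factor 2^(l+2) is lost when h is evaluated at 2 x. *)
have e1 : 0 < e / 2 ^+ l.+2 by rewrite divr_gt0// exprn_gt0.
have h0 := lo 0.
apply: filterS3 (near_pinfty_ge A) (near_pinfty_double (up _ e1)) h0 => x Ax hx hx0.
have x1 : 1 <= x := le_trans A1 Ax.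
have x0 : 0 < x by lra.
have x2 : x <= 2 * x by lra.
have [c /andP[xc c2] E] := mv _ _ Ax x2.
have h'c := inc _ _ Ax xc.
rewrite mul0r in hx0.
have Ee : e / 2 ^+ l.+2 * (2 * x) ^+ l.+2 = e * x ^+ l.+2.
  by rewrite exprMn mulrA divfK// expf_neq0.
rewrite Ee exprSr mulrA in hx.
rewrite -(ler_pM2r x0); nra.
Qed.

(** Here h -> +oo while h = o(x): the former forces h' > 0, the latter h' -> 0, and a positive
    function tending to 0 cannot be eventually nondecreasing. *)
Lemma grows0_derive H h h' h'' : hardy_field H -> hardy_fun H h' -> hardy_fun H h'' ->
  near_derive h h' -> near_derive h' h'' -> grows 0 h ->
  [/\ h x @[x --> +oo] --> +oo, \forall x \near +oo, 0 < h' x,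
      \forall x \near +oo, h'' x < 0 & h' x @[x --> +oo] --> (0 : R)].
Proof.
move=> HH Hh' Hh'' hh' hh'' [lo up].
have hoo : h x @[x --> +oo] --> +oo.
  by apply/cvgryPge => K; apply: filterS (lo K) => x; rewrite expr0 mulr1.
have h'0 : \forall x \near +oo, 0 < h' x.
  have bad : ~ \forall x \near +oo, h' x <= 0.
    move=> s; have [A A1 HA] := (near_pinftyP _).1 (filterI hh' s).
    have [x [Ax hx]] : exists x, A <= x /\ h A + 1 <= h x.
      apply: (@filter_ex _ (pinfty_nbhs R)); apply: filterI; first exact: near_pinfty_ge.
      by move/cvgryPge : hoo; exact.
    have := derive_le0_mono (fun x Ax => (HA x Ax).1) (fun x Ax => (HA x Ax).2) (lexx A) Ax.
    by lra.
  have [s|//|s] := hardy_fun_sign HH Hh'; exfalso; apply: bad;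
    apply: filterS s => x; [by move->|by move/ltW].
have mv := (near_pinftyP _).1 hh'.
(* The mean slope that bounds h' x from above is taken over [x, 2 x] if h' increases and over
   [x / 2, x] if h' decreases. *)
have small : forall e, 0 < e -> \forall x \near +oo, h' x <= e.
  move=> e e0; have [A0 A01 HA0] := mv.
  have [B B1 mono] := near_mono HH Hh'' hh''.
  have e4 : 0 < e / 4 by lra.
  have [C C1 HC] := (near_pinftyP _).1 (filterI (up _ e4) (lo 0)).
  pose A := Num.max A0 (Num.max B C).
  apply: filterS (near_pinfty_ge (2 * A)) => x Ax.
  have A0A : A0 <= A by rewrite le_max lexx.
  have BA : B <= A by rewrite !le_max lexx orbT.
  have CA : C <= A by rewrite !le_max lexx !orbT.
  have x0 : 0 < x by lra.
  case: mono => mono.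
    have A0x : A0 <= x by lra.
    have x2 : x <= 2 * x by lra.
    have [c /andP[xc c2] E] := mvt_half_line HA0 A0x x2.
    have h'c := mono x c ltac:(lra) xc.
    have [h1 _] := HC (2 * x) ltac:(lra).
    have [_ h2] := HC x ltac:(lra).
    rewrite expr1 mul0r in h1 h2.
    rewrite -(ler_pM2r x0); nra.
  have A0x : A0 <= x / 2 by lra.
  have x2 : x / 2 <= x by lra.
  have [c /andP[xc c2] E] := mvt_half_line HA0 A0x x2.
  have h'c := mono c x ltac:(lra) c2.
  have [h1 _] := HC x ltac:(lra).
  have [_ h2] := HC (x / 2) ltac:(lra).
  rewrite expr1 mul0r in h1 h2.
  rewrite -(ler_pM2r x0); nra.
have h'c : h' x @[x --> +oo] --> (0 : R).
  apply/cvgrPdist_le => e e0; apply: filterS2 (small e e0) h'0 => x h1 h2.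
  by rewrite sub0r normrN ger0_norm// ltW.
split=> //.
have bad : ~ \forall x \near +oo, 0 <= h'' x.
  move=> s; have [A A1 HA] := (near_pinftyP _).1 (filterI hh'' (filterI s h'0)).
  have h'A : 0 < h' A by have [_ []] := HA A (lexx A).
  have h'A2 : 0 < h' A / 2 by lra.
  have [x [Ax hx]] : exists x, A <= x /\ h' x <= h' A / 2.
    apply: (@filter_ex _ (pinfty_nbhs R)); apply: filterI; first exact: near_pinfty_ge.
    exact: small.
  have := derive_ge0_mono (fun x Ax => (HA x Ax).1) (fun x Ax => (HA x Ax).2.1) (lexx A) Ax.
  by lra.
have [s|s|//] := hardy_fun_sign HH Hh''; exfalso; apply: bad;
  apply: filterS s => x; [by move->|by move/ltW].
Qed.

Lemma hardy_chain H f : hardy_field H -> hardy_fun H f ->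
  exists F : nat -> R -> R, [/\ F 0%N = f, forall k, hardy_fun H (F k) &
    forall k, near_derive (F k) (F k.+1)].
Proof.
move=> HH Hf.
pose P h g := hardy_fun H h -> hardy_fun H g /\ near_derive h g.
have [D HD] : {D : (R -> R) -> (R -> R) & forall h, P h (D h)}.
  apply: choice => h; have [Hh|nHh] := pselect (hardy_fun H h); last by exists h.
  by have [g Hg hg] := hardy_fun_derive HH Hh; exists g.
exists (fun k => iter k D f); have HF k : hardy_fun H (iter k D f).
  by elim: k => //= k IH; have [] := HD _ IH.
by split=> // k; have [] := HD _ (HF k).
Qed.

(** The l-th derivative grows strictly between 1 and x, so the (l+1)-st decreases to 0 with an index
    c in [-1, 0], and theta = c + l + 1. Each further derivative lowers the index by 1. The general
    rule needs a negative index, so the case c = 0 at order l + 1, as for x^(l+1) / ln x, is treated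
    apart. *)
Lemma hardy_regular H f l : hardy_field H -> hardy_fun H f -> grows l f ->
  exists (F : nat -> R -> R) (theta : R),
  [/\ F 0%N = f, forall k, near_derive (F k) (F k.+1), l%:R <= theta <= l.+1%:R &
    forall k, (l < k)%N ->
      ((\forall x \near +oo, 0 < F k x) \/ (\forall x \near +oo, F k x < 0)) /\
      x * F k.+1 x / F k x @[x --> +oo] --> theta - k%:R].
Proof.
move=> HH Hf gf; have [F [F0 HF FD]] := hardy_chain HH Hf.
have gF k : (k <= l)%N -> grows (l - k) (F k).
  elim: k => [|k IH] kl; first by rewrite F0 subn0.
  apply: (grows_derive HH (HF k.+2) (FD k) (FD k.+1)).
  by rewrite -subSn// subSS; apply: IH; exact: ltnW.
have := gF l (leqnn _); rewrite subnn => gl.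
have [Foo g0 g'0 gc] := grows0_derive HH (HF l.+1) (HF l.+2) (FD l) (FD l.+1) gl.
have [c /andP[c1 c0] rc] := decreasing_index HH (HF l.+1) (HF l.+2) (FD l) (FD l.+1) g0 g'0 Foo.
exists F, (c + l.+1%:R); split=> //.
  by rewrite -(natr1 l); apply/andP; split; lra.
move=> k lk.
suff [h0 hc] : (\forall x \near +oo, F k x != 0) /\
    x * F k.+1 x / F k x @[x --> +oo] --> c + l.+1%:R - k%:R.
  split=> //; have [s|s|s] := hardy_fun_sign HH (HF k); [exfalso|by left|by right].
  have [x []] : exists x, F k x != 0 /\ F k x = 0.
    by apply: (@filter_ex _ (pinfty_nbhs R)); exact: filterI.
  by move=> /eqP.
have [j ->] : exists j, k = (l.+1 + j)%N by exists (k - l.+1)%N; rewrite subnKC.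
suff [h0 hc] : (\forall x \near +oo, F (l.+1 + j)%N x != 0) /\
    x * F (l.+1 + j).+1%N x / F (l.+1 + j)%N x @[x --> +oo] --> c - j%:R.
  by split=> //; rewrite natrD opprD addrA addrK.
elim: j => [|j [IH1 IH2]].
  by rewrite addn0 subr0; split=> //; exact: gt0_neq0_near.
rewrite addnS; have [cj|cj] := ltP (c - j%:R) 0.
  have [h0 hc] := next_index HH (HF _) (HF _) (FD _) (FD _) cj IH1 IH2.
  by split=> //; rewrite -(natr1 j) opprD addrA.
have j0 : j = 0%N.
  by apply/eqP; rewrite -leqn0 -(ler_nat R); have := ler0n R j; lra.
have cE : c = 0 by move: cj; rewrite j0 subr0; lra.
rewrite j0 addn0 in IH1 IH2 *; rewrite cE in rc *.
split; first exact: lt0_neq0_near.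
rewrite sub0r; exact: (slow_decrease_next_index HH (HF _) (HF _) (FD _) (FD _) g0 g'0 gc rc).
Qed.
End HardyChain.

(** * Power bounds for the derivatives, uniform under bounded dilation *)

Section Size.
Variable R : realType.
Implicit Types (f g h u : R -> R) (H : set (germ R)).

Notation near_derive f g := (\forall x \near +oo, is_derive (x : R) (1 : R) f (g x)).

Lemma of_type_grows l f : of_type_xplus l f -> (\forall x \near +oo, 0 < f x) ->
  grows l f.
Proof.
move=> [_ lo up] f0; split=> [K|e e0].
  pose e := (`|K| + 1)^-1; have e0 : 0 < e by rewrite invr_gt0 ltr_wpDl.
  move/cvgrPdist_le : lo => /(_ e e0) lo.
  apply: filterS3 f0 lo (near_pinfty_ge 1) => x fx.
  rewrite sub0r normrN ler_norml => /andP[_]; rewrite ler_pdivrMr// => xf x1.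
  rewrite (@le_trans _ _ ((`|K| + 1) * x ^+ l))//.
    by rewrite ler_wpM2r ?exprn_ge0//; [lra|have := ler_norm K; lra].
  by rewrite -ler_pdivlMl ?ltr_wpDl.
move/cvgrPdist_le : up => /(_ e e0) up.
apply: filterS2 up (near_pinfty_ge 1) => x.
rewrite sub0r normrN ler_norml => /andP[_ + x1]; rewrite ler_pdivrMr//.
by rewrite exprn_gt0//; lra.
Qed.

Lemma near_pinfty_ln_ge (K : R) : \forall x \near +oo, K <= ln x.
Proof.
apply: filterS (near_pinfty_ge (expR K)) => x Kx.
have x0 := lt_le_trans (expR_gt0 K) Kx.
by rewrite -ler_expR lnK.
Qed.

(** Since x h' / h <= c, the function ln h - c ln x is nonincreasing from some A on, and e ln x
    eventually exceeds its value at A. *)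
Lemma ln_size_ub h h' (c e : R) : near_derive h h' -> (\forall x \near +oo, 0 < h x) ->
  (\forall x \near +oo, x * h' x / h x <= c) -> 0 < e ->
  \forall x \near +oo, ln (h x) <= (c + e) * ln x.
Proof.
move=> hh' h0 hc e0.
have [A A1 HA] := (near_pinftyP _).1 (filterI hh' (filterI h0 hc)).
pose D := fun x => ln (h x) - c * ln x.
have dD x : A <= x -> is_derive (x : R) (1 : R) D (h' x / h x - c / x).
  move=> Ax; have [d [hx _]] := HA x Ax; have x0 : 0 < x by lra.
  have d1 := is_derive1_comp (is_derive1_ln hx) d.
  have d2 := is_derive1_ln x0.
  apply: is_derive_eq; rewrite /GRing.scale/=; ring.
have Dm : forall x y, A <= x -> x <= y -> D y <= D x.
  apply: (derive_le0_mono dD) => x Ax; have [_ [hx hcx]] := HA x Ax.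
  have x0 : 0 < x by lra.
  by rewrite subr_le0 ler_pdivlMr// mulrC mulrA.
apply: filterS2 (near_pinfty_ge A) (near_pinfty_ln_ge (D A / e)) => x Ax.
rewrite ler_pdivrMr// => lx; have := Dm _ _ (lexx A) Ax; rewrite {1}/D; lra.
Qed.

Lemma ln_size_lb h h' (c e : R) : near_derive h h' -> (\forall x \near +oo, 0 < h x) ->
  (\forall x \near +oo, c <= x * h' x / h x) -> 0 < e ->
  \forall x \near +oo, (c - e) * ln x <= ln (h x).
Proof.
move=> hh' h0 hc e0.
have [A A1 HA] := (near_pinftyP _).1 (filterI hh' (filterI h0 hc)).
pose D := fun x => ln (h x) - c * ln x.
have dD x : A <= x -> is_derive (x : R) (1 : R) D (h' x / h x - c / x).
  move=> Ax; have [d [hx _]] := HA x Ax; have x0 : 0 < x by lra.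
  have d1 := is_derive1_comp (is_derive1_ln hx) d.
  have d2 := is_derive1_ln x0.
  apply: is_derive_eq; rewrite /GRing.scale/=; ring.
have Dm : forall x y, A <= x -> x <= y -> D x <= D y.
  apply: (derive_ge0_mono dD) => x Ax; have [_ [hx hcx]] := HA x Ax.
  have x0 : 0 < x by lra.
  by rewrite subr_ge0 ler_pdivrMr// [leRHS]mulrC mulrA.
apply: filterS2 (near_pinfty_ge A) (near_pinfty_ln_ge (- D A / e)) => x Ax.
rewrite ler_pdivrMr// => lx; have := Dm _ _ (lexx A) Ax; rewrite {2}/D; lra.
Qed.

(** Dilation by a bounded factor changes ln x by a bounded amount only. The factor 32 has room for
    every argument q u or t u met in the Type I and Type II sums. *)
Lemma size_window_pos h h' (c e : R) : near_derive h h' -> (\forall x \near +oo, 0 < h x) ->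
  x * h' x / h x @[x --> +oo] --> c -> 0 < e ->
  \forall x \near +oo, forall y, x / 32 <= y -> y <= 32 * x ->
    x `^ (c - e) <= h y <= x `^ (c + e).
Proof.
move=> hh' h0 /cvgrPdist_le hc e0.
have e4 : 0 < e / 4 by lra.
have U := @ln_size_ub h h' (c + e / 4) _ hh' h0 _ e4.
have L := @ln_size_lb h h' (c - e / 4) _ hh' h0 _ e4.
have {}U := U ltac:(by apply: filterS (hc _ e4) => x; rewrite ler_norml => /andP[]; lra).
have {}L := L ltac:(by apply: filterS (hc _ e4) => x; rewrite ler_norml => /andP[]; lra).
have [A A1 HA] := (near_pinftyP _).1 (filterI h0 (filterI U L)).
pose K := ln 32 : R.
have K0 : 0 <= K by rewrite ln_ge0//; lra.
apply: filterS2 (near_pinfty_ge (32 * A))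
  (near_pinfty_ln_ge (2 * (`|c| + e) * K / e)) => x Ax; rewrite ler_pdivrMr// => lx y y1 y2.
have [hy [uy ly]] := HA y ltac:(lra).
have x0 : 0 < x by lra.
have y0 : 0 < y by lra.
have ly1 : ln x - K <= ln y.
  rewrite -ln_div ?posrE// ler_ln ?posrE//; lra.
have ly2 : ln y <= ln x + K.
  rewrite -lnM ?posrE// ler_ln ?posrE//; lra.
have cn := ler_norm c; have cn' := ler_norm (- c); rewrite normrN in cn'.
have n0 := normr_ge0 c.
have ly0 : 0 <= ln y by apply: ln_ge0; lra.
have b1 : (c + e / 2) * ln y <= (c + e) * ln x.
  have t1 : c * (ln y - ln x) <= `|c| * K.
    rewrite (le_trans (ler_norm _))// normrM ler_wpM2l// ler_norml.
    by apply/andP; split; lra.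
  have t2 : e / 2 * (ln y - ln x) <= e / 2 * K by rewrite ler_wpM2l//; lra.
  have t3 : 0 <= e * K by rewrite mulr_ge0// ltW.
  lra.
have b2 : (c - e) * ln x <= (c - e / 2) * ln y.
  have t1 : c * (ln x - ln y) <= `|c| * K.
    rewrite (le_trans (ler_norm _))// normrM ler_wpM2l// ler_norml.
    by apply/andP; split; lra.
  have t2 : e / 2 * (ln y - ln x) <= e / 2 * K by rewrite ler_wpM2l//; lra.
  have t3 : 0 <= e * K by rewrite mulr_ge0// ltW.
  lra.
rewrite /powR !gt_eqF//; apply/andP; split.
  by rewrite -[leRHS]lnK ?posrE// ler_expR; lra.
by rewrite -[leLHS]lnK ?posrE// ler_expR; lra.
Qed.

(** The sign s lets one statement serve both signs of h. The estimate y h' = c h up to relative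
    error e is needed when dilates of f are subtracted from each other. *)
Lemma size_window h h' (c e : R) : near_derive h h' ->
  (\forall x \near +oo, 0 < h x) \/ (\forall x \near +oo, h x < 0) ->
  x * h' x / h x @[x --> +oo] --> c -> 0 < e ->
  exists2 s : R, (s == 1) || (s == -1) &
  \forall x \near +oo, forall y, x / 32 <= y -> y <= 32 * x ->
    (x `^ (c - e) <= s * h y <= x `^ (c + e)) /\
    `|s * (y * h' y) - c * (s * h y)| <= e * (s * h y).
Proof.
move=> hh' sh hc e0.
have bound s : (\forall x \near +oo, 0 < s * h x) -> 
    \forall x \near +oo, forall y, x / 32 <= y -> y <= 32 * x ->
     `|s * (y * h' y) - c * (s * h y)| <= e * (s * h y).
  move=> s0; move/cvgrPdist_le : (hc) => /(_ e e0) hce.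
  have [A A1 HA] := (near_pinftyP _).1 (filterI s0 hce).
  apply: filterS (near_pinfty_ge (32 * A)) => x xA y y1 y2.
  have [sy] := HA y ltac:(lra); rewrite /= => cy.
  have hy : h y != 0 by apply: contraTneq sy => ->; rewrite mulr0 ltxx.
  have -> : s * (y * h' y) - c * (s * h y) = - (s * h y * (c - y * h' y / h y)) by field.
  by rewrite normrN normrM (gtr0_norm sy) mulrC ler_pM2r.
case: sh => s0.
  exists 1; first by rewrite eqxx.
  have W := size_window_pos hh' s0 hc e0.
  have B := bound 1 ltac:(by apply: filterS s0 => x; rewrite mul1r).
  apply: filterS2 W B => x W B y y1 y2; split; last exact: B.
  by rewrite mul1r; exact: W.
exists (-1); first by rewrite eqxx orbT.
have B := bound (-1) ltac:(by apply: filterS s0 => x; rewrite mulN1r oppr_gt0).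
have W : \forall x \near +oo, forall y, x / 32 <= y -> y <= 32 * x ->
    x `^ (c - e) <= - h y <= x `^ (c + e).
  apply: (@size_window_pos (fun x => - h x) (fun x => - h' x)) => //.
  - by apply: filterS hh' => x d; apply: is_deriveN.
  - by apply: filterS s0 => x; rewrite oppr_gt0.
  - apply: near_eq_cvg_to hc; apply: nearW => x.
    by rewrite mulrN invrN mulrNN.
apply: filterS2 W B => x W B y y1 y2; split; last exact: B.
by rewrite mulN1r; exact: W.
Qed.

Definition regular_chain (l : nat) (theta : R) (F : nat -> R -> R) : Prop :=
  [/\ forall k, near_derive (F k) (F k.+1), l%:R <= theta <= l.+1%:R &
    forall k, (l < k)%N ->
      ((\forall x \near +oo, 0 < F k x) \/ (\forall x \near +oo, F k x < 0)) /\
      x * F k.+1 x / F k x @[x --> +oo] --> theta - k%:R].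

(** Weyl's criterion concerns h f + phi rather than f. The constant disappears after one
    differentiation, and indices are prescribed only for k > l, so theta is unchanged. *)
Lemma regular_chain_affine l theta F (a b : R) : a != 0 -> regular_chain l theta F ->
  regular_chain l theta (fun k x => a * F k x + (k == 0%N)%:R * b).
Proof.
move=> a0 [FD lt Fk]; split=> // [k|k lk].
  apply: filterS (FD k) => x d; apply: is_derive_eq.
  by rewrite /= mul0r /GRing.scale/=; ring.
have [sF rF] := Fk k lk.
have E j (x : R) : (l < j)%N -> a * F j x + (j == 0%N)%:R * b = a * F j x.
  by case: j => // j _; rewrite mul0r addr0.
split; last first.
  apply: near_eq_cvg_to rF; apply: nearW => x; rewrite !E ?(leqW lk)//.
  by rewrite mulrCA invfM mulrACA divff// mul1r.
have [a1|a1] := ltP 0 a.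
  by case: sF => s; [left|right]; apply: filterS s => x Fx; rewrite E// (pmulr_rgt0, pmulr_rlt0).
have a2 : a < 0 by rewrite lt_neqAle a0.
by case: sF => s; [right|left]; apply: filterS s => x Fx; rewrite E// (nmulr_rlt0, nmulr_rgt0).
Qed.

Lemma hardy_regular_chain (f : continuousType R R) l : hardy_union (to_germ f) ->
  of_type_xplus l f ->
  exists (F : nat -> R -> R) (theta : R), F 0%N = f /\ regular_chain l theta F.
Proof.
move=> [H HH Hf] ft; have Hf' : hardy_fun H f by exists f => //; exact: nearW.
have [f0 lo up] := ft.
have cf : continuous f by move=> x; exact: cts_fun.
have [s|s] := eventually_neq0_sign cf f0.
  have [F [theta [F0 FD lt Fk]]] := hardy_regular HH Hf' (of_type_grows ft s).
  by exists F, theta.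
have Nt : of_type_xplus l (fun x => - f x).
  split; first by apply: filterS f0 => x; rewrite oppr_eq0.
    rewrite -[X in _ --> X]oppr0; apply: near_eq_cvg_to (cvgN lo).
    by apply: nearW => x; rewrite invrN mulrN.
  rewrite -[X in _ --> X]oppr0; apply: near_eq_cvg_to (cvgN up).
  by apply: nearW => x; rewrite mulNr.
have Ns : \forall x \near +oo, 0 < - f x by apply: filterS s => x; rewrite oppr_gt0.
have [F [theta [F0 FD lt Fk]]] := hardy_regular HH (hardy_funN HH Hf') (of_type_grows Nt Ns).
have N0 : -1 != 0 :> R by rewrite oppr_eq0 oner_eq0.
exists (fun k x => -1 * F k x + (k == 0%N)%:R * 0), theta; split.
  by apply/funext => x; rewrite F0 mulr0 addr0 mulN1r opprK.
exact: regular_chain_affine.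
Qed.
End Size.

(** * Exponential sums and the derivative test *)

Section PeriodicCosine.
Variable R : realType.
Implicit Types (t u : R) (z : int).

Definition cosp t : R := cos (t * (pi *+ 2)).
Definition sinp t : R := sin (t * (pi *+ 2)).

Lemma cosp_le1 t : `|cosp t| <= 1.
Proof. exact: cos_max. Qed.

Lemma cospN t : cosp (- t) = cosp t.
Proof. by rewrite /cosp mulNr cosN. Qed.

Lemma cosp0 : cosp 0 = 1.
Proof. by rewrite /cosp mul0r cos0. Qed.

Lemma cospB t u : cosp (t - u) = cosp t * cosp u + sinp t * sinp u.
Proof. by rewrite /cosp mulrBl cosB. Qed.

Lemma cospDn t n : cosp (t + n%:R) = cosp t.
Proof.
have := periodicn (@cosD2pi R) n (t * (pi *+ 2)); rewrite /cosp => <-.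
by congr cos; rewrite mulrDl mulr_natl.
Qed.

Lemma cospDz t z : cosp (t + z%:~R) = cosp t.
Proof.
case: z => n; first exact: cospDn.
by rewrite NegzE mulrNz -[LHS](cospDn _ n.+1) subrK.
Qed.

Lemma cos_lipschitz t u : `|cos t - cos u| <= `|t - u|.
Proof.
wlog tu : t u / t <= u => [W|].
  by case: (leP t u) => [/W//|/ltW/W]; rewrite distrC (distrC u).
have [|c _ E] := @MVT_segment R cos (fun x => - sin x) t u tu.
  by apply: continuous_subspaceT => x; exact: continuous_cos.
by rewrite distrC E normrM normrN (distrC t) ler_piMl// sin_max.
Qed.

Lemma cosp_lipschitz t u : `|cosp t - cosp u| <= 8 * `|t - u|.
Proof.
apply: (le_trans (cos_lipschitz _ _)).
rewrite -mulrBl normrM mulrC ler_wpM2r//.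
have p0 := pi_gt0 R; have p2 := pihalf_lt2 R.
by rewrite -mulr_natr ger0_norm; lra.
Qed.

Definition near_int (D : R) t : bool := `[< exists z, `|t - z%:~R| <= D >].

(** By the mean value theorem sin (D pi) = cos c * D pi with 0 <= c <= pi / 4, where cos c >= 1/2;
    and pi >= 2. *)
Lemma sin_pi_ge (D : R) : 0 <= D <= 4^-1 -> D <= sin (D * pi).
Proof.
move=> /andP[D0 D4]; have p0 := pi_gt0 R; have p2 := pi_ge2 R.
have [||c cI E] := @MVT_segment R sin cos 0 (D * pi).
- by rewrite mulr_ge0// ltW.
- by apply: continuous_subspaceT => x; exact: continuous_sin.
move: E; rewrite sin0 !subr0 => ->.
have c14 : cos (pi / 4) ^+ 2 = (2^-1 : R).
  have := cos_mulr2n (pi / 4 : R).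
  have -> : pi / 4 *+ 2 = pi / 2 :> R by rewrite -mulr_natr; field.
  by rewrite cos_pihalf -mulr_natr; lra.
have c14p : 0 < cos (pi / 4 : R) by apply: cos_gt0_pihalf; apply/andP; split; lra.
have c14h : 2^-1 <= cos (pi / 4 : R).
  rewrite leNgt; apply/negP => h; have : cos (pi / 4 : R) ^+ 2 < 2^-1 ^+ 2.
    by rewrite ltr_sqr ?nnegrE// ?ltW.
  by rewrite c14; lra.
have : cos (pi / 4) <= cos c.
  move: cI; rewrite in_itv/= => /andP[c0 cD].
  have cq : c <= pi / 4 by nra.
  rewrite leNgt; apply/negP => h.
  have : pi / 4 < c.
    rewrite -(@ltr_cos R (pi / 4) c)//; rewrite in_itv/=; apply/andP; split; lra.
  by rewrite ltNge cq.
by move=> h; rewrite mulrCA ler_peMr//; nra.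
Qed.

(** Multiplying by 2 sin (pi b) makes the sum telescope to a difference of two sines, and |sin (pi
    b)| >= D when b is at distance more than D from the integers. *)
Lemma geometric_cos (b a D : R) (m : nat) : 0 < D <= 4^-1 -> ~~ near_int D b ->
  `|\sum_(h < m) cosp (a + h%:R * b)| <= D^-1.
Proof.
move=> /andP[D0 D4] nb.
have sb : D <= `|sin (b * pi)|.
  pose z := Num.floor (b + 2^-1); pose t := b - z%:~R.
  have /andP[z1 z2] := floor_itv (b + 2^-1); rewrite -/z intrD in z1 z2.
  have tD : D < `|t|.
    by rewrite ltNge; apply: contra nb => tD; apply/asboolP; exists z.
  have t2 : `|t| <= 2^-1 by rewrite ler_norml /t; apply/andP; split; lra.
  have sz (x : R) : `|sin ((x + z%:~R) * pi)| = `|sin (x * pi)|.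
    have sn (y : R) (n : nat) : `|sin ((y + n%:R) * pi)| = `|sin (y * pi)|.
      rewrite mulrDl mulr_natl (alternatingn (@sinDpi R)) normrM normrX.
      by rewrite normrN1 expr1n mul1r.
    case: (z) => n; first exact: sn.
    by rewrite NegzE mulrNz -[LHS](sn _ n.+1) subrK.
  have -> : `|sin (b * pi)| = sin (`|t| * pi).
    rewrite -(subrK z%:~R b) sz -/t.
    have p0 := pi_gt0 R.
    have st : 0 <= sin (`|t| * pi).
      apply: sin_ge0_pi; rewrite mulr_ge0//=; last exact: ltW.
      by rewrite ler_piMl ?ltW//; lra.
    rewrite -[RHS]ger0_norm//; have [t0|t0] := lerP 0 t; first by rewrite (ger0_norm t0).
    by rewrite (ltr0_norm t0) mulNr sinN normrN.
  have := @sin_pi_ge D; rewrite ltW// D4 => /(_ isT)/le_trans; apply.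
  have p0 := pi_gt0 R.
  rewrite leNgt; apply/negP => h.
  have : `|t| * pi < D * pi.
    rewrite -(@ltr_sin R)// ?in_itv/=; apply/andP; split; nra.
  by rewrite ltr_pM2r// ltNge ltW.
have tel : 2 * sin (b * pi) * \sum_(h < m) cosp (a + h%:R * b) =
   sin ((a + m%:R * b - b / 2) * (pi *+ 2)) - sin ((a - b / 2) * (pi *+ 2)).
  elim: m => [|m IH]; first by rewrite big_ord0 mulr0 mul0r addr0 subrr.
  rewrite big_ord_recr /= mulrDr IH.
  set x := (a + m%:R * b) * (pi *+ 2); set y := b * pi.
  have -> : (a + m.+1%:R * b - b / 2) * (pi *+ 2) = x + y.
    by rewrite /x /y -natr1 -mulr_natr; field.
  have -> : (a + m%:R * b - b / 2) * (pi *+ 2) = x - y.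
    by rewrite /x /y -mulr_natr; field.
  by rewrite /cosp -/x (sinD x y) (sinB x y); ring.
have : `|2 * sin (b * pi) * \sum_(h < m) cosp (a + h%:R * b)| <= 2.
  rewrite tel (le_trans (ler_normB _ _))//.
  by have -> : (2 : R) = 1 + 1 by []; rewrite lerD// sin_max.
rewrite !normrM [`|2|]ger0_norm// -mulrA ger_pMr// => h.
have s0 := lt_le_trans D0 sb.
by rewrite -[leRHS]mul1r ler_pdivlMr// mulrC (le_trans _ h)// ler_wpM2r.
Qed.

(** The right side is the squared modulus of the complex sum of a_i e(g_i); the square of its sine
    part is discarded. *)
Lemma sqr_sum_cosp (I : finType) (a g : I -> R) :
  (\sum_i a i * cosp (g i)) ^+ 2 <=
    \sum_i \sum_j a i * a j * cosp (g i - g j).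
Proof.
have -> : \sum_i \sum_j a i * a j * cosp (g i - g j) =
  (\sum_i a i * cosp (g i)) ^+ 2 + (\sum_i a i * sinp (g i)) ^+ 2.
  rewrite !expr2 !big_distrlr/= -big_split; apply: eq_bigr => i _ /=.
  by rewrite -big_split; apply: eq_bigr => j _ /=; rewrite cospB; ring.
by rewrite lerDl sqr_ge0.
Qed.

Lemma big_triangle (m : nat) (F : nat -> nat -> R) :
  \sum_(j < m) \sum_(i < j) F i j =
    \sum_(1 <= t < m) \sum_(h < m - t) F h (h + t)%N.
Proof.
elim: m => [|m IH]; first by rewrite big_ord0 big_geq.
rewrite big_ord_recr /= IH; case: m {IH} => [|m].
  by rewrite big_ord0 !big_geq// addr0.
have E : \sum_(h < m.+2 - m.+1) F h (h + m.+1)%N = F 0%N m.+1.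
  by rewrite subSnn big_ord_recl big_ord0 addr0.
rewrite [RHS]big_nat_recr//= E {E}.
rewrite [\sum_(i < m.+1) _](reindex_inj rev_ord_inj) big_ord_recr/= subnn.
rewrite addrA; congr (_ + _).
rewrite -[X in _ + X](big_mkord xpredT (fun i => F (m.+1 - i.+1)%N m.+1)).
rewrite -[X in _ + X](big_add1 _ _ 0 m.+1 xpredT (fun i => F (m.+1 - i)%N m.+1)).
rewrite -big_split /= [LHS]big_nat [RHS]big_nat; apply: eq_bigr => t /andP[t1 tm].
by rewrite [in RHS]subSn ?(ltnW tm)// big_ord_recr/= subnK// ltnW.
Qed.

Lemma weyl_differencing (m : nat) (phi : nat -> R) :
  (\sum_(h < m) cosp (phi h)) ^+ 2 <=
    m%:R + 2 * \sum_(1 <= t < m) \sum_(h < m - t) cosp (phi (h + t)%N - phi h).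
Proof.
have := @sqr_sum_cosp 'I_m (fun=> 1) (fun i => phi i).
under eq_bigr do rewrite mul1r.
move/le_trans; apply.
rewrite -(big_triangle m (fun i j => cosp (phi j - phi i))).
have -> : \sum_(i < m) \sum_(j < m) 1 * 1 * cosp (phi i - phi j) =
  \sum_(i < m) \sum_(j < m) cosp (phi i - phi j).
  by apply: eq_bigr => i _; apply: eq_bigr => j _; rewrite !mul1r.
elim: m => [|m IH]; first by rewrite !big_ord0 mulr0 addr0.
rewrite [X in X <= _]big_ord_recr /= [X in _ + X <= _]big_ord_recr/= subrr cosp0.
under eq_bigr do rewrite big_ord_recr/=.
rewrite big_split/= [in leRHS]big_ord_recr/=.
have -> : \sum_(i < m) cosp (phi i - phi m) = \sum_(i < m) cosp (phi m - phi i).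
  by apply: eq_bigr => i _; rewrite -cospN opprB.
by rewrite -natr1; lra.
Qed.

(* Equivalently, [phi] is a polynomial of degree at most [r] whose coefficient
   of degree [r] is [b / r!]. *)
Fixpoint poly_phase (r : nat) (b : R) (phi : nat -> R) : Prop :=
  if r is r'.+1 then poly_phase r' b (fun h => phi h.+1 - phi h)
  else forall h, phi h = b.

Lemma poly_phase_ext r b phi psi :
  phi =1 psi -> poly_phase r b phi -> poly_phase r b psi.
Proof. by move=> /funext->. Qed.

Lemma poly_phaseD r b c phi psi : poly_phase r b phi -> poly_phase r c psi ->
  poly_phase r (b + c) (fun h => phi h + psi h).
Proof.
elim: r phi psi => [|r IH] phi psi /= pb pc; first by move=> h; rewrite pb pc.
by apply: poly_phase_ext (IH _ _ pb pc) => h /=; ring.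
Qed.

Lemma poly_phase0 r : poly_phase r 0 (fun=> 0).
Proof. by elim: r => //= r IH; apply: poly_phase_ext IH => h; rewrite subrr. Qed.

Lemma poly_phase_shift r b phi (t : nat) :
  poly_phase r b phi -> poly_phase r b (fun h => phi (h + t)%N).
Proof. by elim: r phi => [|r IH] phi /= pb; [move=> h|exact: (IH _ pb)]. Qed.

Lemma poly_phase_diff r b phi (t : nat) : poly_phase r.+1 b phi ->
  poly_phase r (t%:R * b) (fun h => phi (h + t)%N - phi h).
Proof.
move=> /= pb; elim: t => [|t IH].
  rewrite mul0r; apply: poly_phase_ext (poly_phase0 r) => h.
  by rewrite addn0 subrr.
rewrite -natr1 mulrDl mul1r.
apply: poly_phase_ext (poly_phaseD IH (poly_phase_shift t pb)) => h /=.
by rewrite -addnS; ring.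
Qed.

Lemma poly_phase1 b phi : poly_phase 1 b phi -> forall h, phi h = phi 0%N + h%:R * b.
Proof.
move=> /= pb; elim=> [|h IH]; first by rewrite mul0r addr0.
by rewrite -(subrK (phi h) (phi h.+1)) pb IH -natr1; ring.
Qed.

Lemma sqr_sum_le (N : nat) (a : nat -> R) :
  (\sum_(n < N) a n) ^+ 2 <= N%:R * \sum_(n < N) a n ^+ 2.
Proof.
have : 0 <= \sum_(i < N) \sum_(j < N) (a i - a j) ^+ 2.
  by apply: sumr_ge0 => i _; apply: sumr_ge0 => j _; exact: sqr_ge0.
have -> : \sum_(i < N) \sum_(j < N) (a i - a j) ^+ 2 =
   2 * (N%:R * \sum_(n < N) a n ^+ 2 - (\sum_(n < N) a n) ^+ 2).
  have -> : N%:R * \sum_(n < N) a n ^+ 2 = \sum_(i < N) \sum_(j < N) a j ^+ 2.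
    by rewrite sumr_const card_ord mulr_natl.
  have E : \sum_(i < N) \sum_(j < N) a j ^+ 2 = \sum_(i < N) \sum_(j < N) a i ^+ 2.
    by rewrite exchange_big.
  rewrite [X in 2 * (X - _)](_ : _ = 2^-1 * (\sum_(i < N) \sum_(j < N) a j ^+ 2
    + \sum_(i < N) \sum_(j < N) a i ^+ 2)); last by rewrite -E; field.
  rewrite -big_split/= expr2 big_distrlr/= mulr_sumr -sumrB mulr_sumr.
  apply: eq_bigr => i _; rewrite -big_split/= mulr_sumr -sumrB mulr_sumr.
  by apply: eq_bigr => j _; field.
by lra.
Qed.
End PeriodicCosine.

(** * Weyl differencing on average and local polynomial approximation *)

Section DerivativeTest.
Variable R : realType.

(** Each Weyl step, after Cauchy-Schwarz over n, squares the required saving and multiplies the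
    leading coefficient by some t < H: hence d^(2^r) and the multipliers q <= H^r. At degree 1 the
    sums are geometric, except for the few n with q beta_n near an integer, which are bounded
    trivially. The lengths m n vary because differencing shortens the sums. *)
Lemma weyl_average (r N H : nat) (phi : nat -> nat -> R) (beta : nat -> R)
    (m : nat -> nat) (D rho d : R) : (0 < H)%N -> 0 <= d <= 1 -> 0 < D <= 4^-1 ->
  H%:R^-1 <= d ^+ (2 ^ r) -> rho + (H%:R * D)^-1 <= d ^+ (2 ^ r) ->
  (forall n, (n < N)%N -> poly_phase r.+1 (beta n) (phi n)) ->
  (forall n, (m n <= H)%N) ->
  (forall q, (0 < q)%N -> (q <= H ^ r)%N ->
    \sum_(n < N) (near_int D (q%:R * beta n))%:R <= rho * N%:R) ->
  \sum_(n < N) `|\sum_(h < m n) cosp (phi n h)| <= 3 * d * (N%:R * H%:R).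
Proof.
move=> H0 d01 D0 Hd; have H0R : 0 < H%:R :> R by rewrite ltr0n.
have N0R : 0 <= N%:R :> R by rewrite ler0n.
have d0 : 0 <= d by case/andP: d01.
elim: r d d0 d01 Hd phi beta m => [|r IH] d d0 d01 Hd phi beta m rd pp mH eq.
  rewrite expn0 expr1 in rd; move: eq => /(_ 1%N isT isT) eq.
  have T (n : 'I_N) : `|\sum_(h < m n) cosp (phi n h)| <=
      H%:R * (near_int D (1%:R * beta n))%:R + D^-1.
    have [D0' _] := andP D0; have DV0 : 0 <= D^-1 by rewrite invr_ge0 ltW.
    case: (boolP (near_int _ _)) => [_|nb].
      rewrite mulr1 (le_trans (ler_norm_sum _ _ _))//.
      rewrite (@le_trans _ _ (\sum_(h < m n) (1 : R)))//.
        by apply: ler_sum => h _; exact: cosp_le1.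
      by rewrite sumr_const card_ord (@le_trans _ _ H%:R) ?lerDl// ler_nat.
    rewrite mulr0 add0r; rewrite mul1r in nb.
    under eq_bigr do rewrite (poly_phase1 (pp n (ltn_ord n))).
    exact: geometric_cos.
  apply: (le_trans (ler_sum _ (fun n _ => T n))).
  rewrite big_split/= -mulr_sumr sumr_const card_ord -[D^-1 *+ N]mulr_natl.
  rewrite (@le_trans _ _ (H%:R * (rho * N%:R) + N%:R * D^-1))//.
    by rewrite lerD2r ler_wpM2l// ler0n.
  have -> : H%:R * (rho * N%:R) + N%:R * D^-1 =
     N%:R * H%:R * (rho + (H%:R * D)^-1).
    by field; rewrite !gt_eqF//; case/andP: D0.
  by rewrite mulrC ler_wpM2r ?mulr_ge0//; lra.
have d1 : d <= 1 by case/andP: d01.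
have d2 : 0 <= d ^+ 2 <= 1 by rewrite sqr_ge0 expr_le1.
have Hd2 : H%:R^-1 <= d ^+ 2.
  apply: (le_trans Hd); rewrite expnS exprM.
  by apply: ler_iXnr; rewrite ?expn_gt0//; case/andP: d2.
rewrite -[X in _ <= X]ger0_norm; last by rewrite !mulr_ge0.
rewrite -[X in X <= _]ger0_norm; last by apply: sumr_ge0.
rewrite -ler_sqr ?nnegrE// !real_normK ?num_real//.
apply: (le_trans (sqr_sum_le N (fun n => `|\sum_(h < m n) cosp (phi n h)|))).
have {}IH t : (0 < t < H)%N ->
    \sum_(n < N) `|\sum_(h < m n - t) cosp (phi n (h + t)%N - phi n h)| <=
    3 * d ^+ 2 * (N%:R * H%:R).
  move=> /andP[t0 tH].
  apply: (IH _ _ _ _ (fun n h => phi n (h + t)%N - phi n h)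
    (fun n => t%:R * beta n) (fun n => (m n - t)%N)) => //.
  - exact: sqr_ge0.
  - by rewrite -exprM -expnS.
  - by rewrite -exprM -expnS.
  - by move=> n nN; apply: poly_phase_diff; exact: pp.
  - by move=> n; rewrite (leq_trans (leq_subr _ _)).
  - move=> q q0 qH; have := eq (q * t)%N; rewrite muln_gt0 q0 t0 expnSr.
    rewrite leq_mul// ?(ltnW tH)// => /(_ isT isT).
    by under eq_bigr do rewrite natrM -mulrA.
have T n : `|\sum_(h < m n) cosp (phi n h)| ^+ 2 <=
    H%:R + 2 * \sum_(1 <= t < H)
      `|\sum_(h < m n - t) cosp (phi n (h + t)%N - phi n h)|.
  rewrite real_normK ?num_real//; apply: (le_trans (weyl_differencing _ _)).
  rewrite lerD ?ler_nat// ler_pM2l//.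
  rewrite (@le_trans _ _ (\sum_(1 <= t < m n)
      `|\sum_(h < m n - t) cosp (phi n (h + t)%N - phi n h)|))//.
    by apply: ler_sum => t _; exact: ler_norm.
  case: (posnP (m n)) => [->|m0].
    by rewrite [leLHS]big_geq//; apply: sumr_ge0.
  rewrite [leRHS](@big_cat_nat _ _ _ (m n))//=.
  by rewrite lerDl; apply: sumr_ge0.
rewrite (@le_trans _ _ (N%:R * (N%:R * H%:R + 2 * (H%:R * (3 * d ^+ 2 * (N%:R * H%:R))))))//.
  rewrite ler_wpM2l//; apply: (le_trans (ler_sum _ (fun n _ => T (nat_of_ord n)))).
  rewrite big_split/= sumr_const card_ord -[H%:R *+ N]mulr_natl lerD//.
  rewrite -mulr_sumr ler_pM2l// exchange_big/=.
  set C := 3 * d ^+ 2 * _ in IH *.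
  apply: (@le_trans _ _ (\sum_(1 <= t < H) C)).
    by rewrite big_nat [leRHS]big_nat; apply: ler_sum => t /IH.
  rewrite sumr_const_nat /C -[leLHS]mulr_natl ler_wpM2r ?mulr_ge0 ?sqr_ge0//.
  by rewrite ler_nat leq_subr.
(* As H^-1 <= d^2, the last factor is at most 7 d^2 <= (3 d)^2, so the constant 3 survives the
   induction. *)
have -> : N%:R * (N%:R * H%:R + 2 * (H%:R * (3 * d ^+ 2 * (N%:R * H%:R)))) =
   (N%:R * H%:R) ^+ 2 * (H%:R^-1 + 6 * d ^+ 2) by field; rewrite gt_eqF.
rewrite [leRHS]exprMn mulrC ler_wpM2r ?sqr_ge0// [leRHS]exprMn; lra.
Qed.

Definition fdiff (g : nat -> R) (n : nat) : R := g n.+1 - g n.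

Lemma iter_fdiff_shift r g n h :
  iter r fdiff (fun i => g (n + i)%N) h = iter r fdiff g (n + h)%N.
Proof. by elim: r h => //= r IH h; rewrite /fdiff !IH addnS. Qed.

(* Newton's forward interpolation of [g] at 0, ..., r. *)
Fixpoint newton (r : nat) (g : nat -> R) (h : nat) : R :=
  if r is r'.+1 then g 0%N + \sum_(i < h) newton r' (fdiff g) i else g 0%N.

Lemma newton_poly_phase r g : poly_phase r (iter r fdiff g 0%N) (newton r g).
Proof.
elim: r g => [|r IH] g //; rewrite iterSr /=.
apply: poly_phase_ext (IH (fdiff g)) => h.
by rewrite big_ord_recr/=; ring.
Qed.

(** The error at h is the sum over i < h of the errors of order one less for [fdiff g]. *)
Lemma newton_error r g (L : R) H : 0 <= L ->
  (forall n, (n < H)%N -> `|iter r.+1 fdiff g n| <= L) ->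
  forall h, (h <= H)%N -> `|g h - newton r g h| <= H%:R ^+ r.+1 * L.
Proof.
move=> L0; elim: r g => [|r IH] g bg h hH.
  have -> : g h - newton 0 g h = \sum_(i < h) fdiff g i.
    by rewrite /= -(big_mkord xpredT (fdiff g)) telescope_sumr.
  apply: (le_trans (ler_norm_sum _ _ _)).
  rewrite (@le_trans _ _ (\sum_(i < h) L))//.
    by apply: ler_sum => i _; apply: bg; rewrite (leq_trans _ hH).
  by rewrite sumr_const card_ord -[leLHS]mulr_natl expr1 ler_wpM2r// ler_nat.
have -> : g h - newton r.+1 g h =
    \sum_(i < h) (fdiff g i - newton r (fdiff g) i).
  rewrite sumrB -(big_mkord xpredT (fdiff g)) telescope_sumr//=; ring.
apply: (le_trans (ler_norm_sum _ _ _)).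
rewrite (@le_trans _ _ (\sum_(i < h) H%:R ^+ r.+1 * L))//.
  apply: ler_sum => i _; apply: IH => [n nH|].
    by have := bg n nH; rewrite iterSr.
  by rewrite (leq_trans (ltnW (ltn_ord i))).
rewrite sumr_const card_ord -[leLHS]mulr_natl [in leRHS]exprS -[leRHS]mulrA ler_wpM2r//.
  by rewrite mulr_ge0// exprn_ge0.
by rewrite ler_nat.
Qed.

Lemma count_clustered (p : nat -> bool) (L : nat) (T : R) : 0 <= T ->
  (forall i j, (i < j)%N -> (j < L)%N -> p i -> p j -> (j - i)%:R <= T) ->
  \sum_(i < L) (p i)%:R <= T + 1.
Proof.
move=> T0 pT.
have : forall l, (l <= L)%N -> \sum_(i < l) (p i)%:R = 0 :> R \/
  exists i j, [/\ (i <= j < l)%N, p i, p j &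
    \sum_(i < l) (p i)%:R <= (j - i).+1%:R :> R].
  elim=> [|l IH] lL; first by left; rewrite big_ord0.
  rewrite big_ord_recr/=; case: (boolP (p l)) => pl; last first.
    rewrite addr0; case: (IH (ltnW lL)) => [->|[i [j [ijl pi pj S]]]]; first by left.
    by right; exists i, j; split=> //; lia.
  right; case: (IH (ltnW lL)) => [->|[i [j [ijl pi pj S]]]].
    by exists l, l; split=> //; rewrite ?leqnn ?ltnSn// subnn add0r.
  exists i, l; split => //; first by lia.
  apply: (@le_trans _ _ ((j - i).+1%:R + 1)); first by rewrite lerD2r.
  by rewrite natr1 ler_nat; lia.
move=> /(_ L (leqnn _)) [->|[i [j [/andP[ij jL] pi pj S]]]]; first by lra.
rewrite (le_trans S)// -natr1 lerD2r; case: (ltngtP i j) ij => // [ij _|-> _].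
  exact: pT.
by rewrite subnn.
Qed.

Lemma count_blocks (p : nat -> bool) (L N : nat) (C : R) : (0 < L)%N -> 0 <= C ->
  (forall a l, (l <= L)%N -> (a + l <= N)%N ->
     \sum_(i < l) (p (a + i)%N)%:R <= C) ->
  \sum_(i < N) (p i)%:R <= (N%:R / L%:R + 1) * C.
Proof.
move=> L0 C0 pC.
suff : forall k a n, (n <= k)%N -> (a + n <= N)%N ->
    \sum_(i < n) (p (a + i)%N)%:R <= (n%:R / L%:R + 1) * C.
  by move=> /(_ N 0%N N (leqnn _) (leqnn _)).
elim=> [|k IH] a n nk an.
  by rewrite leqn0 in nk; rewrite (eqP nk) big_ord0 mul0r add0r mul1r.
case: (leqP n L) => nL.
  apply: (le_trans (pC _ _ nL an)).
  by rewrite ler_peMl// lerDr divr_ge0.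
have -> : (n%:R / L%:R + 1) * C = C + ((n - L)%:R / L%:R + 1) * C.
  by rewrite natrB ?(ltnW nL)//; field; rewrite pnatr_eq0 -lt0n.
have -> : \sum_(i < n) (p (a + i)%N)%:R =
    \sum_(i < L + (n - L)) (p (a + i)%N)%:R :> R by rewrite subnKC// ltnW.
rewrite big_split_ord/=; apply: lerD; first by apply: pC; lia.
under eq_bigr do rewrite addnA.
by apply: IH; lia.
Qed.

(** In a block of about 1 / (2 nu) indices b rises by at most 1/2, so it can be near one integer
    only, and the indices near that integer span at most 2 D / mu. At most 4 nu N + 1 blocks are
    needed. *)
Lemma count_near_int (b : nat -> R) (N : nat) (mu nu D : R) :
  0 < mu -> nu <= 4^-1 -> 0 < D < 4^-1 ->
  (forall n, (n < N)%N -> mu <= b n.+1 - b n <= nu) ->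
  \sum_(n < N) (near_int D (b n))%:R <= (4 * nu * N%:R + 1) * (2 * D / mu + 1).
Proof.
move=> mu0 nu4 /andP[D0 D4] bi.
have C0 : 0 <= 2 * D / mu by rewrite divr_ge0 ?mulr_ge0// ltW.
case: (posnP N) => [->|N0]; first by rewrite big_ord0 mulr0 add0r mul1r addr_ge0.
have munu : mu <= nu by have /andP[] := bi 0%N N0; exact: le_trans.
have nu0 : 0 < nu := lt_le_trans mu0 munu.
pose L := Num.truncn ((2 * nu)^-1).
have nuV : 2 <= (2 * nu)^-1 by rewrite -[leLHS]invrK lef_pV2 ?posrE//; lra.
have /andP[L1 L2] : L%:R <= (2 * nu)^-1 < L.+1%:R by apply: truncn_itv; lra.
have L0 : (0 < L)%N by rewrite truncn_gt0; lra.
have LR : (4 * nu)^-1 <= L%:R.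
  rewrite -(natr1 L) in L2; have -> : (4 * nu)^-1 = (2 * nu)^-1 / 2.
    by field; rewrite gt_eqF.
  by lra.
apply: (@le_trans _ _ ((N%:R / L%:R + 1) * (2 * D / mu + 1))); last first.
  rewrite ler_wpM2r ?addr_ge0// lerD2r mulrC ler_wpM2r//.
  by rewrite -[leRHS]invrK lef_pV2 ?posrE// ?ltr0n// invr_gt0 mulr_gt0.
apply: (@count_blocks (fun n => near_int D (b n)) L N) => //; first by rewrite addr_ge0.
move=> a l lL alN.
apply: (@count_clustered (fun i => near_int D (b (a + i)%N))) => // i j ij jl /asboolP[z1 Hz1] /asboolP[z2 Hz2].
have inc k : (i + k <= j)%N -> k%:R * mu <= b (a + (i + k))%N - b (a + i)%N <= k%:R * nu.
  elim: k => [|k IH] kj; first by rewrite addn0 subrr !mul0r lexx.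
  have kj' : (i + k <= j)%N by rewrite ltnW// -addnS.
    have := IH kj'; have := bi (a + (i + k))%N.
  rewrite addnS addnS => /(_ _)/andP[]; first by clear -alN jl kj; lia.
  by rewrite -natr1 !mulrDl !mul1r => ? ? /andP[? ?]; apply/andP; split; lra.
have := inc (j - i)%N; rewrite subnKC ?(ltnW ij)// => /(_ (leqnn _)) /andP[I1 I2].
have j1 : (1 : R) <= (j - i)%:R by rewrite ler1n subn_gt0.
have jL : (j - i)%:R * nu <= 2^-1.
  apply: (@le_trans _ _ (L%:R * nu)).
    by rewrite ler_pM2r// ler_nat; clear -ij jl lL; lia.
  apply: (@le_trans _ _ ((2 * nu)^-1 * nu)); first by rewrite ler_pM2r.
  by rewrite invfM -mulrA mulVf ?gt_eqF// mulr1.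
have J0 : 0 < (j - i)%:R * mu by rewrite mulr_gt0//; lra.
have z12 : z1 = z2.
  have : `|(z2 - z1)%:~R : R| < 1.
    rewrite intrB; move: Hz1 Hz2; rewrite !ler_norml ltr_norml => /andP[? ?] /andP[? ?].
    by apply/andP; split; lra.
  rewrite -intr_norm -[1]/(1%:~R) ltr_int => h; clear -h; lia.
rewrite ler_pdivlMr//; move: Hz1 Hz2; rewrite z12 !ler_norml => /andP[? ?] /andP[? ?].
by lra.
Qed.

(** A shift by h only adds h terms at one end and removes h at the other. *)
Lemma shift_average (a : nat -> R) (N H : nat) : (forall n, `|a n| <= 1) ->
  H%:R * `|\sum_(n < N) a n| <=
    \sum_(n < N) `|\sum_(h < H) a (n + h)%N| + 2 * H%:R ^+ 2.
Proof.
move=> a1; have sh h : `|\sum_(n < N) a n - \sum_(n < N) a (n + h)%N| <= 2 * h%:R.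
  elim: h => [|h IH].
    by under [X in _ - X]eq_bigr do rewrite addn0; rewrite subrr normr0 mulr0.
  rewrite -(subrK (\sum_(n < N) a (n + h)%N) (\sum_(n < N) a n)) -addrA.
  rewrite (le_trans (ler_normD _ _))// -(natr1 h) mulrDr lerD// mulr1.
  have -> : \sum_(n < N) a (n + h)%N - \sum_(n < N) a (n + h.+1)%N = a h - a (N + h)%N.
    elim: N {IH} => [|N IH]; first by rewrite !big_ord0 add0n !subrr.
    rewrite !big_ord_recr/= opprD addrACA IH addnS addSn; ring.
  by rewrite (le_trans (ler_normB _ _))// [leRHS]mulr2n lerD.
have -> : H%:R * `|\sum_(n < N) a n| = `|\sum_(h < H) \sum_(n < N) a n|.
  by rewrite sumr_const card_ord normrMn mulr_natl.
rewrite -(subrK (\sum_(h < H) \sum_(n < N) a (n + h)%N) (\sum_(h < H) \sum_(n < N) a n)).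
rewrite (le_trans (ler_normD _ _))// addrC lerD//.
  by rewrite exchange_big/= ler_norm_sum.
rewrite -sumrB (le_trans (ler_norm_sum _ _ _))//.
apply: (@le_trans _ _ (\sum_(h < H) (2 * H%:R : R))).
  by apply: ler_sum => h _; rewrite (le_trans (sh _))// ler_pM2l// ler_nat ltnW.
by rewrite sumr_const card_ord -[leLHS]mulr_natl expr2 mulrCA.
Qed.

(** The exponent of D in H^(r+2) D, where H = D^(2^(r+1) + 5) is the block length of the derivative
    test. *)
Definition weyl_exponent (r : nat) : nat := (2 ^ r.+1 + 5) * r.+2 + 1.

(** On blocks of length H, g is replaced by its Newton polynomial of degree r + 1; the error is at
    most H^(r+2) Lam <= 1 / D. The leading coefficients [iter r.+1 fdiff g n] move by between lam
    and Lam as n grows by one, so their multiples are seldom near an integer, and [weyl_average]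
    applies. *)
Lemma derivative_test (r D M N : nat) (g : nat -> R) (lam Lam : R) :
  (100 <= D)%N -> (D ^ weyl_exponent r <= M)%N -> (N <= M)%N ->
  (forall n, (n < 2 * M)%N -> lam <= iter r.+2 fdiff g n <= Lam) ->
  (D%:R * M%:R)^-1 <= lam -> Lam <= D%:R * lam ->
  Lam <= (D ^ weyl_exponent r)%:R^-1 ->
  `|\sum_(n < N) cosp (g n)| <= 13 * (M%:R / D%:R).
Proof.
move=> D100 DM NM gl laml Laml LamD.
set e := weyl_exponent r in DM LamD.
have D0 : (0 < D)%N by lia.
have D0R : 0 < D%:R :> R by rewrite ltr0n.
have D100R : 100 <= D%:R :> R by rewrite (ler_nat R 100).
(* [weyl_average] is used with d = 1 / D, so its errors must stay below 1 / B = d^(2^r). H is the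
   block length and P = H^r bounds the multipliers q produced by differencing. *)
pose B := (D ^ (2 ^ r))%N; pose H := (B ^ 2 * D ^ 5)%N; pose P := (H ^ r)%N.
have EDe : (D ^ e = P * H ^ 2 * D)%N.
  rewrite /e /weyl_exponent /P -expnD addn2 expnD expn1; congr (_ * _)%N.
  by rewrite expnM; congr (_ ^ _)%N; rewrite /H /B -expnM -expnD expnS mulnC.
have DB : (D <= B)%N by rewrite -{1}(expn1 D) leq_exp2l ?expn_gt0//; lia.
have P0 : (0 < P)%N by rewrite !(expn_gt0, muln_gt0) D0.
have H0 : (0 < H)%N by rewrite !(expn_gt0, muln_gt0) D0.
have B0 : (0 < B)%N := leq_trans D0 DB.
have M0 : (0 < M)%N by rewrite (leq_trans _ DM)// expn_gt0 D0.
have HM : (H < M)%N.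
  rewrite (leq_trans _ DM)// EDe (_ : P * H ^ 2 * D = H * (P * H * D))%N.
    rewrite -{1}(muln1 H) ltn_pmul2l// (@leq_trans D)//; first by clear -D100; lia.
    by rewrite leq_pmull// muln_gt0 P0.
  by rewrite -mulnn; ring.
have dM0 : 0 <= M%:R / D%:R :> R by rewrite divr_ge0.
(* Sums of length at most M / D satisfy the bound trivially; otherwise N and M agree up to a factor
   D. *)
case: (leqP (N * D) M) => NDM.
  rewrite (le_trans (ler_norm_sum _ _ _))//.
  apply: (@le_trans _ _ (\sum_(n < N) (1 : R))).
    by apply: ler_sum => n _; exact: cosp_le1.
  rewrite sumr_const card_ord (@le_trans _ _ (M%:R / D%:R))//; last by lra.
  by rewrite ler_pdivlMr// -natrM ler_nat.
have N0 : (0 < N)%N by move: NDM; case: (N) => //; rewrite mul0n.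
have PR0 : 1 <= P%:R :> R by rewrite ler1n.
have HR0 : 0 < H%:R :> R by rewrite ltr0n.
have BR0 : 0 < B%:R :> R by rewrite ltr0n.
have MR0 : 0 < M%:R :> R by rewrite ltr0n.
have NR0 : 0 < N%:R :> R by rewrite ltr0n.
have DBR : D%:R <= B%:R :> R by rewrite ler_nat.
have EH : H%:R = B%:R ^+ 2 * D%:R ^+ 5 :> R by rewrite natrM !natrX.
have EDR : (D ^ e)%:R = P%:R * H%:R ^+ 2 * D%:R :> R by rewrite EDe !natrM natrX.
have NDMR : M%:R <= N%:R * D%:R :> R by rewrite -natrM ler_nat ltnW.
have DMR : P%:R * H%:R ^+ 2 * D%:R <= M%:R :> R by rewrite -EDR ler_nat.
rewrite EDR in LamD.
have lam0 : 0 < lam by rewrite (lt_le_trans _ laml)// invr_gt0 mulr_gt0.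
have lamLam : lam <= Lam.
  by have /andP[] : lam <= _ <= Lam := gl 0%N ltac:(by rewrite muln_gt0); exact: le_trans.
have Lam0 : 0 < Lam by exact: lt_le_trans lamLam.
have LamP : Lam * (P%:R * H%:R ^+ 2 * D%:R) <= 1.
  by rewrite -ler_pdivlMr ?mul1r// !mulr_gt0// ?exprn_gt0// ltr0n.
have lamN : 1 <= lam * N%:R * D%:R ^+ 2.
  apply: (@le_trans _ _ (lam * M%:R * D%:R)).
    by move: laml; rewrite -[(_ * _)^-1]mul1r ler_pdivrMr ?mulr_gt0//; lra.
  by rewrite expr2 -!mulrA !ler_pM2l// mulrA ler_pM2r.
have HB : (B <= H)%N.
  by rewrite /H -mulnn -mulnA leq_pmulr// !(muln_gt0, expn_gt0) D0.
have HBR : B%:R <= H%:R :> R by rewrite ler_nat.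
pose u : R := D%:R^-1; pose b : R := B%:R^-1.
have uD : u * D%:R = 1 by rewrite mulVf// gt_eqF.
have bB : b * B%:R = 1 by rewrite mulVf// gt_eqF.
have u0 : 0 < u by rewrite invr_gt0.
have b0 : 0 < b by rewrite invr_gt0.
have u1 : u <= 100^-1 by rewrite lef_pV2 ?posrE.
have b1 : b <= 100^-1 by rewrite lef_pV2 ?posrE//; exact: le_trans DBR.
have PLam : P%:R * Lam <= b / 32.
  rewrite ler_pdivlMr// -[leRHS]mul1r -ler_pdivrMr// invrK.
  apply: le_trans LamP; have -> : P%:R * Lam * 32 * B%:R = P%:R * Lam * (32 * B%:R) by ring.
  have -> : Lam * (P%:R * H%:R ^+ 2 * D%:R) = P%:R * Lam * (H%:R ^+ 2 * D%:R) by ring.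
  rewrite ler_pM2l ?mulr_gt0//; last by rewrite ltr0n.
  have H1 : 1 <= H%:R :> R by rewrite ler1n.
  have HH : H%:R <= H%:R ^+ 2 :> R by rewrite expr2 ler_peMl.
  rewrite mulrC ler_pM//; [exact: le_trans HH|lra].
(* Dl = 1 / (B D^3) is small enough to put 8 Dl D and 2 Dl / (lam N) well below 1 / B, using lam N
   D^2 >= 1, and large enough that 1 / (H Dl) = 1 / (B D^2). *)
pose Dl : R := b * u ^+ 3.
have u3 : 0 < u ^+ 3 <= 100^-1.
  by rewrite exprn_gt0//= !exprS expr0; nra.
have Dl0 : 0 < Dl < 4^-1.
  by case/andP: u3 => ? ?; apply/andP; split; rewrite /Dl; [exact: mulr_gt0|nra].
have /andP[Dl00 Dl4] := Dl0.
pose rho : R := 8 * Dl * D%:R + 4 * P%:R * Lam + 2 * Dl / (lam * N%:R) + N%:R^-1.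
have WA : \sum_(n < N) `|\sum_(h < H) cosp (newton r.+1 (fun i => g (n + i)%N) h)|
     <= 3 * D%:R^-1 * (N%:R * H%:R).
  apply: (@weyl_average r N H (fun n => newton r.+1 (fun i => g (n + i)%N))
    (iter r.+1 fdiff g) (fun=> H) Dl rho D%:R^-1) => //.
  - by rewrite -/u; clear -u0 u1; apply/andP; split; lra.
  - by rewrite Dl00/= ltW.
  - by rewrite exprVn -natrX lef_pV2 ?posrE.
  - rewrite exprVn -natrX -/b /rho.
    have -> : 8 * Dl * D%:R = 8 * b * u ^+ 2.
      by rewrite /Dl /u; field; rewrite gt_eqF.
    have -> : (H%:R * Dl)^-1 = b * u ^+ 2.
      by rewrite /Dl EH /b /u; field; rewrite !gt_eqF.
    have t3 : 2 * Dl / (lam * N%:R) <= 2 * b * u.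
      rewrite ler_pdivrMr ?mulr_gt0// /Dl.
      have -> : 2 * (b * u ^+ 3) = 2 * b * u * (u ^+ 2) by ring.
      rewrite ler_pM2l ?mulr_gt0// -[leLHS]mul1r -ler_pdivlMr ?exprn_gt0//.
      by rewrite /u exprVn invrK.
    have t4 : N%:R^-1 <= b / 8.
      have -> : b / 8 = (8 * B%:R)^-1 by rewrite invfM mulrC.
      rewrite lef_pV2 ?posrE ?mulr_gt0//.
      apply: (@le_trans _ _ (P%:R * H%:R ^+ 2)).
        apply: (@le_trans _ _ (H%:R ^+ 2)); last by rewrite ler_peMl// exprn_ge0.
        by rewrite expr2 ler_pM//; move: HBR DBR D100R; clear; lra.
      by rewrite -(ler_pM2r D0R) (le_trans DMR).
    have bu : b * u <= b * 100^-1 by rewrite ler_pM2l.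
    have bu2 : b * u ^+ 2 <= b * 100^-1.
      by rewrite ler_pM2l// (le_trans _ u1)// expr2 ler_piMl ?(ltW u0)//; clear -u1; lra.
    move: PLam t3 t4 bu bu2; rewrite -[4 * _ * _]mulrA -[2 * _ * u]mulrA -[8 * _ * _]mulrA.
    by clear -b0; lra.
  - by move=> n _; have := newton_poly_phase r.+1 (fun i => g (n + i)%N);
      rewrite iter_fdiff_shift addn0.
  - move=> q q0 qP.
    have qP' : q%:R <= P%:R :> R by rewrite ler_nat.
    have q1 : 1 <= q%:R :> R by rewrite ler1n.
    have q00 : 0 < q%:R :> R by rewrite ltr0n.
    have qLam : q%:R * Lam <= P%:R * Lam by rewrite ler_pM2r.
    apply: (@le_trans _ _ ((4 * (q%:R * Lam) * N%:R + 1) * (2 * Dl / (q%:R * lam) + 1))).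
      apply: (@count_near_int (fun n => q%:R * iter r.+1 fdiff g n)) => //.
      + exact: mulr_gt0.
      + by lra.
      + move=> n nN; rewrite -mulrBr !ler_pM2l//.
        by apply: (gl n); clear -nN NM; lia.
    have -> : (4 * (q%:R * Lam) * N%:R + 1) * (2 * Dl / (q%:R * lam) + 1) =
        8 * Dl * N%:R * (Lam / lam) + 4 * (q%:R * Lam) * N%:R + 2 * Dl / lam / q%:R + 1.
      by field; rewrite !gt_eqF.
    have -> : rho * N%:R = 8 * Dl * N%:R * D%:R + 4 * (P%:R * Lam) * N%:R +
        2 * Dl / lam + 1.
      by rewrite /rho; field; rewrite !gt_eqF.
    rewrite lerD2r !lerD//.
    + by rewrite ler_pM2l ?mulr_gt0// ler_pdivrMr.
    + by rewrite ler_pM2r// ler_pM2l.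
    + by rewrite ler_pdivrMr// ler_peMr// divr_ge0 ?mulr_ge0// ltW.
have newt n h : (n < N)%N -> (h < H)%N ->
    `|cosp (g (n + h)%N) - cosp (newton r.+1 (fun i => g (n + i)%N) h)| <= 8 / D%:R.
  move=> nN hH; rewrite (le_trans (cosp_lipschitz _ _))// ler_pM2l//.
  apply: (le_trans (newton_error (ltW Lam0) _ (ltnW hH))) => [i iH|].
    have niM : (n + i < 2 * M)%N.
      by move: (leq_trans iH (ltnW HM)); clear -nN NM; lia.
    rewrite iter_fdiff_shift; have /andP[g1 g2] := gl (n + i)%N niM.
    by rewrite ger0_norm// (le_trans (ltW lam0)).
  rewrite -[leRHS]mul1r ler_pdivlMr//.
  apply: le_trans LamP; rewrite !exprSr -natrX -/P mulrAC [leRHS]mulrC.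
  by rewrite expr0 mul1r !mulrA.
rewrite -(ler_pM2l HR0).
apply: (le_trans (shift_average _ _ (fun n => cosp_le1 (g n)))).
have S : \sum_(n < N) `|\sum_(h < H) cosp (g (n + h)%N)| <=
    3 * D%:R^-1 * (N%:R * H%:R) + N%:R * (H%:R * (8 / D%:R)).
  have -> : N%:R * (H%:R * (8 / D%:R)) = \sum_(n < N) (H%:R * (8 / D%:R)) :> R.
    by rewrite sumr_const card_ord -[RHS]mulr_natl.
  apply: le_trans (lerD WA (lexx _)); rewrite -big_split/=; apply: ler_sum => n _.
  rewrite -lerBlDl (le_trans (lerB_dist _ _))// -sumrB (le_trans (ler_norm_sum _ _ _))//.
  apply: (@le_trans _ _ (\sum_(h < H) (8 / D%:R : R))).
    by apply: ler_sum => h _; apply: newt.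
  by rewrite sumr_const card_ord -[leLHS]mulr_natl.
have HMD : H%:R <= M%:R / D%:R :> R.
  have H1 : 1 <= H%:R :> R by rewrite ler1n.
  rewrite ler_pdivlMr// (le_trans _ DMR)// ler_pM2r// (@le_trans _ _ (H%:R ^+ 2))//.
    by rewrite expr2 ler_peMl// ltW.
  by rewrite ler_peMl// exprn_ge0// ltW.
have NMD : N%:R / D%:R <= M%:R / D%:R :> R by rewrite ler_pM2r ?invr_gt0// ler_nat.
rewrite (le_trans (lerD S (lexx _)))//.
(* 13 = 3 + 8 + 2: Weyl averaging, the passage to Newton polynomials, and the boundary terms of the
   shift average, where H <= M / D. *)
have -> : 3 / D%:R * (N%:R * H%:R) + N%:R * (H%:R * (8 / D%:R)) + 2 * H%:R ^+ 2 =
  H%:R * (11 * (N%:R / D%:R) + 2 * H%:R) :> R by ring.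
rewrite ler_pM2l//.
by move: NMD HMD; clear; lra.
Qed.
End DerivativeTest.

(** * Sums along a regularly varying function *)

Section Oscillation.
Variable R : realType.

Lemma leq_weyl_exponent j k : (j <= k)%N -> (weyl_exponent j <= weyl_exponent k)%N.
Proof.
by move=> jk; rewrite leq_add2r leq_mul ?leq_add2r ?leq_exp2l.
Qed.

(* [kappa k] grows geometrically so that the range of admissible sizes of the
   k-th derivative overlaps the one for the (k+1)-st. *)
Lemma exponent_choice (l : nat) (theta m0 : R) :
  l%:R <= theta <= l.+1%:R -> 0 < m0 <= 1 ->
  exists (K : nat) (e : R) (kappa : nat -> R), [/\ 0 < e,
    forall k, (l < k <= K)%N ->
      4 * e <= kappa k /\ kappa k * (weyl_exponent (k - 2))%:R <= m0 &
    forall m, m0 <= m <= 1 -> exists k, [/\ (l < k <= K)%N,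
      theta - k%:R * m + e <= - (kappa k * (weyl_exponent (k - 2))%:R) &
      - m - kappa k + e <= theta - k%:R * m - e]].
Proof.
move=> /andP[t1 t2] /andP[m00 m01].
(* K m0 >= l + 3 makes the K-th derivative small enough at every length, even the shortest. *)
pose K := (Num.truncn ((l%:R + 3) / m0)).+1.
have Km : l%:R + 3 <= K%:R * m0.
  by rewrite -ler_pdivrMr// ltW// /K truncnS_gt.
have lK : (l + 3 <= K)%N.
  rewrite -(ler_nat R) natrD (le_trans Km)//.
  by rewrite -[leRHS]mulr1 ler_wpM2l.
have lK1 : (l < K)%N by rewrite (leq_trans _ lK)// addn3 ltnS leqW.
pose E : R := (weyl_exponent (K - 2))%:R.
have E1 : 1 <= E by rewrite ler1n /weyl_exponent addn1.
(* Normalised so that kappa K * E = m0, the largest value that the constraint on lengths allows. *)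
pose a := m0 / (E * (2 * E) ^+ K).
have E20 : 0 < 2 * E by lra.
have a0 : 0 < a by rewrite divr_gt0// mulr_gt0 ?exprn_gt0//; lra.
pose kappa (k : nat) := a * (2 * E) ^+ k.
have kS k : kappa k.+1 = 2 * E * kappa k by rewrite /kappa exprS mulrCA.
have k0 k : 0 < kappa k by rewrite mulr_gt0 ?exprn_gt0.
have kmono j k : (j <= k)%N -> kappa j <= kappa k.
  by move=> jk; rewrite ler_pM2l// ler_weXn2l//; lra.
have kK : kappa K * E = m0.
  rewrite /kappa /a; field; rewrite ?expf_neq0 ?gt_eqF//; lra.
have kE k : (k <= K)%N -> kappa k * E <= m0.
  by move=> kK'; rewrite -kK ler_pM2r; [exact: kmono|lra].
have wE k : (k <= K)%N -> (weyl_exponent (k - 2))%:R <= E.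
  by move=> kK'; rewrite ler_nat leq_weyl_exponent// leq_sub2r.
have kw k : (k <= K)%N -> kappa k * (weyl_exponent (k - 2))%:R <= kappa k * E.
  by move=> kK'; rewrite ler_pM2l//; exact: wE.
pose e := kappa l.+1 / 4.
have e0 : 0 < e by rewrite divr_gt0.
have e1 : e <= 1.
  have : kappa l.+1 * E <= m0 by apply: kE.
  have : kappa l.+1 <= kappa l.+1 * E by rewrite ler_peMr// ltW.
  by rewrite /e; lra.
exists K, e, kappa; split=> // [k /andP[lk kK']|m /andP[m1 m2]].
  split; last by rewrite (le_trans (kw k kK'))// kE.
  by rewrite /e mulrCA divff ?pnatr_eq0// mulr1 kmono.
pose p k := (l < k)%N && (theta - k%:R * m + e <= - (kappa k * E)).
have pK : p K.
  rewrite /p kK lK1/=.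
  have : K%:R * m0 <= K%:R * m by rewrite ler_wpM2l.
  by rewrite -(natr1 l) in t2; lra.
(* For the least admissible order, the lower bound on the derivative comes from the failure of [p]
   at k - 1 together with kappa k = 2 E kappa (k - 1), or from l <= theta when k = l + 1. *)
have [k /andP[lk pk] kmin] := ex_minnP (ex_intro _ K pK).
have kK' : (k <= K)%N by exact: kmin.
exists k; rewrite lk kK'; split=> //.
  by rewrite (le_trans pk)// lerN2 kw.
have [->|/eqP kl] := eqVneq k l.+1.
  have : 4 * e = kappa l.+1 by rewrite /e mulrCA divff ?pnatr_eq0// mulr1.
  have : l%:R * m <= l%:R by rewrite ler_piMr.
  by rewrite -(natr1 l) mulrDl mul1r; lra.
case: k => // k in lk pk kmin kK' kl *.
have lk' : (l < k)%N.
  by rewrite ltn_neqAle -ltnS lk andbT; apply/eqP => E'; apply: kl; rewrite E'.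
have /negP : ~~ p k by apply/negP => /kmin; rewrite ltnn.
rewrite /p lk'/= => /negP; rewrite -ltNge => h.
have k1 : 4 * e <= E * kappa k.
  rewrite /e mulrCA divff ?pnatr_eq0// mulr1.
  by rewrite (le_trans (kmono _ _ lk'))// ler_peMl// ltW.
by rewrite kS -(natr1 k) mulrDl mul1r; lra.
Qed.

(** The induction hypothesis is applied to the chain G j (u + 1) - G j u, on an interval shorter by
    1; the mean value theorem then turns the remaining unit difference of G k into a derivative. *)
Lemma fdiff_mean_value k (G : nat -> R -> R) (a b : R) :
  (forall j u, (j < k)%N -> a <= u <= b -> is_derive (u : R) (1 : R) (G j) (G j.+1 u)) ->
  forall n, a + (n + k)%:R <= b ->
  exists2 xi, a + n%:R <= xi <= a + (n + k)%:R &
    iter k (@fdiff R) (fun i => G 0%N (a + i%:R)) n = G k xi.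
Proof.
elim: k G b => [|k IH] G b GD n nb.
  by exists (a + n%:R) => //; rewrite addn0 lexx.
have kb : a + n%:R + 1 + k%:R <= b by rewrite addnS -natr1 natrD in nb; lra.
have n0 : 0 <= n%:R :> R by [].
have k0 : 0 <= k%:R :> R by [].
have shift j u : (j < k.+1)%N -> a <= u <= b - 1 ->
    is_derive (u : R) (1 : R) (fun u => G j (u + 1)) (G j.+1 (u + 1)).
  move=> jk /andP[u1 u2].
  have d : is_derive (u + 1) 1 (G j) (G j.+1 (u + 1)) by apply: GD => //; apply/andP; split; lra.
  have d1 : is_derive (u : R) (1 : R) (fun u : R => u + 1) 1.
    by apply: is_derive_eq; rewrite addr0.
  by have := @is_derive1_comp R (G j) (fun u => u + 1) u _ _ d d1; rewrite mulr1.
have [||xi /andP[x1 x2] xiE] := IH (fun j u => G j (u + 1) - G j u) (b - 1) _ n _.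
- move=> j u jk /andP[u1 u2].
  have u12 : a <= u <= b - 1 by rewrite u1.
  have d1 := shift j u (ltnW jk : (j < k.+1)%N) u12.
  have d2 : is_derive (u : R) (1 : R) (G j) (G j.+1 u) by apply: GD; [exact: ltnW|apply/andP; split; lra].
  exact: is_deriveB.
- by rewrite natrD; lra.
rewrite natrD in x2.
have GDk u : a <= u <= b -> is_derive (u : R) (1 : R) (G k) (G k.+1 u) by apply: GD.
have [|||c] := @MVT_segment R (G k) (G k.+1) xi (xi + 1) _.
- by lra.
- by move=> u; rewrite in_itv/= => /andP[? ?]; apply: GDk; apply/andP; split; lra.
- apply: derivable_within_continuous => u; rewrite in_itv/= => /andP[? ?].
  by apply: ex_derive; apply: GDk; apply/andP; split; lra.
rewrite in_itv/= => /andP[c1 c2] E; exists c.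
  by rewrite addnS -natr1 natrD; apply/andP; split; lra.
rewrite -iterS iterSr.
have -> : fdiff (fun i => G 0%N (a + i%:R)) =
    (fun i => G 0%N (a + i%:R + 1) - G 0%N (a + i%:R)).
  by apply/funext => i; rewrite /fdiff -natr1 addrA.
by rewrite xiE E addrAC subrr add0r mulr1.
Qed.

Lemma iter_fdiffZ (s : R) r g : iter r (@fdiff R) (fun n => s * g n) =
  (fun n => s * iter r (@fdiff R) g n).
Proof. by elim: r => //= r ->; apply/funext => n; rewrite /fdiff -mulrBr. Qed.


Lemma powRD_pos (x a b : R) : 0 < x -> x `^ (a + b) = x `^ a * x `^ b.
Proof. by move=> x0; rewrite powRD ?(gt_eqF x0) ?implybT. Qed.

Lemma near_pinfty_powR_ge (K a : R) : 0 < a -> \forall x \near +oo, K <= x `^ a.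
Proof.
move=> a0; have [K0|K0] := leP K 0.
  by apply: nearW => x; rewrite (le_trans K0)// powR_ge0.
apply: filterS2 (near_pinfty_ge 1) (near_pinfty_ln_ge (ln K / a)) => x x1.
rewrite ler_pdivrMr// => h.
have x0 : 0 < x by lra.
by rewrite /powR gt_eqF// -[leLHS]lnK ?posrE// ler_expR mulrC.
Qed.

(** Common to both types of sums. P is the dilation, q in Type I and D in Type II. The window of
    length 3 M leaves room for k-th differences at all n < 2 M. *)
Lemma oscillation (l : nat) (theta m0 : R) :
  l%:R <= theta <= l.+1%:R -> (0 < l)%N -> 0 < m0 <= 1 ->
  exists (K : nat) (e : R), 0 < e /\ \forall x \near +oo,
  forall (P : R) (M N A : nat) (G : nat -> R -> R),
  1 <= P -> x `^ m0 <= x / P -> x / P <= M%:R -> (N <= M)%N ->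
  (forall j u, (j < K)%N -> A%:R <= u <= (A + 3 * M)%:R ->
    is_derive (u : R) (1 : R) (G j) (G j.+1 u)) ->
  (forall k, (l < k <= K)%N -> exists2 s : R, (s == 1) || (s == -1) &
    forall u, A%:R <= u <= (A + 3 * M)%:R ->
    P ^+ k * x `^ (theta - k%:R - e) <= s * G k u <= P ^+ k * x `^ (theta - k%:R + e)) ->
  `|\sum_(n < N) cosp (G 0%N (A + n)%:R)| <= M%:R * x `^ (- e).
Proof.
move=> lt l0 m00; have [K [e [kappa [e0 kap choice]]]] := exponent_choice lt m00.
exists K, e; split => //.
have e3 : 0 < 3 * e by lra.
have [m0p m01] := andP m00.
apply: filterS (filterI (filterI (near_pinfty_ge 2) (near_pinfty_powR_ge K%:R m0p))
  (filterI (near_pinfty_powR_ge 200 e0) (near_pinfty_powR_ge 26 e3))).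
move=> x [[x2 xK] [xe xe3]] P M N A G P1 xP xM NM GD Gb.
have x0 : 0 < x by lra.
have P0 : 0 < P by lra.
have lx0 : 0 < ln x by rewrite ln_gt0//; lra.
(* In exponents P = x^(1-m), M is at least x^m, and G k has size x^(theta - k m) up to x^e: the form
   that the choice of exponents handles. *)
pose m := 1 - ln P / ln x.
have PE : P = x `^ (1 - m).
  rewrite /powR gt_eqF// /m opprB addrC subrK divfK ?gt_eqF//.
  by rewrite lnK.
have xPE : x / P = x `^ m.
  by rewrite PE -{1}(@powRr1 _ x) ?(ltW x0)// -powRN -powRD_pos//; congr (_ `^ _); ring.
have xinj a b : x `^ a <= x `^ b -> a <= b.
  by rewrite /powR gt_eqF// ler_expR ler_pM2r.
have xle a b : a <= b -> x `^ a <= x `^ b by move=> ab; rewrite ler_powR//; lra.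
have m1 : m0 <= m <= 1.
  apply/andP; split; first by apply: xinj; rewrite -xPE.
  by have := divr_ge0 (ln_ge0 P1) (ltW lx0); rewrite /m; lra.
have [k [lkK ub lb]] := choice m m1.
have [ke km] := kap k lkK.
have [lk kK] := andP lkK.
have kr : ((k - 2).+2 = k)%N by rewrite -addn2 subnK// (leq_trans _ lk).
have [s s1 Gs] := Gb k lkK.
pose D := Num.truncn (x `^ kappa k).
have xk200 : 200 <= x `^ kappa k by apply: le_trans xe _; apply: xle; lra.
have /andP[D1 D2] : D%:R <= x `^ kappa k < D.+1%:R by apply: truncn_itv; lra.
rewrite -(natr1 D) in D2.
have D100 : (100 <= D)%N by rewrite -(ler_nat R); lra.
have D0 : 0 < D%:R :> R by rewrite ltr0n (leq_trans _ D100).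
have DE : (D ^ weyl_exponent (k - 2))%:R <=
    x `^ (kappa k * (weyl_exponent (k - 2))%:R) :> R.
  rewrite natrX powRrM powR_mulrn ?powR_ge0// lerXn2r ?nnegrE ?powR_ge0//.
have M0 : 0 < M%:R :> R by apply: lt_le_trans xM; exact: divr_gt0.
have PkE a : P ^+ k * x `^ (theta - k%:R + a) = x `^ (theta - k%:R * m + a).
  rewrite PE -powR_mulrn ?powR_ge0// -powRrM -powRD_pos//.
  by congr (_ `^ _); ring.
have gE : \sum_(n < N) cosp (G 0%N (A + n)%:R) =
    \sum_(n < N) cosp (s * G 0%N (A%:R + n%:R)).
  apply: eq_bigr => n _; rewrite natrD.
  by case/orP: s1 => /eqP->; rewrite ?mul1r// mulN1r cospN.
have KM : (K <= M)%N.
  by rewrite -(ler_nat R) (le_trans xK)// (le_trans xP).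
rewrite gE.
apply: (@le_trans _ _ (13 * (M%:R / D%:R))).
  apply: (@derivative_test _ (k - 2) D M N (fun n => s * G 0%N (A%:R + n%:R))
    (P ^+ k * x `^ (theta - k%:R - e)) (P ^+ k * x `^ (theta - k%:R + e))) => //.
  - rewrite -(ler_nat R) (le_trans DE)// (le_trans _ xM)// (le_trans _ xP)//.
    by apply: xle.
  - move=> n n2M; rewrite kr iter_fdiffZ.
    have nA : A%:R + (n + k)%:R <= (A + 3 * M)%:R :> R.
      by rewrite -natrD ler_nat; clear -n2M kK KM; lia.
    have [xi /andP[xi1 xi2] ->] := 
      fdiff_mean_value (fun j u jk => GD j u (leq_trans jk kK)) nA.
    apply: Gs; apply/andP; split; first by apply: le_trans xi1; rewrite lerDl.
    by apply: (le_trans xi2); rewrite -natrD ler_nat; clear -n2M kK KM; lia.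
  - rewrite PkE -[(_ * _)^-1]mul1r ler_pdivrMr ?mulr_gt0//.
    apply: (@le_trans _ _ (x `^ (theta - k%:R * m - e) * (x `^ kappa k / 2 * x `^ m))).
      rewrite mulrA mulrAC mulrA -!powRD_pos// ler_pdivlMr// mul1r.
      apply: (@le_trans _ _ (x `^ e)); first by lra.
      by apply: xle; lra.
    rewrite ler_pM2l ?powR_gt0// ler_pM ?divr_ge0 ?powR_ge0//; first by lra.
    by rewrite -xPE.
  - rewrite !PkE.
    have -> : theta - k%:R * m + e = 2 * e + (theta - k%:R * m - e) by ring.
    rewrite (powRD_pos (2 * e) _ x0) ler_pM2r ?powR_gt0//.
    apply: (@le_trans _ _ (x `^ kappa k / 2)); last by lra.
    rewrite ler_pdivlMr//; apply: (@le_trans _ _ (x `^ (2 * e) * x `^ e)).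
      by rewrite ler_wpM2l ?powR_ge0//; lra.
    by rewrite -powRD_pos//; apply: xle; lra.
  - rewrite PkE -[leLHS]invrK lef_pV2 ?posrE ?invr_gt0 ?powR_gt0//; last first.
      by rewrite ltr0n expn_gt0 -(ltr0n R) D0.
    by rewrite -powRN (le_trans DE)//; apply: xle; lra.
rewrite mulrCA ler_pM2l// ler_pdivrMr//.
apply: (@le_trans _ _ (x `^ (- e) * (x `^ kappa k / 2))).
  rewrite mulrA -powRD_pos// ler_pdivlMr//; apply: (@le_trans _ _ (x `^ (3 * e))); first by lra.
  by apply: xle; lra.
by rewrite ler_wpM2l ?powR_ge0//; lra.
Qed.
End Oscillation.

(** * Type I and Type II exponential sums *)

Section Bilinear.
Variable R : realType.
Variables (l : nat) (theta : R) (F : nat -> R -> R).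
Hypothesis l0 : (0 < l)%N.
Hypothesis RF : regular_chain l theta F.

Lemma near_pinfty_nat (P : R -> Prop) :
  (\forall x \near +oo, P x) -> \forall X \near \oo, P X%:R.
Proof.
move=> /near_pinftyP[A A1 AP].
exists (Num.truncn A).+1 => // X /= AX; apply: AP.
by rewrite (le_trans (ltW (truncnS_gt A)))// ler_nat.
Qed.

Lemma near_forall_lt (K : nat) (P : nat -> R -> Prop) :
  (forall k, (k < K)%N -> \forall x \near +oo, P k x) ->
  \forall x \near +oo, forall k, (k < K)%N -> P k x.
Proof.
elim: K => [|K IH] HP; first by apply: nearW.
have {}IH := IH (fun k kK => HP k (ltnW kK)).
apply: filterS2 IH (HP K (ltnSn K)) => x h1 h2 k.
by rewrite ltnS leq_eqVlt => /orP[/eqP->|/h1].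
Qed.

Lemma is_derive_exprn (k : nat) (t : R) :
  is_derive (t : R) (1 : R) (fun v : R => v ^+ k.+1) (k.+1%:R * t ^+ k).
Proof.
elim: k => [|k IH].
  rewrite (_ : (fun v : R => v ^+ 1) = id); first by apply: is_derive_eq; rewrite mulr1.
  by apply/funext => v; rewrite expr1.
rewrite (_ : (fun v : R => v ^+ k.+2) = (fun v : R => v * v ^+ k.+1)); last first.
  by apply/funext => v; rewrite -exprS.
by apply: is_derive_eq; rewrite /GRing.scale/= -[k.+2%:R]natr1 exprS; ring.
Qed.

Lemma is_derive_dilate (f : R -> R) (c q u d : R) :
  is_derive (q * u) 1 f d -> is_derive u 1 (fun v => c * f (q * v)) (c * (q * d)).
Proof.
move=> fd; have d1 : is_derive u 1 (fun v : R => q * v) q.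
  by apply: is_derive_eq; rewrite /GRing.scale/= mulr1.
have d2 : is_derive u 1 (fun v : R => f (q * v)) (d * q).
  exact: (@is_derive1_comp R f (fun v => q * v) u _ _ fd d1).
by apply: is_derive_eq; rewrite /GRing.scale/=; ring.
Qed.

Lemma chain_window (K : nat) (e : R) : 0 < e -> \forall x \near +oo,
  (forall j y, (j < K)%N -> x / 32 <= y -> is_derive (y : R) (1 : R) (F j) (F j.+1 y)) /\
  (forall k, (l < k <= K)%N -> exists2 s : R, (s == 1) || (s == -1) &
    forall y, x / 32 <= y -> y <= 32 * x ->
    (x `^ (theta - k%:R - e) <= s * F k y <= x `^ (theta - k%:R + e)) /\
    `|s * (y * F k.+1 y) - (theta - k%:R) * (s * F k y)| <= e * (s * F k y)).
Proof.
move=> e0; have [FD _ Fk] := RF; apply: filterI.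
  have : \forall x \near +oo, forall j, (j < K)%N -> is_derive (x : R) (1 : R) (F j) (F j.+1 x).
    by apply: near_forall_lt => j _; exact: FD.
  move=> /near_pinftyP[A A1 HA]; apply: filterS (near_pinfty_ge (32 * A)) => x Ax j y jK xy.
  by apply: HA => //; lra.
have : \forall x \near +oo, forall k, (k < K.+1)%N -> (l < k)%N ->
    exists2 s : R, (s == 1) || (s == -1) &
    forall y, x / 32 <= y -> y <= 32 * x ->
    (x `^ (theta - k%:R - e) <= s * F k y <= x `^ (theta - k%:R + e)) /\
    `|s * (y * F k.+1 y) - (theta - k%:R) * (s * F k y)| <= e * (s * F k y).
  apply: near_forall_lt => k _; have [lk|kl] := boolP (l < k)%N; last by apply: nearW.
  have [sF rF] := Fk k lk; have [s s1 H] := size_window (FD k) sF rF e0.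
  by apply: filterS H => x Hx _; exists s.
by apply: filterS => x Hx k /andP[lk kK]; exact: Hx.
Qed.

(** By the chain rule the derivatives are q^j F j (q u). The condition q^2 <= X gives X / q >=
    X^(1/2), hence m0 = 1/2. *)
Lemma linear_sum_bound : exists2 e : R, 0 < e & \forall X \near \oo,
  forall q b : nat, (0 < q)%N -> (q ^ 2 <= X)%N -> (b <= 2 * X %/ q)%N ->
  `|\sum_((X %/ q).+1 <= j < b.+1) cosp (F 0%N (q * j)%:R)| <=
    2 * (X%:R / q%:R) * X%:R `^ (- e).
Proof.
have [_ lt _] := RF.
have m0 : 0 < (2^-1 : R) <= 1 by apply/andP; split; lra.
have [K [e [e0 osc]]] := oscillation lt l0 m0.
exists e => //.
have CW := chain_window K e0.
apply: filterS (near_pinfty_nat (filterI (near_pinfty_ge 1) (filterI osc CW))).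
move=> X [X1 [{}osc [CD CB]]] q b q0 qX bX.
have q0R : 0 < q%:R :> R by rewrite ltr0n.
have qXR : q%:R * q%:R <= X%:R :> R by rewrite -natrM ler_nat.
have [bA|Ab] := leqP b (X %/ q).
  by rewrite big_geq ?normr0.
set A := (X %/ q).+1.
have XqA : (X < A * q)%N by rewrite -ltn_divLR.
have AqX : ((X %/ q) * q <= X)%N by exact: leq_trunc_div.
have q1X : q%:R <= X%:R :> R.
  by apply: le_trans qXR; rewrite ler_peMl ?(ltW q0R)// ler1n.
have X0 : 0 < X%:R :> R by lra.
have -> : \sum_(A <= j < b.+1) cosp (F 0%N (q * j)%:R) =
    \sum_(n < b.+1 - A) cosp (q%:R ^+ 0 * F 0%N (q%:R * (A + n)%:R)).
  rewrite -{1}(add0n A) big_addn big_mkord; apply: eq_bigr => n _.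
  by rewrite expr0 mul1r -natrM addnC.
have A2 : (2 * X %/ q < 2 * A)%N by rewrite ltn_divLR//; clear -XqA; lia.
have NA : (b.+1 - A <= A)%N by clear -bX A2; lia.
have qA : X%:R <= q%:R * A%:R :> R by rewrite -natrM ler_nat mulnC ltnW.
have qA2 : q%:R * A%:R <= 2 * X%:R :> R.
  have : (q * A <= X + q)%N by rewrite /A mulnS addnC leq_add2r mulnC.
  by rewrite -(ler_nat R) natrM natrD; lra.
have P1 : 1 <= q%:R :> R by rewrite ler1n.
have xP : X%:R `^ 2^-1 <= X%:R / q%:R :> R.
  rewrite powR12_sqrt ?(ltW X0)// ler_pdivlMr//.
  rewrite -[leRHS]sqr_sqrtr ?(ltW X0)// expr2 ler_wpM2l ?sqrtr_ge0//.
  by rewrite -[leLHS]ger0_norm// -sqrtr_sqr ler_wsqrtr// expr2.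
have xM : X%:R / q%:R <= A%:R :> R by rewrite ler_pdivrMr// mulrC.
apply: (@le_trans _ _ (A%:R * X%:R `^ (- e))); last first.
  by rewrite ler_wpM2r ?powR_ge0// mulrA ler_pdivlMr// mulrC.
have win (u : R) : A%:R <= u <= (A + 3 * A)%:R ->
    X%:R / 32 <= q%:R * u /\ q%:R * u <= 32 * X%:R.
  rewrite natrD natrM => /andP[u1 u2]; have := ler_wpM2l (ltW q0R) u1.
  by have := ler_wpM2l (ltW q0R) u2; lra.
apply: (osc q%:R A (b.+1 - A)%N A (fun j u => q%:R ^+ j * F j (q%:R * u))) => //.
- move=> j u jK /win[y1 y2].
  have d := is_derive_dilate (q%:R ^+ j) (CD j _ jK y1).
  by apply: is_derive_eq d _; rewrite exprSr mulrA.
- move=> k kK; have [s s1 Hs] := CB k kK; exists s => // u /win[y1 y2].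
  have [/andP[b1 b2] _] := Hs _ y1 y2.
  by rewrite mulrCA !ler_pM2l ?exprn_gt0// b1.
Qed.

(** The k-th derivative in u of f(d1 u) - f(d2 u) is a difference of values of t^k F k (t u). By the
    mean value theorem in t it equals (d1 - d2) t^(k-1) (k F k + y F (k+1)) at y = t u, and the last
    factor is close to theta F k. Since d1 - d2 >= D X^(-e), the size is still D^k X^(theta - k) up
    to a small power of X. *)
Lemma pair_sum_bound : exists2 e : R, 0 < e <= 8^-1 & \forall X \near \oo,
  forall D d1 d2 a b : nat, (0 < D)%N -> (X%:R : R) `^ 8^-1 <= X%:R / D%:R ->
  (D < d2)%N -> (d2 < d1)%N -> (d1 <= 2 * D)%N ->
  D%:R * (X%:R : R) `^ (- e) <= (d1 - d2)%:R ->
  (X <= 2 * D * a)%N -> (b <= (2 * X %/ D).+1)%N ->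
  `|\sum_(a <= j < b) cosp (F 0%N (d1 * j)%:R - F 0%N (d2 * j)%:R)| <=
    3 * (X%:R / D%:R) * X%:R `^ (- e).
Proof.
have [_ lt _] := RF.
have m0 : 0 < (8^-1 : R) <= 1 by apply/andP; split; lra.
have [K [e1 [e10 osc]]] := oscillation lt l0 m0.
(* The lower bound loses X^(-e) three times: in d1 - d2, in the size of F k, and in constants. *)
pose e := Num.min (e1 / 3) 8^-1.
have e0 : 0 < e by rewrite lt_min; apply/andP; split; lra.
have e18 : e <= 8^-1 by rewrite ge_min lexx orbT.
have e13 : e <= e1 / 3 by rewrite ge_min lexx.
exists e; first by rewrite e0.
(* One order more than [oscillation] asks for, since t^k F k (t u) is differentiated once more in
   t. *)
have CW := chain_window K.+1 e0.
apply: filterS (near_pinfty_nat (filterI (filterI (near_pinfty_ge 1)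
  (near_pinfty_powR_ge (2 ^+ K * (l.+2)%:R) e0)) (filterI osc CW))).
move=> X [[X1 Xe] [{}osc [CD CB]]] D d1 d2 a b D0 XD Dd2 d21 d1D Dd Xa bX.
have D0R : 0 < D%:R :> R by rewrite ltr0n.
have X0 : 0 < X%:R :> R by lra.
have [ba|ab] := leqP b a.
  by rewrite big_geq// normr0 mulr_ge0 ?powR_ge0// mulr_ge0// divr_ge0.
set M := (2 * X %/ D).+1.
have XMD : 2 * X%:R <= M%:R * D%:R :> R.
  by rewrite -!natrM ler_nat ltnW// -ltn_divLR.
have xle (c1 c2 : R) : c1 <= c2 -> (X%:R : R) `^ c1 <= X%:R `^ c2 by move=> h; rewrite ler_powR.
have DX : D%:R <= X%:R :> R.
  have : 1 <= X%:R / D%:R :> R.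
    by apply: le_trans XD; rewrite -[leLHS](powRr0 X%:R); apply: xle; lra.
  by rewrite ler_pdivlMr// mul1r.
have MDX : M%:R * D%:R <= 3 * X%:R :> R.
  have : (M * D <= 2 * X + D)%N by rewrite /M mulSn addnC leq_add2r leq_trunc_div.
  by rewrite -(ler_nat R) natrD !natrM; lra.
have -> : \sum_(a <= j < b) cosp (F 0%N (d1 * j)%:R - F 0%N (d2 * j)%:R) =
    \sum_(n < b - a) cosp (d1%:R ^+ 0 * F 0%N (d1%:R * (a + n)%:R) -
       d2%:R ^+ 0 * F 0%N (d2%:R * (a + n)%:R)).
  rewrite -{1}(add0n a) big_addn big_mkord; apply: eq_bigr => n _.
  by rewrite !expr0 !mul1r -!natrM addnC.
have P1 : 1 <= D%:R :> R by rewrite ler1n.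
have xM : X%:R / D%:R <= M%:R :> R by rewrite ler_pdivrMr//; lra.
have NM : (b - a <= M)%N by rewrite (leq_trans (leq_subr _ _)).
have aM : (a <= M)%N by rewrite (leq_trans (ltnW ab)).
apply: (@le_trans _ _ (M%:R * X%:R `^ (- e1))); last first.
  rewrite ler_pM ?powR_ge0//; last by apply: xle; lra.
  by rewrite mulrA ler_pdivlMr.
have d2R : D%:R <= d2%:R :> R by rewrite ler_nat ltnW.
have d1R : d1%:R <= 2 * D%:R :> R by rewrite -natrM ler_nat.
have d21R : d2%:R <= d1%:R :> R by rewrite ler_nat ltnW.
have XaR : X%:R <= 2 * D%:R * a%:R :> R by rewrite -!natrM ler_nat.
have aR : a%:R <= M%:R :> R by rewrite ler_nat.
have win (t u : R) : d2%:R <= t <= d1%:R -> a%:R <= u <= (a + 3 * M)%:R ->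
    X%:R / 32 <= t * u /\ t * u <= 32 * X%:R.
  rewrite natrD natrM => /andP[t1 t2] /andP[u1 u2].
  have a0 : 0 <= a%:R :> R by [].
  have Dt : D%:R <= t := le_trans d2R t1.
  have h1 : D%:R * a%:R <= t * u by rewrite ler_pM// ltW.
  have h2 : t * u <= (2 * D%:R) * (4 * M%:R) by rewrite ler_pM//;
    clear -t1 t2 u1 u2 d1R aR d2R D0R a0 Dt; lra.
  by clear -h1 h2 XaR MDX X0; lra.
have in1 : (d2%:R <= d1%:R :> R) && (d1%:R <= d1%:R :> R) by rewrite d21R lexx.
have in2 : (d2%:R <= d2%:R :> R) && (d2%:R <= d1%:R :> R) by rewrite d21R lexx.
apply: (osc D%:R M (b - a)%N a (fun j u => d1%:R ^+ j * F j (d1%:R * u) -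
   d2%:R ^+ j * F j (d2%:R * u))) => //.
- move=> j u jK uI; have [y1 _] := win _ u in1 uI; have [y2 _] := win _ u in2 uI.
  have h1 := is_derive_dilate (d1%:R ^+ j) (CD j _ (leqW jK) y1).
  have h2 := is_derive_dilate (d2%:R ^+ j) (CD j _ (leqW jK) y2).
  by apply: is_derive_eq (is_deriveB h1 h2) _; rewrite !exprSr !mulrA.
move=> k /andP[lk kK]; have [s s1 Hs] := CB k ltac:(by rewrite lk leqW).
exists s => // u uI.
pose psi' (t : R) := t ^+ k.-1 * (k%:R * F k (t * u) + (t * u) * F k.+1 (t * u)).
have k0 : (0 < k)%N by apply: leq_ltn_trans lk.
have dpsi (t : R) : d2%:R <= t <= d1%:R ->
    is_derive (t : R) (1 : R) (fun t => t ^+ k * F k (t * u)) (psi' t).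
  move=> tI; have [y1 y2] := win _ _ tI uI.
  have h1 : is_derive t 1 (fun v => 1 * F k (u * v)) (1 * (u * F k.+1 (u * t))).
    by apply: is_derive_dilate; rewrite mulrC; apply: CD.
  have h2 : is_derive t 1 (fun v => F k (v * u)) (u * F k.+1 (t * u)).
    rewrite (_ : (fun v => _) = (fun v => 1 * F k (u * v))).
      by apply: is_derive_eq h1 _; rewrite mul1r (mulrC u t).
    by apply/funext => v; rewrite mul1r mulrC.
  have h3 : is_derive t 1 (fun v : R => v ^+ k) (k%:R * t ^+ k.-1).
    by have := is_derive_exprn k.-1 t; rewrite prednK.
  apply: is_derive_eq; have tk : t ^+ k = t ^+ k.-1 * t by rewrite -exprSr prednK.
  rewrite /psi' /GRing.scale/= tk.
  ring.
have [||t tI E] := @MVT_segment R (fun t => t ^+ k * F k (t * u)) psi' d2%:R d1%:R d21R.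
- by move=> t; rewrite in_itv/= => /andP[/ltW ? /ltW ?]; apply: dpsi; apply/andP.
- apply: derivable_within_continuous => t; rewrite in_itv/= => tI.
  by apply: ex_derive; exact: dpsi.
rewrite in_itv/= in tI.
rewrite E; have [y1 y2] := win _ _ tI uI.
have [/andP[b1 b2] b3] := Hs _ y1 y2.
set y := t * u in y1 y2 b1 b2 b3 *.
have f0 : 0 < s * F k y by apply: lt_le_trans b1; rewrite powR_gt0.
(* W is theta * (s F k y) up to relative error e; here theta >= l >= 1 prevents cancellation. *)
pose W := k%:R * (s * F k y) + s * (y * F k.+1 y).
have lR : 1 <= l%:R :> R by rewrite ler1n.
have [lt1 lt2] := andP lt.
have W1 : 2^-1 * (s * F k y) <= W.
  have te : 0 <= theta - e - 2^-1 by move: lR lt1 e18; clear; lra.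
  move: b3 (mulr_ge0 te (ltW f0)); rewrite /W ler_norml => /andP[h _].
  by clear -h; lra.
have W2 : W <= l.+2%:R * (s * F k y).
  have te : 0 <= l.+2%:R - theta - e.
    by move: lt2 e18; rewrite -[l.+2%:R]natr1; clear; lra.
  move: b3 (mulr_ge0 te (ltW f0)); rewrite /W ler_norml => /andP[_ h].
  by clear -h; lra.
have -> : s * (psi' t * (d1%:R - d2%:R)) = t ^+ k.-1 * (d1%:R - d2%:R) * W.
  by rewrite /psi' /W -/y; ring.
rewrite natrB ?(ltnW d21)// in Dd.
have [t1 t2] := andP tI.
have Dt : D%:R <= t := le_trans d2R t1.
have t2D : t <= 2 * D%:R := le_trans t2 d1R.
have t0 : 0 <= t := le_trans (ltW D0R) Dt.
have x0e : 0 < X%:R `^ (- e) :> R by rewrite powR_gt0.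
have K2 : 2 ^+ k.-1 <= 2 ^+ K :> R by rewrite ler_eXn2l ?ltr1n// (leq_trans (leq_pred k)).
have K1 : 1 <= 2 ^+ k.-1 :> R by rewrite exprn_ege1// ler1n.
have Xe2 : 2 <= (X%:R : R) `^ e.
  apply: le_trans Xe; rewrite -[leLHS]mul1r ler_pM// ?ler_nat//.
  by rewrite (le_trans K1 K2).
apply/andP; split.
  apply: (@le_trans _ _ (D%:R ^+ k.-1 * (D%:R * X%:R `^ (- e)) *
      (2^-1 * X%:R `^ (theta - k%:R - e)))); last first.
    rewrite !ler_pM ?mulr_ge0 ?exprn_ge0 ?powR_ge0 ?(ltW D0R)//.
    - by rewrite lerXn2r ?nnegrE// ?(ltW D0R)// (le_trans _ Dt).
    - by apply: le_trans W1; rewrite ler_pM2l.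
  rewrite [D%:R ^+ k](_ : _ = D%:R ^+ k.-1 * D%:R); last by rewrite -exprSr prednK.
  rewrite -!mulrA !ler_pM2l ?exprn_gt0// mulrCA.
  rewrite -powRD_pos// ler_pdivlMl// -[2]/(2%:R).
  apply: (@le_trans _ _ (X%:R `^ e * X%:R `^ (theta - k%:R - e1))).
    by rewrite ler_wpM2r// powR_ge0.
  by rewrite -powRD_pos//; apply: xle; clear -e13 e10 e0; lra.
apply: (@le_trans _ _ (2 ^+ k.-1 * D%:R ^+ k.-1 * D%:R *
    (l.+2%:R * X%:R `^ (theta - k%:R + e)))).
  rewrite !ler_pM ?mulr_ge0 ?exprn_ge0 ?subr_ge0//.
  - by rewrite (le_trans _ W1)// mulr_ge0// ltW.
  - by rewrite -exprMn lerXn2r ?nnegrE ?mulr_ge0.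
  - by clear -d2R d1R; lra.
  - by apply: (le_trans W2); rewrite ler_pM2l// ltr0n.
rewrite [D%:R ^+ k](_ : _ = D%:R ^+ k.-1 * D%:R); last by rewrite -exprSr prednK.
rewrite [leLHS](_ : _ = D%:R ^+ k.-1 * D%:R * (2 ^+ k.-1 * l.+2%:R *
  X%:R `^ (theta - k%:R + e))); last by ring.
rewrite ler_wpM2l ?mulr_ge0 ?exprn_ge0//.
apply: (@le_trans _ _ (X%:R `^ e * X%:R `^ (theta - k%:R + e))).
  rewrite ler_wpM2r ?powR_ge0// (le_trans _ Xe)// ler_wpM2r//.
by rewrite -powRD_pos//; apply: xle; clear -e13 e10 e0; lra.
Qed.

Lemma sum_ord_interval (J a b : nat) (h : nat -> R) : (b <= J)%N ->
  \sum_(j < J) ((a <= j) && (j < b))%N%:R * h j = \sum_(a <= j < b) h j.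
Proof.
move=> bJ; rewrite (big_nat_widenl a 0)// (big_nat_widen _ _ _ _ _ bJ) big_mkord.
rewrite [RHS]big_mkcond; apply: eq_bigr => j _ /=.
by case: ifP; rewrite ?mul1r ?mul0r.
Qed.

(** Cauchy-Schwarz over j removes the coefficients c, and expanding the square leaves sums over j
    for pairs (d1, d2). Pairs closer than D X^(-e) are few and bounded trivially; the others fall
    under [pair_sum_bound]. The final square root halves the exponent. *)
Lemma bilinear_sum_bound : exists2 e : R, 0 < e & \forall X \near \oo,
  forall (D : nat) (a c : nat -> R) (L : R),
  (X%:R : R) `^ 8^-1 <= X%:R / D%:R -> (X%:R : R) `^ 8^-1 <= D%:R ->
  (forall d, `|a d| <= 1) -> (forall j, (j <= 2 * X)%N -> `|c j| <= L) ->
  `|\sum_(i < D) \sum_(j < (2 * X %/ D).+1)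
     ((X < (D.+1 + i) * j) && ((D.+1 + i) * j <= 2 * X))%N%:R *
     (a (D.+1 + i)%N * c j * cosp (F 0%N ((D.+1 + i) * j)%:R))| <=
  6 * X%:R * L * X%:R `^ (- e).
Proof.
have [e /andP[e0 e8] pair] := pair_sum_bound.
exists (e / 2); first by rewrite divr_gt0.
apply: filterS (filterI (near_pinfty_nat (near_pinfty_ge 1)) pair).
move=> X [X1 {}pair] D a c L XD DX a1 cL.
have X0 : 0 < X%:R :> R by lra.
have X8 : 1 <= (X%:R : R) `^ 8^-1 by rewrite -[leLHS](powRr0 (X%:R : R)) ler_powR.
have D0R : 0 < D%:R :> R by lra.
have D0 : (0 < D)%N by rewrite -(ltr0n R).
set J := (2 * X %/ D).+1.
have DleX : D%:R <= X%:R :> R.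
  by have := le_trans X8 XD; rewrite ler_pdivlMr// mul1r.
have JD : J%:R * D%:R <= 3 * X%:R :> R.
  have : (J * D <= 2 * X + D)%N by rewrite /J mulSn addnC leq_add2r leq_trunc_div.
  by rewrite -(ler_nat R) natrD !natrM; lra.
have L0 : 0 <= L by apply: le_trans (cL 0%N _).
pose d (i : nat) := (D.+1 + i)%N.
pose p (i j : nat) := ((X < d i * j) && (d i * j <= 2 * X))%N.
pose f (i j : nat) := F 0%N (d i * j)%:R.
pose T (j : nat) := \sum_(i < D) (a (d i) * (p i j)%:R) * cosp (f i j).
pose U (i1 i2 : nat) := \sum_(j < J) (p i1 j && p i2 j)%:R * cosp (f i1 j - f i2 j).
have JX j : (j < J)%N -> (j <= 2 * X)%N.
  by rewrite ltnS => /leq_trans; apply; exact: leq_div.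
have -> : \sum_(i < D) \sum_(j < J) (p i j)%:R * (a (d i) * c j * cosp (f i j)) =
    \sum_(j < J) c j * T j.
  rewrite exchange_big; apply: eq_bigr => j _; rewrite mulr_sumr.
  by apply: eq_bigr => i _; ring.
pose xe := (X%:R : R) `^ (- e).
have xe0 : 0 < xe by rewrite powR_gt0.
(* D >= X^(1/8) and e <= 1/8: the diagonal pairs are absorbed in the count of close pairs. *)
have xe1 : 1 <= D%:R * xe.
  apply: (@le_trans _ _ (X%:R `^ 8^-1 * xe)); last by rewrite ler_pM2r.
  by rewrite -powRD_pos// -[leLHS](powRr0 (X%:R : R)) ler_powR//; lra.
have Uge (i1 i2 : 'I_D) : (i2 < i1)%N -> D%:R * xe <= (i1 - i2)%:R ->
    `|U i1 i2| <= 3 * (X%:R / D%:R) * xe.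
  move=> i21 Di.
  have d21 : (d i2 < d i1)%N by rewrite ltn_add2l.
  have d20 : (0 < d i2)%N by [].
  have d10 : (0 < d i1)%N by [].
  (* The smaller factor d i2 gives the binding lower end of the range of j, the larger factor d i1
     the upper end. *)
  have -> : U i1 i2 = \sum_((X %/ d i2).+1 <= j < (2 * X %/ d i1).+1)
      cosp (F 0%N (d i1 * j)%:R - F 0%N (d i2 * j)%:R).
    rewrite -(@sum_ord_interval J); last first.
      by rewrite ltnS leq_div2l// /d addSnnS leq_addr.
    apply: eq_bigr => j _; congr (_ %:R * _); rewrite /p !ltnS.
    rewrite ltn_divLR// leq_divRL// ![(d _ * j)%N]mulnC.
    have h : (j * d i2 <= j * d i1)%N by rewrite leq_mul2l (ltnW d21) orbT.
    case: (ltnP X (j * d i2)) => h1; last by rewrite !andFb andbF.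
    rewrite (leq_trans h1 h)/=; case: (leqP (j * d i1) (2 * X)) => h2 //.
    by rewrite (leq_trans h h2).
  apply: pair => //.
  - by rewrite /d addSn ltnS leq_addr.
  - by rewrite /d mul2n -addnn addSnnS leq_add2l.
  - by rewrite /d subnDl.
  - have h : (d i2 <= 2 * D)%N by rewrite /d mul2n -addnn addSnnS leq_add2l.
    rewrite (@leq_trans (d i2 * (X %/ d i2).+1))//; last by rewrite leq_mul2r h orbT.
    by rewrite mulnC ltnW// -ltn_divLR.
  - by rewrite ltnS leq_div2l// /d addSnnS leq_addr.
have Usym (i1 i2 : 'I_D) : U i1 i2 = U i2 i1.
  by apply: eq_bigr => j _; rewrite andbC -cospN opprB.
have UJ (i1 i2 : 'I_D) : `|U i1 i2| <= J%:R.
  apply: (le_trans (ler_norm_sum _ _ _)).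
  apply: (@le_trans _ _ (\sum_(j < J) (1 : R))); last by rewrite sumr_const card_ord.
  apply: ler_sum => j _; rewrite normrM; case: (_ && _); last by rewrite normr0 mul0r.
  by rewrite normr1 mul1r; exact: cosp_le1.
pose close (i1 i2 : nat) := ((i1 - i2 + (i2 - i1))%:R < D%:R * xe).
have UB (i1 i2 : 'I_D) : `|U i1 i2| <= 3 * (X%:R / D%:R) * xe + J%:R * (close i1 i2)%:R.
  have xd : 0 <= 3 * (X%:R / D%:R) * xe by rewrite !mulr_ge0 ?invr_ge0// ltW.
  have [cl|] := boolP (close i1 i2); first by rewrite mulr1 ler_wpDl.
  rewrite /close -leNgt mulr0 addr0; case: (ltngtP i1 i2) => h.
  - by rewrite (eqP (ltnW h : (i1 - i2 == 0)%N)) add0n Usym; exact: Uge.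
  - by rewrite [(i2 - i1)%N](eqP (ltnW h : (i2 - i1 == 0)%N)) addn0; exact: Uge.
  - by rewrite h !subnn addn0 => ?; exfalso; lra.
have cnt (i1 : 'I_D) : \sum_(i2 < D) (close i1 i2)%:R <= 2 * (D%:R * xe) + 1.
  apply: count_clustered; first by rewrite !mulr_ge0// ltW.
  move=> i j ij jD c1 c2.
  apply: (@le_trans _ _ ((i1 - i + (i - i1))%:R + (i1 - j + (j - i1))%:R)).
    by rewrite -natrD ler_nat; clear -ij; lia.
  by move: c1 c2; rewrite /close; lra.
have ST : \sum_(j < J) `|T j| ^+ 2 <= 12 * X%:R * (D%:R * xe).
  apply: (@le_trans _ _ (\sum_(i1 < D) \sum_(i2 < D) `|U i1 i2|)).
    apply: (@le_trans _ _ (\sum_(j < J) \sum_(i1 < D) \sum_(i2 < D)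
        (a (d i1) * (p i1 j)%:R) * (a (d i2) * (p i2 j)%:R) * cosp (f i1 j - f i2 j))).
      apply: ler_sum => j _; rewrite real_normK ?num_real//.
      exact: (@sqr_sum_cosp _ _ (fun i : 'I_D => a (d i) * (p i j)%:R) (fun i : 'I_D => f i j)).
    rewrite exchange_big/=; apply: ler_sum => i1 _.
    rewrite exchange_big/=; apply: ler_sum => i2 _.
    have -> : \sum_(j < J) (a (d i1) * (p i1 j)%:R) * (a (d i2) * (p i2 j)%:R) *
        cosp (f i1 j - f i2 j) = a (d i1) * a (d i2) * U i1 i2.
      rewrite /U mulr_sumr; apply: eq_bigr => j _; rewrite -mulnb natrM; ring.
    rewrite (le_trans (ler_norm _))// !normrM ler_piMl//.
    by rewrite mulr_ile1.
  apply: (@le_trans _ _ (\sum_(i1 < D) (D%:R * (3 * (X%:R / D%:R) * xe) +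
      J%:R * (2 * (D%:R * xe) + 1)))).
    apply: ler_sum => i1 _; apply: (le_trans (ler_sum _ (fun i2 _ => UB i1 i2))).
    rewrite big_split/= sumr_const card_ord -[_ *+ D]mulr_natl lerD2l -mulr_sumr.
    by rewrite ler_wpM2l.
  rewrite sumr_const card_ord -[leLHS]mulr_natl.
  have -> : D%:R * (D%:R * (3 * (X%:R / D%:R) * xe) + J%:R * (2 * (D%:R * xe) + 1)) =
    3 * X%:R * (D%:R * xe) + (J%:R * D%:R) * (2 * (D%:R * xe) + 1).
    by field; rewrite gt_eqF.
  apply: (@le_trans _ _ (3 * X%:R * (D%:R * xe) + (3 * X%:R) * (3 * (D%:R * xe)))).
    by rewrite lerD2l ler_pM//; lra.
  by lra.
have S2 : (\sum_(j < J) `|c j * T j|) ^+ 2 <= (6 * X%:R * L) ^+ 2 * xe.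
  apply: (le_trans (sqr_sum_le J (fun j => `|c j * T j|))).
  apply: (@le_trans _ _ (J%:R * (L ^+ 2 * (12 * X%:R * (D%:R * xe))))).
    rewrite ler_wpM2l//; apply: (@le_trans _ _ (\sum_(j < J) L ^+ 2 * `|T j| ^+ 2)).
      apply: ler_sum => j _; rewrite normrM exprMn ler_wpM2r ?sqr_ge0//.
      by rewrite lerXn2r ?nnegrE// cL// JX.
    by rewrite -mulr_sumr ler_wpM2l ?sqr_ge0.
  have -> : J%:R * (L ^+ 2 * (12 * X%:R * (D%:R * xe))) =
    (J%:R * D%:R) * (12 * X%:R * L ^+ 2 * xe) by ring.
  have -> : (6 * X%:R * L) ^+ 2 * xe = 3 * X%:R * (12 * X%:R * L ^+ 2 * xe) by ring.
  by rewrite ler_wpM2r// !mulr_ge0 ?sqr_ge0// ltW.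
apply: (le_trans (ler_norm_sum _ _ _)).
have xeE : xe = ((X%:R : R) `^ (- (e / 2))) ^+ 2.
  by rewrite expr2 -powRD_pos// /xe; congr (_ `^ _); field.
rewrite -[leLHS]ger0_norm ?sumr_ge0// -[leRHS]ger0_norm; last first.
  by rewrite !mulr_ge0 ?powR_ge0// ltW.
by rewrite -ler_sqr ?nnegrE// !real_normK ?num_real// exprMn -xeE.
Qed.

End Bilinear.

(** * Vaughan's identity *)

Section DivisorSums.
Variable R : realType.

Notation "\dsum_ ( d | n ) F" := (\sum_(1 <= d < n.+1 | (d %| n)%N) F)
  (at level 41, d at level 50, F at level 41).

Lemma dsum_widen (n N : nat) (f : nat -> R) : (0 < n)%N -> (n <= N)%N ->
  \dsum_(d | n) f d = \sum_(1 <= d < N.+1 | (d %| n)%N) f d.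
Proof.
move=> n0 nN; rewrite (big_nat_widen _ _ _ _ _ (nN : (n.+1 <= N.+1)%N)).
apply: eq_bigl => d; rewrite ltnS; apply/andP/idP => [[]//|dn]; split=> //.
exact: dvdn_leq.
Qed.

Lemma sum_multiples (d a b : nat) (f : nat -> R) : (0 < d)%N ->
  \sum_(a.+1 <= n < b.+1 | (d %| n)%N) f (n %/ d)%N =
    \sum_((a %/ d).+1 <= j < (b %/ d).+1) f j.
Proof.
move=> d0; have [ba|ab] := leqP b a.
  by rewrite !big_geq// ltnS leq_div2r.
have [k ->] : exists k, b = (a + k)%N by exists (b - a)%N; rewrite subnKC// ltnW.
elim: k => [|k IH]; first by rewrite addn0 !big_geq.
rewrite addnS big_mkcond big_nat_recr/= -?big_mkcond; last by rewrite ltnS leq_addr.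
rewrite IH divnS//; case: (d %| (a + k).+1)%N; last by rewrite add0n addr0.
by rewrite add1n [RHS]big_nat_recr//= ltnS leq_div2r// leq_addr.
Qed.

Lemma hyperbola (a b : nat) (f : nat -> nat -> R) :
  \sum_(a.+1 <= n < b.+1) \dsum_(d | n) f d (n %/ d)%N =
    \sum_(1 <= d < b.+1) \sum_((a %/ d).+1 <= j < (b %/ d).+1) f d j.
Proof.
rewrite (eq_big_nat _ _ (F2 := fun n =>
    \sum_(1 <= d < b.+1 | (d %| n)%N) f d (n %/ d)%N)); last first.
  by move=> n /andP[an nb]; apply: dsum_widen; [exact: leq_trans an|].
under eq_bigr do rewrite big_mkcond.
rewrite exchange_big_nat/=; apply: eq_big_nat => d /andP[d0 _].
by rewrite -big_mkcond (sum_multiples _ _ (f d)).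
Qed.

(** Both sides run over the pairs with d m | n. *)
Lemma dsum_exchange (n : nat) (f : nat -> nat -> R) : (0 < n)%N ->
  \dsum_(d | n) \dsum_(m | (n %/ d)%N) f d m =
  \dsum_(m | n) \dsum_(d | (n %/ m)%N) f d m.
Proof.
move=> n0.
have E (g : nat -> nat -> R) : \dsum_(d | n) \dsum_(m | (n %/ d)%N) g d m =
    \sum_(1 <= d < n.+1) \sum_(1 <= m < n.+1 | (d * m %| n)%N) g d m.
  rewrite big_mkcond; apply: eq_big_nat => d /andP[d0 _].
  case: ifPn => dn.
    have nd0 : (0 < n %/ d)%N by rewrite divn_gt0// dvdn_leq.
    rewrite (dsum_widen _ nd0 (leq_div _ _)); apply: eq_bigl => m.
    by rewrite -(dvdn_pmul2l d0) mulnC [(d * (_ %/ d))%N]mulnC divnK// mulnC.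
  rewrite big1// => m dm; exfalso; move/negP: dn; apply.
  exact: dvdn_trans (dvdn_mulr _ _) dm.
rewrite (E f) (E (fun m d => f d m)).
under eq_bigr do rewrite big_mkcond.
rewrite exchange_big_nat/=; apply: eq_bigr => m _.
by rewrite -big_mkcond; apply: eq_bigl => d; rewrite mulnC.
Qed.

Definition vonMangoldt (n : nat) : R := if primes n is [:: p] then ln p%:R else 0.

Lemma vonMangoldt_prime p : prime p -> vonMangoldt p = ln p%:R.
Proof. by move=> pp; rewrite /vonMangoldt primes_prime. Qed.

Lemma vonMangoldt_neq0 n : vonMangoldt n != 0 ->
  exists p b, [/\ prime p, (0 < b)%N, n = (p ^ b)%N & vonMangoldt n = ln p%:R].
Proof.
have [->|n0] := posnP n; first by rewrite /vonMangoldt eqxx.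
rewrite /vonMangoldt; case E: (primes n) => [|p [|q s]]; rewrite ?eqxx// => _.
have : p \in primes n by rewrite E mem_head.
rewrite mem_primes => /and3P[pp _ pn].
exists p, (logn p n); split=> //; first by rewrite logn_gt0 E mem_head.
by rewrite {1}(prod_prime_decomp n0) prime_decompE E big_map big_seq1.
Qed.

Lemma vonMangoldt_pfactor p b : prime p -> (0 < b)%N -> vonMangoldt (p ^ b) = ln p%:R.
Proof. by move=> pp b0; rewrite /vonMangoldt primesX// primes_prime. Qed.

Lemma ln_nat_ge0 n : 0 <= ln n%:R :> R.
Proof. by case: n => [|n]; [rewrite ln0|rewrite ln_ge0// ler1n]. Qed.

Lemma vonMangoldt_ge0 n : 0 <= vonMangoldt n.
Proof. by rewrite /vonMangoldt; case: (primes n) => [|p [|q s]]//; exact: ln_nat_ge0. Qed.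

(** Write n = p m with p prime. The only prime power that divides n but not m is p^(logn p m + 1),
    which contributes ln p. *)
Lemma sum_vonMangoldt n : (0 < n)%N -> \dsum_(d | n) vonMangoldt d = ln n%:R.
Proof.
elim/ltn_ind: n => n IH n0; have [n1|n1] := leqP n 1.
  have -> : n = 1%N by apply/eqP; rewrite eqn_leq n1.
  by rewrite big_mkcond big_nat1 /vonMangoldt/= ln1.
pose p := pdiv n; have pp : prime p := pdiv_prime n1.
have p0 := prime_gt0 pp.
pose m := (n %/ p)%N; have nE : n = (p * m)%N by rewrite mulnC divnK// pdiv_dvd.
have m0 : (0 < m)%N by move: n0; rewrite nE muln_gt0 => /andP[].
have mn : (m < n)%N by rewrite ltn_Pdiv// prime_gt1.
have mdn : (m %| n)%N by rewrite nE dvdn_mull.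
rewrite (bigID (fun d => (d %| m)%N))/=.
have -> : \sum_(1 <= d < n.+1 | (d %| n)%N && (d %| m)%N) vonMangoldt d = ln m%:R.
  rewrite -(IH m mn m0) (dsum_widen _ m0 (ltnW mn)); apply: eq_bigl => d.
  by case: (boolP (d %| m)%N) => dm; rewrite ?andbF// (dvdn_trans dm mdn).
pose b := (logn p m).+1; pose q := (p ^ b)%N.
have qn : (q %| n)%N.
  by rewrite /q pfactor_dvdn// nE lognM// logn_prime// eqxx.
have qm : ~~ (q %| m)%N by rewrite /q pfactor_dvdn// -ltnNge.
have q0 : (0 < q)%N by rewrite expn_gt0 p0.
have -> : \sum_(1 <= d < n.+1 | (d %| n)%N && ~~ (d %| m)%N) vonMangoldt d = ln p%:R.
  rewrite big_mkcond (bigD1_seq q)/= ?iota_uniq//; last first.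
    by rewrite mem_index_iota q0 ltnS dvdn_leq.
  rewrite qn qm vonMangoldt_pfactor// big1 ?addr0// => d dq.
  case: ifP => // /andP[dn dm]; apply/eqP/negPn/negP.
  move=> /vonMangoldt_neq0[r [c [pr c0 dE _]]].
  have rp : r = p.
    apply/eqP/negPn/negP => rp; move/negP: dm; apply.
    rewrite nE Gauss_dvdr in dn => //.
    by rewrite dE coprimeXl// prime_coprime// dvdn_prime2.
  subst r; move: dm dn dq; rewrite dE pfactor_dvdn// -ltnNge => mc.
  rewrite pfactor_dvdn// nE lognM// logn_prime// eqxx add1n => cm.
  have -> : c = b by apply/eqP; rewrite eqn_leq cm mc.
  by rewrite eqxx.
by rewrite addrC -lnM ?posrE ?ltr0n// -natrM -nE.
Qed.

Lemma vonMangoldt_le_ln n : vonMangoldt n <= ln n%:R.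
Proof.
have [->|n0] := posnP n; first by rewrite ln0.
rewrite -sum_vonMangoldt// big_mkcond (bigD1_seq n)/= ?iota_uniq//; last first.
  by rewrite mem_index_iota n0 ltnSn.
rewrite dvdnn lerDl sumr_ge0// => d _; case: ifP => // _; exact: vonMangoldt_ge0.
Qed.

Definition squarefree (n : nat) : bool := all (fun p => logn p n == 1%N) (primes n).

Definition mobius (n : nat) : R := (squarefree n)%:R * (-1) ^+ size (primes n).

Lemma mobius_le1 n : `|mobius n| <= 1.
Proof. by rewrite normrM normr_nat normrX normrN1 expr1n mulr1 lern1 leq_b1. Qed.

Lemma mobius_primeM p e : prime p -> (0 < e)%N ->
  mobius (p * e) = if (p %| e)%N then 0 else - mobius e.
Proof.
move=> pp e0; have p0 := prime_gt0 pp.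
case: ifPn => pe; rewrite /mobius.
  suff -> : squarefree (p * e) = false by rewrite mul0r.
  apply/negbTE/allPn; exists p; first by rewrite mem_primes pp muln_gt0 p0 e0 dvdn_mulr.
  rewrite lognM// logn_prime// eqxx; have : (0 < logn p e)%N.
    by rewrite logn_gt0 mem_primes pp e0.
  by case: logn.
have pr : perm_eq (primes (p * e)) (p :: primes e).
  apply: uniq_perm; rewrite ?primes_uniq//= ?primes_uniq ?andbT.
    by rewrite mem_primes (negbTE pe) !andbF.
  by move=> q; rewrite primesM// primes_prime// !inE.
rewrite (perm_size pr)/= exprS mulrCA mulN1r; congr (- (_ %:R * _)).
rewrite /squarefree (perm_all _ pr)/= lognM// logn_prime// eqxx.
have -> : logn p e = 0%N by apply/eqP; rewrite -leqn0 leqNgt logn_gt0 mem_primes (negbTE pe) !andbF.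
rewrite /=; congr nat_of_bool; apply: eq_in_all => q.
rewrite mem_primes => /and3P[pq _ qe]; rewrite lognM// logn_prime//.
by have -> : (q == p) = false by apply/negbTE/eqP => qp; rewrite -qp qe in pe.
Qed.

(** With n = p m, each divisor e of m prime to p cancels against p e; the remaining divisors are
    divisible by p^2 and contribute 0. *)
Lemma sum_mobius n : (0 < n)%N -> \dsum_(d | n) mobius d = (n == 1%N)%:R.
Proof.
move=> n0; have [n1|n1] := leqP n 1.
  have -> : n = 1%N by apply/eqP; rewrite eqn_leq n1.
  by rewrite big_mkcond big_nat1 /mobius/= mulr1.
rewrite gtn_eqF//.
pose p := pdiv n; have pp : prime p := pdiv_prime n1.
have p0 := prime_gt0 pp.
pose m := (n %/ p)%N; have nE : n = (p * m)%N by rewrite mulnC divnK// pdiv_dvd.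
have m0 : (0 < m)%N by move: n0; rewrite nE muln_gt0 => /andP[].
have mn : (m <= n)%N by exact: leq_div.
pose g (d : nat) := if (p * d %| n)%N then mobius (p * d) else 0.
rewrite (bigID (fun d => (p %| d)%N))/=.
have -> : \sum_(1 <= d < n.+1 | (d %| n)%N && (p %| d)%N) mobius d =
    \sum_(1 <= e < m.+1 | (e %| m)%N) mobius (p * e).
  have := sum_multiples 0 n g p0; rewrite div0n -/m => E.
  rewrite [RHS]big_mkcond.
  transitivity (\sum_(1 <= j < m.+1) g j); last first.
    by apply: eq_bigr => e _; rewrite /g nE dvdn_pmul2l.
  rewrite -E [LHS]big_mkcond [RHS]big_mkcond; apply: eq_bigr => d _.
  case: (boolP (p %| d)%N) => pd; rewrite ?andbF// andbT /g.
  by rewrite [(p * _)%N]mulnC divnK.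
have -> : \sum_(1 <= d < n.+1 | (d %| n)%N && ~~ (p %| d)%N) mobius d =
    \sum_(1 <= e < m.+1 | (e %| m)%N) (if (p %| e)%N then 0 else mobius e).
  rewrite (dsum_widen _ m0 mn) [LHS]big_mkcond [RHS]big_mkcond; apply: eq_bigr => d _.
  case: (boolP (p %| d)%N) => pd; rewrite ?andbF ?if_same// andbT nE Gauss_dvdr//.
  by rewrite coprime_sym prime_coprime.
rewrite -big_split/= big1_seq// => e /andP[em]; rewrite mem_index_iota => /andP[e0 _].
by rewrite mobius_primeM//; case: ifP; rewrite ?addr0// addNr.
Qed.

(* [cutoff U] is (Lambda 1_{> U}) * 1, so that Lambda 1_{> U} = mu * cutoff U. *)
Definition cutoff (U j : nat) : R := \dsum_(m | j) (U < m)%N%:R * vonMangoldt m.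

Lemma mobius_cutoff U n : (0 < n)%N ->
  \dsum_(d | n) mobius d * cutoff U (n %/ d) = (U < n)%N%:R * vonMangoldt n.
Proof.
move=> n0; under eq_bigr do rewrite /cutoff mulr_sumr.
rewrite (dsum_exchange (fun d m => mobius d * ((U < m)%N%:R * vonMangoldt m)))//.
rewrite big_mkcond (bigD1_seq n)/= ?iota_uniq//; last first.
  by rewrite mem_index_iota n0 ltnSn.
rewrite dvdnn divnn n0 -mulr_suml sum_mobius// eqxx mul1r.
rewrite big1_seq ?addr0// => m /andP[mn]; rewrite mem_index_iota ltnS => /andP[m0 mlen].
case: ifP => // dm; rewrite -mulr_suml sum_mobius; last by rewrite divn_gt0.
rewrite (_ : (n %/ m == 1)%N = false) ?mul0r//; apply/negbTE/eqP => E.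
by move: mn; rewrite -(divnK dm) E mul1n eqxx.
Qed.

(** For Type I sums: the sum over m > U is traded for the smooth weight ln j and finitely many short
    moduli m <= U. *)
Lemma cutoffE U j : (0 < j)%N -> cutoff U j =
  ln j%:R - \sum_(1 <= m < U.+1 | (m %| j)%N) vonMangoldt m.
Proof.
move=> j0; rewrite /cutoff -(sum_vonMangoldt j0).
pose N := maxn j U; have jN : (j <= N)%N by rewrite leq_maxl.
have UN : (U <= N)%N by rewrite leq_maxr.
rewrite !(dsum_widen _ j0 jN).
have -> : \sum_(1 <= m < U.+1 | (m %| j)%N) vonMangoldt m =
    \sum_(1 <= m < N.+1 | (m %| j)%N) (m <= U)%N%:R * vonMangoldt m.
  rewrite (big_nat_widen _ _ _ _ _ (UN : (U.+1 <= N.+1)%N)).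
  rewrite [LHS]big_mkcond [RHS]big_mkcond; apply: eq_bigr => m _; rewrite ltnS.
  by case: (m %| j)%N => //=; case: (m <= U)%N; rewrite ?mul1r ?mul0r.
apply/eqP; rewrite eq_sym subr_eq -big_split; apply/eqP; apply: eq_bigr => m _ /=.
by rewrite -mulrDl ltnNge; case: (m <= U)%N; rewrite ?add0r ?addr0 mul1r.
Qed.

Lemma cutoff_bound U j : 0 <= cutoff U j <= ln j%:R.
Proof.
apply/andP; split.
  by apply: sumr_ge0 => m _; rewrite mulr_ge0// vonMangoldt_ge0.
have [->|j0] := posnP j; first by rewrite /cutoff big_geq// ln0.
by rewrite cutoffE// lerBlDr lerDl sumr_ge0// => m _; exact: vonMangoldt_ge0.
Qed.

Lemma cutoff_eq0 U j : (j <= U)%N -> cutoff U j = 0.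
Proof.
move=> jU; rewrite /cutoff big1_seq// => m /andP[_]; rewrite mem_index_iota ltnS.
by move=> /andP[_ mj]; rewrite ltnNge (leq_trans mj jU) mul0r.
Qed.

(** Since U <= X, the truncation of Lambda is invisible on the range. Terms with d <= U will be of
    Type I, those with d > U of Type II. *)
Lemma vaughan_identity (U X : nat) (w : nat -> R) : (U <= X)%N ->
  \sum_(X.+1 <= n < (2 * X).+1) vonMangoldt n * w n =
  \sum_(1 <= d < (2 * X).+1) mobius d *
    \sum_((X %/ d).+1 <= j < (2 * X %/ d).+1) cutoff U j * w (d * j)%N.
Proof.
move=> UX; under [RHS]eq_bigr do rewrite mulr_sumr.
rewrite -(hyperbola X (2 * X) (fun d j => mobius d * (cutoff U j * w (d * j)%N))).
apply: eq_big_nat => n /andP[Xn _].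
have n0 : (0 < n)%N := leq_ltn_trans (leq0n X) Xn.
have -> : vonMangoldt n = (U < n)%N%:R * vonMangoldt n.
  by rewrite (leq_ltn_trans UX Xn) mul1r.
rewrite -mobius_cutoff// mulr_suml; apply: eq_bigr => d dn.
by rewrite mulrA [(d * _)%N]mulnC divnK.
Qed.

(** A prime power p^c <= N with c >= 2 has p <= s, about sqrt N, and c <= b, about log_2 N. *)
Lemma sum_prime_powers (N s b : nat) : (N < s.+1 ^ 2)%N -> (N < 2 ^ b.+1)%N ->
  \sum_(1 <= n < N.+1) (~~ prime n)%:R * vonMangoldt n <= s%:R * b%:R * ln N%:R.
Proof.
move=> Ns Nb.
have T n : (1 <= n < N.+1)%N -> (~~ prime n)%:R * vonMangoldt n <=
    \sum_(1 <= p < s.+1) \sum_(1 <= c < b.+1) (n == p ^ c)%N%:R * ln N%:R.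
  rewrite ltnS => /andP[n0 nN].
  have P0 : 0 <= \sum_(1 <= p < s.+1) \sum_(1 <= c < b.+1) (n == p ^ c)%N%:R * ln (N%:R : R).
    by apply: sumr_ge0 => p _; apply: sumr_ge0 => c _; rewrite mulr_ge0// ln_nat_ge0.
  have [L0|] := eqVneq (vonMangoldt n) 0; first by rewrite L0 mulr0.
  move=> /vonMangoldt_neq0[p [c [pp c0 nE _]]].
  have [pn|npn] := boolP (prime n); first by rewrite mul0r.
  have c2 : (1 < c)%N.
    by rewrite ltn_neqAle c0 andbT; apply: contraNneq npn => cE; rewrite nE -cE expn1.
  have p1 := prime_gt1 pp.
  have ps : (p < s.+1)%N.
    rewrite -(@ltn_exp2r _ _ 2)// (leq_ltn_trans _ Ns)// (leq_trans _ nN)// nE.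
    by rewrite leq_exp2l.
  have cb : (c < b.+1)%N.
    rewrite -(@ltn_exp2l 2)// (leq_ltn_trans _ Nb)// (leq_trans _ nN)// nE.
    by rewrite leq_exp2r.
  rewrite mul1r (bigD1_seq p)/= ?iota_uniq ?mem_index_iota ?(ltnW p1)//.
  rewrite [X in _ <= X + _](bigD1_seq c)/= ?iota_uniq ?mem_index_iota ?c0//.
  rewrite -nE eqxx mul1r -addrA; apply: (@le_trans _ _ (ln N%:R)).
    apply: le_trans (vonMangoldt_le_ln n) _.
    by rewrite ler_ln ?posrE ?ltr0n// ?ler_nat// (leq_trans n0).
  rewrite lerDl addr_ge0// sumr_ge0// => *; rewrite ?mulr_ge0 ?ln_nat_ge0//.
  by apply: sumr_ge0 => *; rewrite mulr_ge0// ln_nat_ge0.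
rewrite big_nat; apply: (le_trans (ler_sum _ T)); rewrite -big_nat exchange_big/=.
apply: (@le_trans _ _ (\sum_(1 <= p < s.+1) \sum_(1 <= c < b.+1) ln N%:R)).
  apply: ler_sum => p _; rewrite exchange_big/=; apply: ler_sum => c _.
  rewrite -mulr_suml ler_piMl ?ln_nat_ge0//.
  have [qI|qI] := boolP ((p ^ c)%N \in index_iota 1 N.+1).
    rewrite (bigD1_seq (p ^ c)%N)/= ?iota_uniq// eqxx big1 ?addr0// => n /negbTE->.
    by [].
  rewrite big1_seq// => n /andP[_ nI]; case: eqP => // nE.
  by rewrite nE (negbTE qI) in nI.
by rewrite !sumr_const_nat !subn1/= -mulrnA mulnC -natrM mulr_natl.
Qed.

(** The logarithm of the binomial coefficient (2 M choose M) is the sum of Lambda(d) (floor(2 M / d)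
    - 2 floor(M / d)), whose brackets are at most 1. *)
Lemma chebyshev_lower (M : nat) :
  M%:R * ln 2 <= \sum_(1 <= d < (2 * M).+1) vonMangoldt d.
Proof.
have H N : \sum_(1 <= n < N.+1) ln n%:R =
    \sum_(1 <= d < N.+1) vonMangoldt d * (N %/ d)%:R :> R.
  have := hyperbola 0 N (fun d _ => vonMangoldt d).
  under [X in X = _]eq_big_nat => n /andP[n0 _] do rewrite sum_vonMangoldt//.
  move=> ->; apply: eq_big_nat => d _.
  by rewrite div0n sumr_const_nat subn1/= mulr_natr.
have E : \sum_(1 <= n < (2 * M).+1) ln n%:R - 2 * \sum_(1 <= n < M.+1) ln n%:R =
    \sum_(1 <= d < (2 * M).+1) vonMangoldt d * ((2 * M %/ d)%:R - 2 * (M %/ d)%:R) :> R.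
  rewrite !H.
  have -> : \sum_(1 <= d < M.+1) vonMangoldt d * (M %/ d)%:R =
      \sum_(1 <= d < (2 * M).+1) vonMangoldt d * (M %/ d)%:R.
    have MM : (M.+1 <= (2 * M).+1)%N by rewrite ltnS leq_pmull.
    rewrite (@big_cat_nat _ _ _ M.+1 1 (2 * M).+1)//= [X in _ + X]big1_seq ?addr0// => d.
    by rewrite mem_index_iota => /andP[_ /andP[Md _]]; rewrite divn_small// mulr0.
  rewrite mulr_sumr -sumrB; apply: eq_bigr => d _; ring.
apply: (@le_trans _ _ (\sum_(1 <= d < (2 * M).+1) vonMangoldt d *
    ((2 * M %/ d)%:R - 2 * (M %/ d)%:R))); last first.
  rewrite big_nat [leRHS]big_nat; apply: ler_sum => d /andP[d0 _].
  have h : (2 * M %/ d <= 2 * (M %/ d) + 1)%N.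
    rewrite -ltnS ltn_divLR//; have := divn_eq M d; have := ltn_pmod M d0.
    set q := (M %/ d)%N; set r := (M %% d)%N.
    by clear; nia.
  rewrite ler_piMr ?vonMangoldt_ge0//; move: h.
  by rewrite -(ler_nat R) natrD natrM; lra.
(* What remains is that the central binomial coefficient at least doubles when M grows by one. *)
rewrite -E; elim: M {H E} => [|M IH].
  by rewrite muln0 !big_geq// mul0r mulr0 subrr.
have -> : (2 * M.+1).+1 = (2 * M).+3 by rewrite mulnS.
rewrite [X in _ <= X - _]big_nat_recr//= [X in _ <= X + _ - _]big_nat_recr//=.
rewrite [X in _ <= _ - 2 * X]big_nat_recr//=.
have -> : ln (2 * M).+2%:R = ln 2 + ln M.+1%:R :> R.
  rewrite -lnM ?posrE ?ltr0n// -natrM; congr (ln _%:R).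
  by rewrite mulnS add2n.
have : ln M.+1%:R <= ln (2 * M).+1%:R :> R.
  by rewrite ler_ln ?posrE ?ltr0n// ler_nat ltnS leq_pmull.
rewrite -(natr1 M) mulrDl mul1r mulrDr; lra.
Qed.
End DivisorSums.

(** * Sums over primes *)

Section Auxiliary.
Variable R : realType.

Lemma abel_bound (x w : nat -> R) (N : nat) (B : R) :
  (forall n, (n < N)%N -> w n.+1 <= w n) -> 0 <= w N ->
  (forall n, (n <= N)%N -> `|\sum_(i < n) x i| <= B) ->
  `|\sum_(i < N) w i * x i| <= w 0%N * B.
Proof.
move=> wm wN xB.
have B0 : 0 <= B by apply: le_trans (xB 0%N _).
have : `|\sum_(i < N) w i * x i - w N * \sum_(i < N) x i| <= (w 0%N - w N) * B.
  have : forall n, (n <= N)%N ->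
      `|\sum_(i < n) w i * x i - w n * \sum_(i < n) x i| <= (w 0%N - w n) * B.
    elim=> [|n IH] nN; first by rewrite !big_ord0 mulr0 subr0 normr0 subrr mul0r.
    have -> : \sum_(i < n.+1) w i * x i - w n.+1 * \sum_(i < n.+1) x i =
      (\sum_(i < n) w i * x i - w n * \sum_(i < n) x i) +
      (w n - w n.+1) * \sum_(i < n.+1) x i by rewrite !big_ord_recr/=; ring.
    rewrite (le_trans (ler_normD _ _))//.
    have -> : (w 0%N - w n.+1) * B = (w 0%N - w n) * B + (w n - w n.+1) * B by ring.
    rewrite lerD ?IH ?(ltnW nN)// normrM ger0_norm ?subr_ge0 ?wm//.
    by rewrite ler_wpM2l ?subr_ge0 ?wm// xB.
  exact.
have := xB N (leqnn N) => h1 h2.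
rewrite -(subrK (w N * \sum_(i < N) x i) (\sum_(i < N) w i * x i)).
rewrite (le_trans (ler_normD _ _))//.
have -> : w 0%N * B = (w 0%N - w N) * B + w N * B by ring.
by rewrite lerD// normrM ger0_norm// ler_wpM2l.
Qed.

(** Reduced to nonincreasing weights by replacing w with W - w. *)
Lemma abel_bound_incr (x w : nat -> R) (N : nat) (B W : R) :
  (forall n, (n < N)%N -> w n <= w n.+1) -> 0 <= w 0%N -> w N <= W ->
  (forall n, (n <= N)%N -> `|\sum_(i < n) x i| <= B) ->
  `|\sum_(i < N) w i * x i| <= 2 * W * B.
Proof.
move=> wm w0 wW xB.
have B0 : 0 <= B by apply: le_trans (xB 0%N _).
have : `|\sum_(i < N) (W - w i) * x i| <= (W - w 0%N) * B.
  apply: (@abel_bound x (fun i => W - w i)) => // [n nN|]; first by rewrite lerD2l lerN2 wm.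
  by rewrite subr_ge0.
have -> : \sum_(i < N) (W - w i) * x i = W * \sum_(i < N) x i - \sum_(i < N) w i * x i.
  by rewrite mulr_sumr -sumrB; apply: eq_bigr => i _; rewrite mulrBl.
have wN0 : w 0%N <= w N.
  by elim: {xB wW} N wm => // n IH wm; rewrite (le_trans (IH _) (wm _ _))// => i ?; apply: wm; exact: ltnW.
have W0 : 0 <= W by lra.
have h : `|W * \sum_(i < N) x i| <= W * B.
  by rewrite normrM (ger0_norm W0) ler_wpM2l// xB.
move=> h2; rewrite -[\sum_(i < N) w i * x i](subKr (W * \sum_(i < N) x i)).
rewrite (le_trans (ler_normB _ _))//.
have : 0 <= w 0%N * B by exact: mulr_ge0.
lra.
Qed.

Lemma harmonic_le (N : nat) : (0 < N)%N ->
  \sum_(1 <= d < N.+1) d%:R^-1 <= 1 + ln N%:R :> R.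
Proof.
case: N => // N _; elim: N => [|N IH]; first by rewrite big_nat1 ln1 invr1 addr0.
rewrite big_nat_recr//=.
have : N.+2%:R^-1 <= ln N.+2%:R - ln N.+1%:R :> R.
  rewrite -ln_div ?posrE ?ltr0n// -[X in _ <= X]opprK -lnV ?posrE ?divr_gt0 ?ltr0n//.
  rewrite invf_div lerNr.
  have -> : N.+1%:R / N.+2%:R = 1 + - N.+2%:R^-1 :> R.
    have n0 : N.+2%:R != 0 :> R by rewrite pnatr_eq0.
    by apply: (mulIf n0); rewrite divfK// mulrDl mulNr mulVf// mul1r -[N.+2%:R]natr1 addrK.
  by apply: le_ln1Dx; rewrite ltrN2 invf_lt1 ?ltr1n ?ltr0n.
move=> h; rewrite (le_trans (lerD IH h))//.
by rewrite [ln N.+2%:R - _]addrC addrA addrK.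
Qed.

Lemma half_le_ln2 : 2^-1 <= ln 2 :> R.
Proof.
have : ln (1 + - 2^-1) <= - 2^-1 :> R by apply: le_ln1Dx; lra.
have -> : 1 + - 2^-1 = 2^-1 :> R by field.
by rewrite lnV ?posrE//; lra.
Qed.

Lemma trunc_log_le_ln (N : nat) : (0 < N)%N -> (trunc_log 2 N)%:R <= 2 * ln N%:R :> R.
Proof.
move=> N0; have : (2 ^ trunc_log 2 N <= N)%N by rewrite trunc_logP.
move: (trunc_log 2 N) => k h.
have : ln (2 ^ k)%:R <= ln N%:R :> R by rewrite ler_ln ?posrE ?ltr0n ?expn_gt0// ler_nat.
rewrite natrX lnXn// -[_ *+ _]mulr_natl => kN.
have : k%:R * 2^-1 <= k%:R * ln 2 :> R by rewrite ler_wpM2l// half_le_ln2.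
by move=> /le_trans/(_ kN); rewrite ler_pdivrMr// mulrC.
Qed.

Lemma ln_le_powR (x a : R) : 1 <= x -> 0 < a -> ln x <= a^-1 * x `^ a.
Proof.
move=> x1 a0; have x0 : 0 < x by lra.
rewrite ler_pdivlMl//; have := ln_sublinear (powR_gt0 a x0).
by rewrite ln_powR => /ltW.
Qed.

(** Any power saving outweighs the three logarithms lost in Vaughan's identity. *)
Lemma near_log_cube (K e d : R) : 0 < e -> 0 < d ->
  \forall x \near +oo, (ln (K * x) + K) ^+ 3 <= d * x `^ e.
Proof.
move=> e0 d0.
pose c := (ln K + K) + 4 / e + 1 + `|ln K + K|.
have e4 : 0 < e / 4 by lra.
have e4' : 0 < e / 4 by lra.
apply: filterS (filterI (near_pinfty_ge 1) (filterI (near_pinfty_powR_ge (c ^+ 3 / d) e4)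
  (near_pinfty_ln_ge (- (ln K + K))))).
move=> x [x1 [xc lx]]; have x0 : 0 < x by lra.
have X1 : 1 <= x `^ (e / 4) by rewrite -[leLHS](powRr0 x) ler_powR//; lra.
(* For K <= 0 the logarithm of K x takes its default value 0, so the left side is K^3 <= 0. *)
have [K0|K0] := leP K 0.
  rewrite ln0; last by rewrite mulr_le0_ge0 ?(ltW x0).
  rewrite add0r (@le_trans _ _ 0)//; last by rewrite mulr_ge0 ?powR_ge0// ltW.
  by rewrite exprn_odd_le0.
rewrite lnM ?posrE//.
have l1 : ln x <= 4 / e * x `^ (e / 4).
  by have := ln_le_powR x1 e4; rewrite invf_div.
have c0 : 0 <= c.
  have := ler_norm (- (ln K + K)); rewrite normrN /c.
  have : 0 < 4 / e by rewrite divr_gt0.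
  lra.
have L : 0 <= ln K + ln x + K by lra.
have L2 : ln K + ln x + K <= c * x `^ (e / 4).
  have h : ln K + K <= `|ln K + K| * x `^ (e / 4).
    by rewrite (le_trans (ler_norm _))// ler_peMr.
  have h2 : 0 <= (ln K + K + `|ln K + K| + 1 - `|ln K + K|) * x `^ (e / 4) + `|ln K + K| * x `^ (e / 4).
    have := ler_norm (- (ln K + K)); rewrite normrN => ?.
    by rewrite -mulrDl mulr_ge0 ?powR_ge0//; lra.
  rewrite /c; nra.
apply: (@le_trans _ _ ((c * x `^ (e / 4)) ^+ 3)); first by rewrite lerXn2r ?nnegrE// mulr_ge0// powR_ge0.
have -> : x `^ e = x `^ (e / 4) * (x `^ (e / 4)) ^+ 3.
  by rewrite -exprS -powR_mulrn ?powR_ge0// -powRrM; congr (_ `^ _); field.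
rewrite exprMn mulrA ler_wpM2r ?exprn_ge0 ?powR_ge0//.
by move: xc; rewrite ler_pdivrMr// mulrC.
Qed.
End Auxiliary.

(** * Assembling the Type I and Type II bounds through Vaughan's identity *)

Section TypeOneTypeTwo.
Variable R : realType.
Variables (U X : nat) (w : nat -> R) (W : R).
Hypotheses (U0 : (0 < U)%N) (UX : (U ^ 4 <= X)%N) (W1 : 1 <= W).
Hypothesis XW : ln (2 * X).+1%:R <= W.

Let inner d := \sum_((X %/ d).+1 <= j < (2 * X %/ d).+1) cutoff R U j * w (d * j)%N.

Let leUX : (U <= X)%N.
Proof. by rewrite (leq_trans _ UX)// -{1}(expn1 U) leq_pexp2l. Qed.

Let ln_le_W j : (j <= (2 * X).+1)%N -> ln j%:R <= W.
Proof.
case: j => [|j] jX; first by rewrite ln0// (le_trans ler01).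
by rewrite (le_trans _ XW)// ler_ln ?posrE ?ltr0n// ler_nat.
Qed.

(** By [cutoffE], the term ln j is removed by partial summation, and the terms m | j, m <= U, become
    sums with modulus m d <= U^2; this is where U^4 <= X is needed. Each part costs at most 2 W^2 B
    / d, the second through a harmonic sum. *)
Lemma type_one_bound (B : R) (d : nat) : (0 < d <= U)%N ->
  (forall q b, (0 < q)%N -> (q ^ 2 <= X)%N -> (b <= 2 * X %/ q)%N ->
    `|\sum_((X %/ q).+1 <= j < b.+1) w (q * j)%N| <= B / q%:R) ->
  `|\sum_((X %/ d).+1 <= j < (2 * X %/ d).+1) cutoff R U j * w (d * j)%N| <=
    4 * W ^+ 2 * B / d%:R.
Proof.
move=> /andP[d0 dU] hB.
have sq q : (q <= U ^ 2)%N -> (q ^ 2 <= X)%N.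
  by move=> qU; rewrite (leq_trans _ UX)// (expnM U 2 2) leq_exp2r.
have dR : 0 < d%:R :> R by rewrite ltr0n.
have B0 : 0 <= B.
  have := hB d (X %/ d)%N d0 (sq _ _).
  rewrite big_geq// normr0 pmulr_lge0 ?invr_gt0//; apply; last first.
    by rewrite leq_div2r// leq_pmull.
  by rewrite (leq_trans dU)// -{1}(expn1 U) leq_pexp2l.
have dX : (d ^ 2 <= X)%N.
  by apply: sq; rewrite (leq_trans dU)// -{1}(expn1 U) leq_pexp2l.
have W0 : 0 <= W := le_trans ler01 W1.
pose a := (X %/ d)%N; pose b := (2 * X %/ d)%N.
have ab : (a <= b)%N by rewrite leq_div2r// leq_pmull.
rewrite -/a -/b.
have -> : \sum_(a.+1 <= j < b.+1) cutoff R U j * w (d * j)%N =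
  \sum_(a.+1 <= j < b.+1) ln j%:R * w (d * j)%N -
  \sum_(1 <= m < U.+1) vonMangoldt R m *
     \sum_((X %/ (m * d)).+1 <= j < (2 * X %/ (m * d)).+1) w (m * d * j)%N.
  have -> : \sum_(1 <= m < U.+1) vonMangoldt R m *
     \sum_((X %/ (m * d)).+1 <= j < (2 * X %/ (m * d)).+1) w (m * d * j)%N =
    \sum_(1 <= m < U.+1) \sum_(a.+1 <= j < b.+1)
       (m %| j)%N%:R * (vonMangoldt R m * w (d * j)%N).
    apply: eq_big_nat => m /andP[m0 _].
    rewrite [(m * d)%N]mulnC !divnMA -/a -/b.
    rewrite -(@sum_multiples _ m a b (fun j => w (d * m * j)%N))// mulr_sumr.
    rewrite big_mkcond/=; apply: eq_bigr => j _; case: ifPn => mj.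
      by rewrite mul1r [(d * m)%N]mulnC -mulnA mulnC -mulnA [(_ %/ _ * _)%N]divnK.
    by rewrite mul0r.
  rewrite exchange_big_nat -sumrB/=; apply: eq_big_nat => j /andP[aj _].
  rewrite cutoffE; last exact: leq_ltn_trans aj.
  rewrite mulrBl; congr (_ - _); rewrite mulr_suml big_mkcond/=; apply: eq_bigr => m _.
  by case: (m %| j)%N; rewrite ?mul1r ?mul0r.
rewrite (le_trans (ler_normB _ _))//.
have -> : 4 * W ^+ 2 * B / d%:R =
   2 * W ^+ 2 * (B / d%:R) + 2 * W ^+ 2 * (B / d%:R) by field; lra.
have Bd : 0 <= B / d%:R by rewrite divr_ge0// ltW.
apply: lerD.
  rewrite (@le_trans _ _ (2 * W * (B / d%:R)))//; last first.
    by rewrite ler_wpM2r// expr2 ler_wpM2l// ler_peMl.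
  rewrite -{1}(add0n a.+1) big_addn big_mkord subSS.
  apply: (@abel_bound_incr _ (fun i => w (d * (i + a.+1))%N) (fun i => ln (i + a.+1)%:R)).
  - by move=> n _; rewrite ler_ln ?posrE ?ltr0n ?addnS// ler_nat addSn.
  - exact: ln_nat_ge0.
  - apply: ln_le_W; rewrite addnS ltnS subnK// /b.
    exact: leq_div.
  - move=> n nab; have nb : (a + n <= b)%N by rewrite -leq_subRL.
    have := hB d (a + n)%N d0 dX nb.
    by rewrite -/a -{1}(add0n a.+1) big_addn big_mkord subSS addKn.
rewrite (le_trans (ler_norm_sum _ _ _))//.
rewrite (@le_trans _ _ (\sum_(1 <= m < U.+1) W * (B / d%:R) * m%:R^-1))//.
  apply: ler_sum_nat => m /andP[m0 mU].
  rewrite normrM ger0_norm ?vonMangoldt_ge0// -[leRHS]mulrA.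
  rewrite ler_pM ?vonMangoldt_ge0//.
    rewrite (le_trans (vonMangoldt_le_ln _ _))// ln_le_W//.
    by rewrite (leq_trans (mU : (m <= U)%N))// (leq_trans leUX)// ltnW// ltnS leq_pmull.
  have -> : B / d%:R / m%:R = B / (m * d)%:R.
    by rewrite natrM invfM mulrCA mulrA mulrC mulrA.
  apply: hB => //; first by rewrite muln_gt0 m0.
  by apply: sq; rewrite expnS expn1 leq_mul.
rewrite -mulr_sumr (le_trans (ler_wpM2l _ (harmonic_le _ U0)))//; first by rewrite mulr_ge0.
rewrite mulrAC ler_wpM2r// expr2 mulrCA ler_wpM2l//.
have : ln U%:R <= W by rewrite ln_le_W// (leq_trans leUX)// ltnW// ltnS leq_pmull.
by move=> UW; rewrite mulr_natl mulr2n lerD.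
Qed.

(** If X / D < T then j <= 2 X / D < 2 T <= U, where [cutoff] vanishes. Otherwise both variables
    exceed T in size and the bilinear bound applies, with [cutoff] bounded by W. *)
Lemma type_two_bound (B T : R) (D : nat) : (U <= D)%N -> 0 <= B -> 
  0 < T -> 2 * T <= U%:R ->
  (forall (a c : nat -> R) (L : R), T <= X%:R / D%:R -> T <= D%:R ->
    (forall d, `|a d| <= 1) -> (forall j, (j <= 2 * X)%N -> `|c j| <= L) ->
    `|\sum_(i < D) \sum_(j < (2 * X %/ D).+1)
     ((X < (D.+1 + i) * j) && ((D.+1 + i) * j <= 2 * X))%N%:R *
     (a (D.+1 + i)%N * c j * w ((D.+1 + i) * j)%N)| <= B * L) ->
  `|\sum_(D.+1 <= d < (2 * D).+1) mobius R d *
     \sum_((X %/ d).+1 <= j < (2 * X %/ d).+1) cutoff R U j * w (d * j)%N| <= B * W.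
Proof.
move=> UD B0 T0 TU hB.
have D0 : (0 < D)%N by rewrite (leq_trans U0).
have DR : 0 < D%:R :> R by rewrite ltr0n.
have W0 : 0 <= W := le_trans ler01 W1.
have [TX|TX] := leP T (X%:R / D%:R); last first.
  rewrite big_nat big1 ?normr0 ?mulr_ge0// => d /andP[Dd _].
  rewrite big_nat big1 ?mulr0// => j /andP[_ jX].
  rewrite cutoff_eq0 ?mul0r//.
  have : j%:R <= (2 * (X%:R / D%:R) : R).
    rewrite mulrA ler_pdivlMr// -!natrM ler_nat.
    rewrite -leq_divRL// (leq_trans (jX : (j <= _)%N))// leq_div2l//.
    exact: ltnW.
  by move=> jX2; rewrite -(ler_nat R); lra.
have TD : T <= D%:R.
  have : U%:R <= D%:R :> R by rewrite ler_nat.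
  lra.
have := hB (mobius R) (cutoff R U) W TX TD (@mobius_le1 _) _.
set S := (S in `|S| <= _); set S' := (S in _ -> `|S| <= _).
suff -> : S' = S.
  apply=> j jX; have /andP[c0 cj] := cutoff_bound R U j.
  by rewrite ger0_norm// (le_trans cj)// ln_le_W// ltnW.
rewrite /S' -{1}(add0n D.+1) big_addn big_mkord subSS mul2n -addnn addnK.
apply: eq_bigr => i _; rewrite [(i + _)%N]addnC.
set d := (D.+1 + i)%N; have d0 : (0 < d)%N by [].
have dD : (2 * X %/ d <= 2 * X %/ D)%N by rewrite leq_div2l// /d addSn ltnW// ltnS leq_addr.
rewrite -(@sum_ord_interval _ (2 * X %/ D).+1)// mulr_sumr.
apply: eq_bigr => j _; rewrite ltn_divLR// ltnS leq_divRL// [(j * d)%N]mulnC.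
by rewrite -[in RHS]mulrA mulrCA.
Qed.

(** Summing 4 W^2 B1 / d over d <= U gives 8 W^3 B1; the range d > U splits into at most 3 W dyadic
    pieces of cost B2 W each. *)
Lemma vonMangoldt_sum_bound (B1 B2 T : R) : 0 <= B2 ->
  0 < T -> 2 * T <= U%:R ->
  (forall q b, (0 < q)%N -> (q ^ 2 <= X)%N -> (b <= 2 * X %/ q)%N ->
    `|\sum_((X %/ q).+1 <= j < b.+1) w (q * j)%N| <= B1 / q%:R) ->
  (forall D (a c : nat -> R) (L : R), T <= X%:R / D%:R -> T <= D%:R ->
    (forall d, `|a d| <= 1) -> (forall j, (j <= 2 * X)%N -> `|c j| <= L) ->
    `|\sum_(i < D) \sum_(j < (2 * X %/ D).+1)
     ((X < (D.+1 + i) * j) && ((D.+1 + i) * j <= 2 * X))%N%:R *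
     (a (D.+1 + i)%N * c j * w ((D.+1 + i) * j)%N)| <= B2 * L) ->
  `|\sum_(X.+1 <= n < (2 * X).+1) vonMangoldt R n * w n| <= 
    W ^+ 3 * (8 * B1 + 3 * B2).
Proof.
move=> B20 T0 TU h1 h2; have W0 : 0 <= W := le_trans ler01 W1.
have X0 : (0 < X)%N by rewrite (leq_trans U0).
have B10 : 0 <= B1.
  rewrite -[B1]divr1; apply: le_trans (h1 1%N X _ _ _) => //.
  by rewrite divn1 leq_pmull.
rewrite (vaughan_identity _ leUX) (big_cat_nat (n := U.+1))//=; last first.
  by rewrite ltnS (leq_trans leUX)// leq_pmull.
rewrite (le_trans (ler_normD _ _))// mulrDr lerD//.
  rewrite (le_trans (ler_norm_sum _ _ _))//.
  rewrite (@le_trans _ _ (\sum_(1 <= d < U.+1) 4 * W ^+ 2 * B1 * d%:R^-1))//.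
    apply: ler_sum_nat => d dU; rewrite normrM -[leRHS]mul1r.
    by rewrite ler_pM// ?mobius_le1// type_one_bound.
  have c0 : 0 <= 4 * W ^+ 2 * B1 by rewrite !mulr_ge0.
  rewrite -mulr_sumr (le_trans (ler_wpM2l c0 (harmonic_le _ U0)))//.
  have h : ln U%:R <= W by rewrite ln_le_W// (leq_trans leUX)// ltnW// ltnS leq_pmull.
  have -> : W ^+ 3 * (8 * B1) = 4 * W ^+ 2 * B1 * (2 * W) by ring.
  by rewrite ler_wpM2l// mulr_natl mulr2n lerD.
pose I := (trunc_log 2 (2 * X)).+1.
have XI : (2 * X < 2 ^ I)%N by exact: trunc_log_ltn.
have IW : I%:R <= 3 * W.
  have /ln_le_W lW : (2 * X <= (2 * X).+1)%N by [].
  have := trunc_log_le_ln R (_ : 0 < 2 * X)%N; rewrite muln_gt0 => /(_ X0) h.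
  rewrite /I -(natr1 (trunc_log _ _)) (_ : 3 * W = 2 * W + W); last by ring.
  by rewrite lerD// (le_trans h)// ler_wpM2l.
(* The range is lengthened to a whole number of dyadic pieces; for d > 2 X the inner sums are
   empty. *)
have ext : \sum_(U.+1 <= d < (2 * X).+1) mobius R d * inner d =
    \sum_(U.+1 <= d < (U * 2 ^ I).+1) mobius R d * inner d.
  have le1 : ((2 * X).+1 <= (U * 2 ^ I).+1)%N.
    by rewrite ltnS (leq_trans (ltnW XI))// leq_pmull.
  have le2 : (U.+1 <= (2 * X).+1)%N by rewrite ltnS (leq_trans leUX)// leq_pmull.
  rewrite [RHS](big_cat_nat _ le1)//= [X in _ = _ + X]big_nat_cond [X in _ = _ + X]big1 ?addr0// => d /andP[/andP[Xd _] _].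
  rewrite /inner big_geq ?mulr0// !divn_small//.
  by rewrite (leq_ltn_trans _ Xd)// leq_pmull.
rewrite -/(inner _); under eq_bigr do rewrite -/(inner _).
rewrite ext.
have : `|\sum_(U.+1 <= d < (U * 2 ^ I).+1) mobius R d * inner d| <= I%:R * (B2 * W).
  elim: (I) => [|i IH]; first by rewrite muln1 big_geq// normr0 mul0r.
  have iS : (U * 2 ^ i.+1 = 2 * (U * 2 ^ i))%N by rewrite expnS mulnCA.
  rewrite (big_cat_nat (n := (U * 2 ^ i).+1))/=; last 2 first.
  - by rewrite ltnS leq_pmulr// expn_gt0.
  - by rewrite ltnS iS leq_pmull.
  rewrite (le_trans (ler_normD _ _))// -natr1 mulrDl mul1r lerD// iS.
  by apply: (@type_two_bound B2 T) => //; [rewrite leq_pmulr// expn_gt0 | exact: h2].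
move=> /le_trans; apply.
have -> : W ^+ 3 * (3 * B2) = (3 * W) * (B2 * W) * W by ring.
rewrite (@le_trans _ _ (3 * W * (B2 * W)))//; first by rewrite ler_wpM2r// mulr_ge0.
by rewrite ler_peMr// !mulr_ge0.
Qed.
End TypeOneTypeTwo.

(** * Cancellation over a dyadic block *)

Section DyadicSum.
Variable R : realType.
Variables (l : nat) (theta : R) (F : nat -> R -> R).
Hypothesis l0 : (0 < l)%N.
Hypothesis RF : regular_chain l theta F.

Lemma dyadic_sum (eps : R) : 0 < eps -> \forall X \near \oo,
  `|\sum_(X.+1 <= n < (2 * X).+1) vonMangoldt R n * cosp (F 0%N n%:R)| <= eps * X%:R.
Proof.
move=> eps0; have [e1 e10 h1] := linear_sum_bound l0 RF.
have [e2 e20 h2] := bilinear_sum_bound l0 RF.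
(* 34 = 8 * 2 + 3 * 6, from 8 B1 + 3 B2 with B1 = 2 X^(1 - e1) and B2 = 6 X^(1 - e2). *)
have d0 : 0 < eps / 34 by rewrite divr_gt0.
have e8 : 0 < 8^-1 :> R by lra.
apply: filterS (filterI (filterI h1 h2) (near_pinfty_nat (filterI (near_pinfty_powR_ge 3 e8)
  (filterI (filterI (near_log_cube 3 e10 d0) (near_log_cube 3 e20 d0)) (near_pinfty_ge 1))))).
move=> X [[{}h1 {}h2] [T3 [[c1 c2] X1]]].
have X0 : 0 < X%:R :> R by lra.
set T := X%:R `^ 8^-1 in T3 h2; set W := ln (3 * X%:R) + 3 in c1 c2.
have W1 : 1 <= W.
  have : 0 <= ln (3 * X%:R) :> R by apply: ln_ge0; lra.
  rewrite /W; lra.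
have XW : ln (2 * X).+1%:R <= W.
  rewrite /W (@le_trans _ _ (ln (3 * X%:R)))//; last by rewrite lerDl.
  rewrite ler_ln ?posrE ?ltr0n//; last by lra.
  by rewrite -natr1 natrM; lra.
have T0 : 0 < T by lra.
have T8 : T ^+ 8 = X%:R.
  by rewrite -powR_mulrn ?powR_ge0// -powRrM mulVf// ?powRr1// ltW.
(* U is about X^(1/4): the largest size with U^4 <= X, and above 2 T = 2 X^(1/8) once T >= 3. *)
pose U := Num.truncn (T ^+ 2).
have UT : U%:R <= T ^+ 2 by rewrite truncn_le ?sqr_ge0.
have TU : 2 * T <= U%:R.
  have := truncnS_gt (T ^+ 2); rewrite -/U -(natr1 U) => h.
  have : 3 * T <= T ^+ 2 by rewrite expr2 ler_wpM2r// ltW.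
  clear -h T3 T0; lra.
have U0 : (0 < U)%N by rewrite -(ltr0n R); lra.
have UX : (U ^ 4 <= X)%N.
  rewrite -(ler_nat R) natrX -T8 (exprM T 2 4).
  by rewrite lerXn2r ?nnegrE// sqr_ge0.
set B1 := 2 * X%:R * X%:R `^ (- e1); set B2 := 6 * X%:R * X%:R `^ (- e2).
have B20 : 0 <= B2 by rewrite !mulr_ge0// ?powR_ge0// ltW.
apply: (le_trans (@vonMangoldt_sum_bound _ U X (fun n => cosp (F 0%N n%:R)) W
  U0 UX W1 XW B1 B2 T B20 T0 TU _ _)).
- move=> q b q0 qX bX; rewrite (le_trans (h1 q b q0 qX bX))//.
  by rewrite /B1 -!mulrA [_ `^ _ * _]mulrC.
- move=> D a c L TD1 TD2 a1 cL; rewrite (le_trans (h2 D a c L TD1 TD2 a1 cL))//.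
  by rewrite /B2 -!mulrA [_ `^ _ * _]mulrC.
have k (e : R) : W ^+ 3 <= eps / 34 * X%:R `^ e -> W ^+ 3 * X%:R `^ (- e) <= eps / 34.
  move=> h; rewrite powRN -ler_pdivlMr ?invr_gt0 ?powR_gt0//.
  by rewrite invrK.
have -> : W ^+ 3 * (8 * B1 + 3 * B2) = X%:R * (16 * (W ^+ 3 * X%:R `^ (- e1)) +
  18 * (W ^+ 3 * X%:R `^ (- e2))) by rewrite /B1 /B2; ring.
rewrite mulrC ler_wpM2r// ?(ltW X0)//.
move: (k _ c1) (k _ c2); move: (W ^+ 3 * _) (W ^+ 3 * _) => u v uP vP.
have -> : eps = 16 * (eps / 34) + 18 * (eps / 34) by field.
by rewrite lerD// ler_wpM2l.
Qed.
End DyadicSum.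

(** * Prime powers, Chebyshev's bound and enumeration of primes *)

Section Preliminaries.
Variable R : realType.

Lemma near_ln_le (e d : R) : 0 < e -> 0 < d ->
  \forall x \near +oo, ln (3 * x) + ln (3 * x) ^+ 2 <= d * x `^ e.
Proof.
move=> e0 d0; apply: filterS (filterI (near_log_cube 3 e0 d0) (near_pinfty_ge 1)).
move=> x [xe x1]; apply: le_trans xe.
have : 0 <= ln (3 * x) :> R by apply: ln_ge0; lra.
move: (ln _) => L L0.
have h1 : 0 <= L ^+ 2 by exact: sqr_ge0.
have h2 : 0 <= L ^+ 3 by exact: exprn_ge0.
have -> : (L + 3) ^+ 3 = L ^+ 3 + 9 * L ^+ 2 + 27 * L + 27 by ring.
lra.
Qed.

Lemma nat_sqrt (N : nat) : exists s, (s ^ 2 <= N < s.+1 ^ 2)%N.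
Proof.
elim: N => [|N [s /andP[sN Ns]]]; first by exists 0%N.
have [h|h] := leqP (s.+1 ^ 2) N.+1; last by exists s; rewrite h (leq_trans sN).
exists s.+1; rewrite h (leq_ltn_trans Ns)// ltn_exp2r//.
Qed.

Lemma sum_nth_prime (h : nat -> R) (k : nat) :
  \sum_(1 <= n < nth_prime k) (prime n)%:R * h n = \sum_(i < k) h (nth_prime i).
Proof.
elim: k => [|k IH].
  rewrite big_ord0 big_nat big1// => n /andP[n0].
  have -> : nth_prime 0 = 2.
    by rewrite /nth_prime/= /next_prime; case: ex_minnP => [[|[|[|m]]]]//= _ /(_ 2%N isT).
  by case: n n0 => [|[]]// _ _; rewrite mul0r.
have p0 : (0 < nth_prime k)%N by rewrite prime_gt0// nth_prime_prime.
rewrite (big_cat_nat (n := nth_prime k))//=; last exact/ltnW/ltn_nth_primeS.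
rewrite IH big_ord_recr/=; congr (_ + _).
rewrite big_ltn ?ltn_nth_primeS// nth_prime_prime mul1r big_nat big1 ?addr0//.
move=> n /andP[pn]; rewrite /nth_prime [in ltnRHS]iterS {1}/next_prime.
case: ex_minnP => m _ mmin nm; case pr : (prime n); last by rewrite mul0r.
have := mmin n; rewrite pr andbT => /(_ pn); rewrite leqNgt => /negP; by [].
Qed.

Lemma leq_nth_prime k : (k < nth_prime k)%N.
Proof.
elim: k => [|k IH]; first by rewrite prime_gt0// nth_prime_prime.
exact: leq_ltn_trans IH (ltn_nth_primeS _).
Qed.

Lemma near_sum_prime_powers (eps : R) : 0 < eps -> \forall N \near \oo,
  \sum_(1 <= n < N.+1) (~~ prime n)%:R * vonMangoldt R n <= eps * N%:R.
Proof.
move=> eps0; have h2 : 0 < 2^-1 :> R by lra.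
have ep2 : 0 < eps / 2 by lra.
apply: filterS (near_pinfty_nat (filterI (near_ln_le h2 ep2) (near_pinfty_ge 1))).
move=> N [NL N1]; have N0 : 0 < N%:R :> R by lra.
have [s /andP[sN Ns]] := nat_sqrt N.
have Nn : (0 < N)%N by rewrite -(ltr0n R).
have bN := trunc_log_ltn N (isT : 1 < 2)%N.
rewrite (le_trans (sum_prime_powers R Ns bN))//.
have L0 : 0 <= ln N%:R :> R by exact: ln_nat_ge0.
have L3 : ln N%:R <= ln (3 * N%:R) :> R by rewrite ler_ln ?posrE//; lra.
have sR : s%:R <= N%:R `^ 2^-1 :> R.
  rewrite -ler_sqr ?nnegrE ?powR_ge0// -[leRHS]powR_mulrn ?powR_ge0// -powRrM mulVf//.
  by rewrite powRr1 ?(ltW N0)// -natrX ler_nat.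
have bL : (trunc_log 2 N)%:R <= 2 * ln N%:R :> R.
  exact: trunc_log_le_ln.
have -> : eps * N%:R = N%:R `^ 2^-1 * (2 * (eps / 2 * N%:R `^ 2^-1)).
  rewrite (_ : N%:R `^ 2^-1 * _ = eps * (N%:R `^ 2^-1 * N%:R `^ 2^-1)); last by field.
  by rewrite -powRD_pos// (_ : 2^-1 + 2^-1 = 1) ?powRr1 ?(ltW N0)//; field.
rewrite -mulrA ler_pM ?mulr_ge0//.
rewrite (@le_trans _ _ (2 * ln N%:R * ln N%:R))//; first by rewrite ler_wpM2r.
rewrite -mulrA ler_wpM2l// (le_trans _ NL)// -expr2.
have : ln N%:R ^+ 2 <= ln (3 * N%:R) ^+ 2 :> R by rewrite lerXn2r ?nnegrE// (le_trans L0).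
have := le_trans L0 L3; lra.
Qed.

(** Prime powers take at most N / 16 from Chebyshev's bound, and each remaining weight is at most ln
    N. *)
Lemma chebyshev_prime_count : \forall N \near \oo,
  N%:R <= 8 * (ln N%:R * \sum_(1 <= n < N.+1) (prime n)%:R) :> R.
Proof.
have e16 : 0 < 16^-1 :> R by lra.
apply: filterS (filterI (near_sum_prime_powers e16) (near_pinfty_nat (near_pinfty_ge (4 : R)))).
move=> N [pp N4].
have Nn : (0 < N)%N by rewrite -(ltr0n R); lra.
have c1 : (N./2)%:R * 2^-1 <= \sum_(1 <= n < N.+1) vonMangoldt R n.
  apply: (@le_trans _ _ ((N./2)%:R * ln 2)); first by rewrite ler_wpM2l// half_le_ln2.
  apply: (le_trans (chebyshev_lower R _)).
  have hN : ((2 * N./2).+1 <= N.+1)%N by rewrite ltnS mul2n -[leqRHS]odd_double_half leq_addl.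
  rewrite [leRHS](big_cat_nat _ hN)//= lerDl sumr_ge0// => n _; exact: vonMangoldt_ge0.
have c2 : \sum_(1 <= n < N.+1) (prime n)%:R * vonMangoldt R n <=
    ln N%:R * \sum_(1 <= n < N.+1) (prime n)%:R.
  rewrite mulr_sumr; apply: ler_sum_nat => n /andP[n0 nN]; rewrite mulrC ler_wpM2r//.
  rewrite (le_trans (vonMangoldt_le_ln _ _))// ler_ln ?posrE ?ltr0n// ler_nat//.
have c3 : \sum_(1 <= n < N.+1) vonMangoldt R n =
    \sum_(1 <= n < N.+1) (prime n)%:R * vonMangoldt R n +
    \sum_(1 <= n < N.+1) (~~ prime n)%:R * vonMangoldt R n.
  rewrite -big_split; apply: eq_bigr => n _ /=.
  by case: (prime n); rewrite /= mul1r mul0r ?addr0 ?add0r.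
have c4 : N%:R <= 2 * (N./2)%:R + 1 :> R.
  rewrite -natrM natr1 ler_nat mul2n -{1}(odd_double_half N).
  by case: (odd N); rewrite ?add0n// ltnW.
lra.
Qed.
End Preliminaries.

(** * From von Mangoldt weights to means over the primes *)

Section PrimeSums.
Variables (R : realType) (g : nat -> R).
Hypothesis g1 : forall n, `|g n| <= 1.
Hypothesis dyadic : forall eps : R, 0 < eps -> \forall X \near \oo,
  `|\sum_(X.+1 <= n < (2 * X).+1) vonMangoldt R n * g n| <= eps * X%:R.

(** N is halved repeatedly: each step adds one dyadic block and, for odd N, one term of logarithmic
    size. The costs form a geometric series, and K pays for the range where the dyadic bound is not
    yet available. *)
Lemma near_sum_vonMangoldt (eps : R) : 0 < eps -> \forall N \near \oo,
  `|\sum_(1 <= n < N.+1) vonMangoldt R n * g n| <= eps * N%:R.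
Proof.
move=> eps0; have e4 : 0 < eps / 4 by rewrite divr_gt0.
have e10 : 0 < 1 :> R by [].
have [X0 _ X0P] : \forall X \near \oo,
  `|\sum_(X.+1 <= n < (2 * X).+1) vonMangoldt R n * g n| <= eps / 4 * X%:R /\
  ln (2 * X).+1%:R <= eps / 4 * X%:R.
  apply: filterS2 (dyadic e4) (near_pinfty_nat (filterI (near_ln_le e10 e4) (near_pinfty_ge 1))).
  move=> X dX [lX X1]; split=> //.
  have : ln (2 * X).+1%:R <= ln (3 * X%:R) :> R.
    by rewrite ler_ln ?posrE ?ltr0n// -?(natr1 (2 * X)) ?natrM; lra.
  move: lX; rewrite powRr1; last by lra.
  have : 0 <= ln (3 * X%:R) ^+ 2 :> R by exact: sqr_ge0.
  lra.
pose K := \sum_(1 <= n < (2 * X0).+1) vonMangoldt R n.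
have term n : `|vonMangoldt R n * g n| <= vonMangoldt R n.
  by rewrite normrM ger0_norm ?vonMangoldt_ge0// ler_piMr// vonMangoldt_ge0.
have K0 : 0 <= K by apply: sumr_ge0 => n _; exact: vonMangoldt_ge0.
have bound N : `|\sum_(1 <= n < N.+1) vonMangoldt R n * g n| <= eps / 2 * N%:R + K.
  elim/ltn_ind: N => N IH.
  have [N2|N2] := leqP N (2 * X0).
    rewrite (@le_trans _ _ K)//; last by rewrite lerDr mulr_ge0// ltW// divr_gt0.
    rewrite (le_trans (ler_norm_sum _ _ _))//.
    apply: (@le_trans _ _ (\sum_(1 <= n < N.+1) vonMangoldt R n)); first exact: ler_sum_nat.
    rewrite /K (big_cat_nat (n := N.+1) (p := (2 * X0).+1))//= lerDl sumr_ge0// => n _.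
    exact: vonMangoldt_ge0.
  have Nd := odd_double_half N; rewrite -mul2n in Nd.
  have MX : (X0 <= N./2)%N by rewrite -leq_double -!mul2n -(leq_add2l (odd N)) Nd;
    case: (odd N); rewrite ?add0n ?(ltnW N2)// add1n.
  have [dM lM] := X0P _ MX.
  have MN : (N./2 < N)%N.
    by rewrite -{2}Nd; move: (N./2) (odd N) N2 Nd => M [] /= N2 Nd; clear -N2 Nd; lia.
  have AM := IH _ MN.
  have A2 : `|\sum_(1 <= n < (2 * N./2).+1) vonMangoldt R n * g n| <=
      eps / 2 * (N./2)%:R + K + eps / 4 * (N./2)%:R.
    rewrite (big_cat_nat (n := (N./2).+1))//=; last by rewrite ltnS leq_pmull.
    by rewrite (le_trans (ler_normD _ _))// lerD.
  have NR : 2 * (N./2)%:R <= N%:R :> R by rewrite -natrM ler_nat -{2}Nd leq_addl.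
  have NE : eps / 4 * (2 * (N./2)%:R) <= eps / 4 * N%:R by rewrite ler_wpM2l// ltW.
  have AN : `|\sum_(1 <= n < N.+1) vonMangoldt R n * g n| <=
      eps / 2 * (N./2)%:R + K + eps / 4 * (N./2)%:R + ln (2 * N./2).+1%:R.
    rewrite -{1}Nd; case: (odd N); rewrite ?add1n ?add0n; last first.
      by rewrite (le_trans A2)// lerDl ln_nat_ge0.
    rewrite big_nat_recr//= (le_trans (ler_normD _ _))// lerD//.
    by rewrite (le_trans (term _))// vonMangoldt_le_ln.
  move: AN lM NE; clear -R; lra.
have e2 : 0 < eps / 2 by lra.
apply: filterS (near_pinfty_nat (near_pinfty_ge (K / (eps / 2)))) => N.
rewrite ler_pdivrMr// => KN; rewrite (le_trans (bound N))//.
lra.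
Qed.

Lemma near_sum_prime_ln (eps : R) : 0 < eps -> \forall N \near \oo,
  `|\sum_(1 <= n < N.+1) (prime n)%:R * ln n%:R * g n| <= eps * N%:R.
Proof.
move=> eps0; have e2 : 0 < eps / 2 by lra.
apply: filterS2 (near_sum_vonMangoldt e2) (near_sum_prime_powers e2) => N h1 h2.
have -> : \sum_(1 <= n < N.+1) (prime n)%:R * ln n%:R * g n =
  \sum_(1 <= n < N.+1) vonMangoldt R n * g n -
  \sum_(1 <= n < N.+1) (~~ prime n)%:R * vonMangoldt R n * g n.
  rewrite -sumrB; apply: eq_bigr => n _; case pr: (prime n) => /=.
    by rewrite vonMangoldt_prime// !mul1r !mul0r subr0.
  by rewrite mul1r !mul0r subrr.
rewrite (le_trans (ler_normB _ _))// [eps]splitr mulrDl lerD//.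
rewrite (le_trans (ler_norm_sum _ _ _))// (le_trans _ h2)//.
apply: ler_sum_nat => n _; rewrite normrM ger0_norm ?mulr_ge0 ?vonMangoldt_ge0//.
by rewrite ler_piMr// mulr_ge0 ?vonMangoldt_ge0.
Qed.

(** The weight ln p is removed by partial summation on (s, N] with s about sqrt N, where ln n is at
    least half of ln N. The primes up to s are counted trivially, and Chebyshev turns N / ln N into
    a multiple of the number of primes. *)
Lemma near_sum_prime (eps : R) : 0 < eps -> \forall N \near \oo,
  `|\sum_(1 <= n < N.+1) (prime n)%:R * g n| <= eps * \sum_(1 <= n < N.+1) (prime n)%:R.
Proof.
(* 40 = 8 + 32: the primes up to s cost 8 d, those above s cost 4 * 8 d. *)
move=> eps0; pose d := eps / 40; have d0 : 0 < d by rewrite divr_gt0.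
have h2 : 0 < 2^-1 :> R by lra.
have [N0 _ N0P] := near_sum_prime_ln d0.
apply: filterS2 (chebyshev_prime_count R) (near_pinfty_nat (filterI (near_ln_le h2 d0)
  (near_pinfty_ge (N0.+2 ^ 2)%:R))).
move=> N cheb [lN NN0].
have [s /andP[sN Ns]] := nat_sqrt N.
have N1 : 1 < N%:R :> R by rewrite (lt_le_trans _ NN0)// ltr1n -(exp1n 2) ltn_exp2r.
have s0 : (N0 < s)%N.
  have := NN0; rewrite ler_nat => /leq_ltn_trans/(_ Ns).
  by rewrite ltn_exp2r// ltnS => /ltnW.
have sNN : (s <= N)%N by rewrite (leq_trans _ sN)// -{1}(expn1 s) leq_pexp2l// (leq_ltn_trans _ s0).
have L0 : 0 < ln N%:R :> R by rewrite ln_gt0.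
have Ls : ln N%:R <= 2 * ln s.+1%:R :> R.
  by rewrite mulr_natl -lnXn ?ltr0n// -natrX ler_ln ?posrE ?ltr0n ?expn_gt0// ?ler_nat ?(ltnW Ns)//
    (leq_ltn_trans _ (leq_trans s0 sNN)).
have Ls0 : 0 < ln s.+1%:R :> R by lra.
set S := \sum_(1 <= n < N.+1) (prime n)%:R in cheb *.
have S0 : 0 <= S by apply: sumr_ge0.
have sqrtN : (N%:R `^ 2^-1) * (N%:R `^ 2^-1) = N%:R :> R.
  by rewrite -powRD_pos ?(lt_trans _ N1)// (_ : 2^-1 + 2^-1 = 1) ?powRr1//; last field; lra.
have sR : s%:R <= N%:R `^ 2^-1 :> R.
  by rewrite -ler_sqr ?nnegrE ?powR_ge0// [leRHS]expr2 sqrtN -natrX ler_nat.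
have NL : N%:R / ln N%:R <= 8 * S by rewrite ler_pdivrMr// -mulrA [S * _]mulrC.
have p1 : `|\sum_(1 <= n < s.+1) (prime n)%:R * g n| <= d * (8 * S).
  rewrite (@le_trans _ _ s%:R)//.
    rewrite (le_trans (ler_norm_sum _ _ _))//.
    have -> : s%:R = \sum_(1 <= n < s.+1) 1 :> R by rewrite big_const_nat iter_addr addr0 subn1.
    apply: ler_sum_nat => n _; rewrite normrM; case: (prime n); rewrite ?normr1 ?normr0 ?mul1r ?mul0r ?ler01//.
  rewrite (le_trans sR)// (le_trans _ (ler_wpM2l (ltW d0) NL))// mulrA ler_pdivlMr//.
  rewrite -[in leRHS]sqrtN mulrCA ler_wpM2l ?powR_ge0// (le_trans _ lN)//.
  have : ln N%:R <= ln (3 * N%:R) :> R by rewrite ler_ln ?posrE; lra.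
  have : 0 <= ln (3 * N%:R) ^+ 2 :> R by exact: sqr_ge0.
  lra.
have p2 : `|\sum_(s.+1 <= n < N.+1) (prime n)%:R * g n| <= 4 * d * (8 * S).
  rewrite -{1}(add0n s.+1) big_addn big_mkord subSS.
  have -> : \sum_(i < N - s) (prime (i + s.+1))%:R * g (i + s.+1)%N =
    \sum_(i < N - s) (ln (i + s.+1)%:R)^-1 *
      ((prime (i + s.+1))%:R * ln (i + s.+1)%:R * g (i + s.+1)%N).
    apply: eq_bigr => i _; have li : ln (i + s.+1)%:R != 0 :> R.
      by rewrite gt_eqF// ln_gt0// ltr1n addnS ltnS addn_gt0 (leq_ltn_trans _ s0)// orbT.
    by field.
  have : `|\sum_(i < N - s) (ln (i + s.+1)%:R)^-1 *
      ((prime (i + s.+1))%:R * ln (i + s.+1)%:R * g (i + s.+1)%N)| <=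
      (ln (0 + s.+1)%:R)^-1 * (2 * d * N%:R).
    apply: (@abel_bound _ (fun i => (prime (i + s.+1))%:R * ln (i + s.+1)%:R * g (i + s.+1)%N)
       (fun i => (ln (i + s.+1)%:R)^-1)).
    - move=> n _; have ln1 k : 0 < ln (k + s.+1)%:R :> R.
        by rewrite ln_gt0// ltr1n addnS ltnS addn_gt0 (leq_ltn_trans _ s0)// orbT.
      rewrite lef_pV2 ?posrE ?ln1// ler_ln ?posrE ?ltr0n ?addnS// ler_nat addSn.
      exact: leqnSn.
    - by rewrite invr_ge0 ln_nat_ge0.
    - move=> n nN; have nN' : (s + n <= N)%N by rewrite -leq_subRL.
      have -> : \sum_(i < n) (prime (i + s.+1))%:R * ln (i + s.+1)%:R * g (i + s.+1)%N =
        \sum_(1 <= n0 < (s + n).+1) (prime n0)%:R * ln n0%:R * g n0 -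
        \sum_(1 <= n0 < s.+1) (prime n0)%:R * ln n0%:R * g n0.
        rewrite (big_cat_nat (n := s.+1))//=; last by rewrite ltnS leq_addr.
        by rewrite [RHS]addrAC subrr add0r -[in RHS](add0n s.+1) big_addn subSS addKn big_mkord.
      have bm m : (s <= m <= N)%N ->
          `|\sum_(1 <= n0 < m.+1) (prime n0)%:R * ln n0%:R * g n0| <= d * N%:R.
        move=> /andP[sm mN]; rewrite (le_trans (N0P m _))//=; first exact: leq_trans (ltnW s0) sm.
        by rewrite ler_wpM2l ?(ltW d0)// ler_nat.
      rewrite (le_trans (ler_normB _ _))// -mulrA mulr_natl mulr2n lerD// bm// ?leqnn//.
      by rewrite leq_addr.
  move=> /le_trans; apply; rewrite add0n.
  rewrite (_ : 4 * d * (8 * S) = 2 * (2 * d * (8 * S))); last by ring.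
  rewrite mulrC ler_pdivrMr//.
  have : 2 * d * (N%:R / ln N%:R) <= 2 * d * (8 * S) by rewrite ler_wpM2l// mulr_ge0// (ltW d0).
  rewrite [X in X <= _]mulrA ler_pdivrMr// => /le_trans; apply.
  rewrite [leRHS]mulrAC [leRHS]mulrC ler_wpM2l//.
  by apply: mulr_ge0; apply: mulr_ge0 => //; exact: ltW.
rewrite (big_cat_nat (n := s.+1))//= (le_trans (ler_normD _ _))// (le_trans (lerD p1 p2))//.
by rewrite /d le_eqVlt; apply/orP; left; apply/eqP; field.
Qed.

Lemma cvg_mean_prime :
  (\sum_(i < n) g (nth_prime i)) / n%:R @[n --> \oo] --> (0 : R).
Proof.
apply/cvgrPdist_le => eps eps0.
have [N0 _ N0P] := near_sum_prime eps0.
exists N0.+1 => // n /= nN; rewrite sub0r normrN.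
have n0 : 0 < n%:R :> R by rewrite ltr0n (leq_ltn_trans _ nN).
rewrite normrM normfV (gtr0_norm n0) ler_pdivrMr//.
have pn := leq_nth_prime n.
(* The bound is taken at N = nth_prime n - 1: as indexing starts at 0, exactly n primes lie up to
   that N. *)
have pE : (nth_prime n).-1.+1 = nth_prime n by rewrite prednK// (leq_ltn_trans _ pn).
have := N0P (nth_prime n).-1; rewrite /= pE -ltnS pE => /(_ (ltn_trans nN pn)).
rewrite sum_nth_prime.
under [X in _ <= _ * X]eq_bigr do rewrite -[_%:R]mulr1.
by rewrite (sum_nth_prime (fun _ => 1)) sumr_const card_ord.
Qed.
End PrimeSums.

(** * Weyl's criterion *)

Section Fejer.
Variable R : realType.

(** The Fejer kernel |sum of e(i t)|^2 / K, expanded so that its frequencies i - j are visible. *)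
Definition fejer (K : nat) (t : R) : R :=
  K%:R^-1 * \sum_(i < K) \sum_(j < K) cosp ((i%:R - j%:R) * t).

Lemma fejerE K t : fejer K t = K%:R^-1 *
  ((\sum_(i < K) cosp (i%:R * t)) ^+ 2 + (\sum_(i < K) sinp (i%:R * t)) ^+ 2).
Proof.
rewrite /fejer !expr2 !big_distrlr -big_split/=; congr (_ * _); apply: eq_bigr => i _.
by rewrite -big_split/=; apply: eq_bigr => j _; rewrite mulrBl cospB.
Qed.

Lemma fejer_ge0 K t : 0 <= fejer K t.
Proof. by rewrite fejerE mulr_ge0// addr_ge0// sqr_ge0. Qed.

(** Both real sums are geometric, the sine sum being a cosine sum with phase -1/4. *)
Lemma fejer_le K D t : 0 < D <= 4^-1 -> ~~ near_int D t ->
  fejer K t <= K%:R^-1 * (2 * D^-1 ^+ 2).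
Proof.
move=> D4 nt; have D0 : 0 <= D^-1 by rewrite invr_ge0 ltW//; case/andP: D4.
have sq (x : R) : `|x| <= D^-1 -> x ^+ 2 <= D^-1 ^+ 2.
  by move=> xD; rewrite -real_normK ?num_real// lerXn2r.
rewrite fejerE ler_wpM2l// mulr_natl mulr2n lerD//; apply: sq.
  have := geometric_cos 0 K D4 nt; rewrite (eq_bigr (fun i : 'I_K => cosp (i%:R * t)))// => i _.
  by rewrite add0r.
have := geometric_cos (- 4^-1) K D4 nt.
rewrite (eq_bigr (fun i : 'I_K => sinp (i%:R * t)))// => i _.
have E : 4^-1 * (pi *+ 2) = pi / 2 :> R by rewrite -mulr_natl; field.
by rewrite addrC cospB /cosp /sinp E cos_pihalf sin_pihalf mulr0 mulr1 add0r.
Qed.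

(** Over m periods the sum is m S, yet [geometric_cos] bounds it independently of m; hence S = 0,
    without complex roots of unity. *)
Lemma sum_cosp_period (K : nat) (z : int) (a : R) : z != 0 -> (`|z| < K)%N ->
  \sum_(q < K) cosp (a + q%:R * (z%:~R / K%:R)) = 0.
Proof.
move=> z0 zK; have K0 : (0 < K)%N by exact: leq_ltn_trans zK.
have KR : 0 < K%:R :> R by rewrite ltr0n.
(* z / K is not an integer, so its distance to the integers is at least 1 / K > D. *)
set b := z%:~R / K%:R; pose D : R := (4 * K%:R)^-1.
have D4 : 0 < D <= 4^-1.
  rewrite invr_gt0 mulr_gt0//= lef_pV2 ?posrE ?mulr_gt0// ler_peMr// ler1n//.
have nb : ~~ near_int D b.
  apply/negP => /asboolP[w].
  have -> : b - w%:~R = (z - w * K%:Z)%:~R / K%:R.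
    by rewrite intrB intrM mulrBl mulfK// gt_eqF.
  rewrite normrM normfV (gtr0_norm KR) ler_pdivrMr// /D invfM mulfVK ?gt_eqF//.
  move=> h; have : (absz (z - w * K%:Z)%R)%:R < 1 :> R.
    by rewrite natr_absz intr_norm; lra.
  rewrite -[1]/(1%:R) ltr_nat ltnS leqn0 absz_eq0 subr_eq0 => /eqP zw.
  move: zK z0; rewrite zw abszM absz_nat => h2 h3.
  have w0 : (0 < `|w|)%N by rewrite absz_gt0; apply: contraNneq h3 => ->; rewrite mul0r.
  by move: h2; rewrite ltnNge leq_pmull.
set S := \sum_(q < K) _.
have mS m : \sum_(q < m * K) cosp (a + q%:R * b) = m%:R * S.
  elim: m => [|m IH]; first by rewrite mul0n big_ord0 mul0r.
  rewrite mulSn big_split_ord/= -(natr1 m) mulrDl mul1r addrC; congr (_ + _).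
  rewrite -IH; apply: eq_bigr => q _.
  have -> : a + (K + q)%:R * b = a + q%:R * b + z%:~R.
    by rewrite natrD /b; field; rewrite gt_eqF.
  exact: cospDz.
apply/eqP; rewrite -normr_le0; apply/ler_addgt0Pr => e e0; rewrite add0r.
pose m := (Num.truncn (D^-1 / e)).+1.
have := geometric_cos a (m * K) D4 nb; rewrite mS normrM ger0_norm// => h.
have := truncnS_gt (D^-1 / e); rewrite -/m ltr_pdivrMr// => h2.
have m0 : 0 < m%:R :> R by rewrite ltr0n.
by rewrite -(ler_pM2l m0) (le_trans h)// ltW.
Qed.

(** Translates of the kernel by the nodes q / K form a partition of unity up to the factor K: every
    frequency i - j other than 0 averages out. *)
Lemma sum_fejer (K : nat) (t : R) : (0 < K)%N ->
  \sum_(q < K) fejer K (t - q%:R / K%:R) = K%:R.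
Proof.
move=> K0; have KR : K%:R != 0 :> R by rewrite pnatr_eq0 -lt0n.
rewrite /fejer -mulr_sumr exchange_big/=.
rewrite (eq_bigr (fun=> K%:R)).
  by rewrite sumr_const card_ord -[X in _ * X]mulr_natl mulKf.
move=> i _; rewrite exchange_big/= (bigD1 i)//= subrr.
rewrite [X in X + _](eq_bigr (fun=> 1)) ?sumr_const ?card_ord; last first.
  by move=> q _; rewrite mul0r cosp0.
rewrite big1 ?addr0// => j ji.
pose z : int := j%:Z - i%:Z.
rewrite -[RHS](@sum_cosp_period K z ((i%:R - j%:R) * t)).
- apply: eq_bigr => q _; congr cosp; rewrite /z intrB.
  by field.
- by rewrite subr_eq0; apply: contra ji => /eqP[] /val_inj ->.
- rewrite /z; move: (ltn_ord i) (ltn_ord j); move: (val i) (val j) => m n.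
  by clear -m; lia.
Qed.
End Fejer.

(** * Equidistribution from vanishing cosine means *)

Section WeylCriterion.
Variables (R : realType) (y : nat -> R).
Hypothesis mean0 : forall (h : nat) (phi : R), (0 < h)%N ->
  (\sum_(i < n) cosp (h%:R * y i + phi)) / n%:R @[n --> \oo] --> (0 : R).

Lemma mean_fejer (K : nat) (phi : R) : (0 < K)%N ->
  (\sum_(i < n) fejer K (y i - phi)) / n%:R @[n --> \oo] --> (1 : R).
Proof.
move=> K0; have KR : K%:R != 0 :> R by rewrite pnatr_eq0 -lt0n.
have -> : (fun n : nat => (\sum_(i < n) fejer K (y i - phi)) / n%:R) = fun n : nat =>
   K%:R^-1 * \sum_(i < K) \sum_(j < K)
     (\sum_(m < n) cosp ((i%:R - j%:R) * (y m - phi))) / n%:R.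
  apply/funext => n; rewrite /fejer -mulr_sumr -mulrA; congr (_ * _).
  rewrite exchange_big/= mulr_suml; apply: eq_bigr => i _.
  by rewrite exchange_big/= mulr_suml; apply: eq_bigr => j _.
have E : K%:R^-1 * \sum_(i < K) \sum_(j < K) (i == j)%:R = 1 :> R.
  rewrite (eq_bigr (fun=> 1)) ?sumr_const ?card_ord ?mulVf// => i _.
  by rewrite (bigD1 i)//= eqxx big1 ?addr0// => j; rewrite eq_sym => /negbTE ->.
rewrite -[X in _ --> X]E; apply: cvgMr.
apply: cvg_big => [|i _]; first exact: add_continuous.
apply: cvg_big => [|j _]; first exact: add_continuous.
have [->|ij] := eqVneq i j.
  apply: cvg_trans (@cvg_cst R (1 : R) nat \oo _); apply: near_eq_cvg.
  exists 1%N => // n /= n0.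
  rewrite (eq_bigr (fun=> 1)) ?sumr_const ?card_ord ?divff ?pnatr_eq0 -?lt0n// => m _.
  by rewrite subrr mul0r cosp0.
wlog ji : i j ij / (j < i)%N => [W|].
  have [ji|] := ltnP j i; first exact: W.
  rewrite leq_eqVlt => /predU1P[/val_inj/eqP|]; first by rewrite (negbTE ij).
  move=> ji; have := W j i; rewrite eq_sym => /(_ ij ji) h.
  apply: cvg_trans h; apply: near_eq_cvg.
  apply: nearW => n; congr (_ / _); apply: eq_bigr => m _.
  by rewrite -cospN; congr cosp; ring.
have ij0 : (0 < i - j)%N by rewrite subn_gt0.
have := mean0 (- ((i%:R - j%:R) * phi)) ij0.
apply: cvg_trans; apply: near_eq_cvg; apply: nearW => n; congr (_ / _).
by apply: eq_bigr => m _; rewrite natrB ?(ltnW ji)// -mulrBr.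
Qed.

Let freq (a b : R) (N : nat) : R :=
  #|[set n : 'I_N | a <= frac_part (y n) < b]%SET|%:R / N%:R.

Let freqE a b N :
  freq a b N = (\sum_(n < N) (a <= frac_part (y n) < b)%R%:R) / N%:R.
Proof.
rewrite /freq; congr (_ / _); rewrite -sum1_card natr_sum big_mkcond/=.
by apply: eq_bigr => i _; rewrite inE; case: ifP.
Qed.

Let frac_part_itv (t : R) : 0 <= frac_part t < 1.
Proof.
rewrite /frac_part; have := floor_itv t; rewrite intrD => /andP[h1 h2].
by apply/andP; split; lra.
Qed.

(** As D < s < 1 - D, the only integer that can be within D of t - s is the floor of t, and then the
    fractional part of t lies in [a, b). *)
Lemma fejer_separated (K : nat) (D a b t s : R) : 0 < D <= 4^-1 ->
  0 <= a -> b <= 1 -> a + D < s -> s < b - D -> ~~ (a <= frac_part t < b) ->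
  fejer K (t - s) <= K%:R^-1 * (2 * D^-1 ^+ 2).
Proof.
move=> D4 a0 b1 as_ sb tI; apply: fejer_le => //; apply/negP => /asboolP[z].
have /andP[f0 f1] := frac_part_itv t.
have -> : t - s - z%:~R = frac_part t - s + (Num.floor t - z)%:~R.
  by rewrite /frac_part intrB; ring.
move: (frac_part t) (Num.floor t - z) f0 f1 tI => u w u0 u1 tI.
rewrite ler_norml => /andP[h1 h2]; case/andP: D4 => D0 _.
have w0 : w < 1 by rewrite -(ltr_int R); lra.
have w1 : -1 < w by rewrite -(ltr_int R) mulrNz; lra.
have wE : w = 0 by clear -w0 w1; lia.
move: h1 h2 tI; rewrite wE; clear -as_ sb; move=> h1 h2 /negP; apply.
by apply/andP; split; lra.
Qed.

(** W averages the kernels at the nodes inside (a + D, b - D). It is at most 1 by the partition of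
    unity and at most e / 4 outside [a, b), so up to e / 4 it is a minorant of the indicator; its
    mean along y tends to the proportion m of such nodes. *)
Lemma freq_lower (a b e : R) : 0 <= a -> b <= 1 -> 0 < e ->
  \forall N \near \oo, b - a - e <= freq a b N.
Proof.
move=> a0 b1 e0.
(* The loss e is split into four equal parts: 2 D, 2 / K, the kernels outside [a, b), and the
   convergence of the mean. *)
pose D := Num.min (e / 8) 4^-1.
have D4 : 0 < D <= 4^-1 by rewrite lt_min ge_min lexx orbT andbT; apply/andP; split; lra.
have De : D <= e / 8 by rewrite ge_min lexx.
have /andP[D0 _] := D4.
pose K := (Num.truncn (4 / e * (2 * D^-1 ^+ 2 + 2))).+1.
have KR : 0 < K%:R :> R by rewrite ltr0n.
have Ke : 2 * D^-1 ^+ 2 + 2 <= e / 4 * K%:R.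
  rewrite -ler_pdivrMl ?divr_gt0// invf_div; exact/ltW/truncnS_gt.
have D2 : 0 <= D^-1 ^+ 2 by exact: sqr_ge0.
have K1 : K%:R^-1 <= e / 8.
  by rewrite -[leLHS]mul1r ler_pdivrMr//; lra.
have KD : K%:R^-1 * (2 * D^-1 ^+ 2) <= e / 4.
  by rewrite mulrC ler_pdivrMr//; lra.
pose G q := (a + D < q%:R / K%:R) && (q%:R / K%:R < b - D).
pose W (t : R) := K%:R^-1 * \sum_(q < K | G q) fejer K (t - q%:R / K%:R).
have W1 t : W t <= 1.
  rewrite /W ler_pdivrMl// mulr1 -[leRHS](@sum_fejer _ K t)// [leLHS]big_mkcond/=.
  by apply: ler_sum => q _; case: ifP => // _; exact: fejer_ge0.
have WI t : W t <= (a <= frac_part t < b)%R%:R + e / 4.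
  case tI : (a <= frac_part t < b); first by rewrite (le_trans (W1 t))// lerDl; lra.
  rewrite add0r /W ler_pdivrMl//.
  rewrite (@le_trans _ _ (\sum_(q < K) e / 4))//; last first.
    by rewrite sumr_const card_ord -[leLHS]mulr_natl.
  rewrite [leLHS]big_mkcond/=; apply: ler_sum => q _; case: ifP => [/andP[q1 q2]|_]; last by lra.
  by rewrite (le_trans _ KD)// (fejer_separated K D4 a0 b1 q1 q2)// tI.
pose m := (\sum_(q < K) (G q)%:R) / K%:R : R.
have mean_W : (\sum_(n < N) W (y n)) / N%:R @[N --> \oo] --> m.
  have -> : (fun N : nat => (\sum_(n < N) W (y n)) / N%:R) = fun N : nat => K%:R^-1 *
      \sum_(q < K) (G q)%:R * ((\sum_(n < N) fejer K (y n - q%:R / K%:R)) / N%:R).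
    apply/funext => N; rewrite /W -mulr_sumr -mulrA; congr (_ * _).
    rewrite exchange_big/= mulr_suml big_mkcond/=; apply: eq_bigr => q _.
    by case: (G q); rewrite ?mul1r ?mul0r.
  rewrite /m mulrC; apply: cvgMr; apply: cvg_big => [|q _]; first exact: add_continuous.
  by rewrite -[X in _ --> X]mulr1; apply: cvgMr; exact: mean_fejer.
have mG : b - a - 2 * D - 2 * K%:R^-1 <= m.
  rewrite /m ler_pdivlMr// mulrBl mulfVK ?gt_eqF//.
  have [B0|B0] := leP (b - D) 0.
    rewrite (@le_trans _ _ 0)//; last by apply: sumr_ge0.
    have : (b - a - 2 * D) * K%:R <= 0 by rewrite mulr_le0_ge0 ?(ltW KR)//; lra.
    lra.
  pose q0 := (Num.truncn ((a + D) * K%:R)).+1.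
  pose q1 := Num.truncn ((b - D) * K%:R).
  have q0A : q0%:R <= (a + D) * K%:R + 1.
    by rewrite /q0 -natr1 lerD2r truncn_le// mulr_ge0 ?(ltW KR)//; lra.
  have q1B : q1%:R <= (b - D) * K%:R by rewrite truncn_le// mulr_ge0 ?(ltW KR)// ltW.
  have q1K : (q1 <= K)%N.
    by rewrite -(ler_nat R) (le_trans q1B)// ler_piMl ?(ltW KR)//; lra.
  have q1B' : (b - D) * K%:R <= q1%:R + 1 by rewrite natr1 ltW// truncnS_gt.
  have := sum_ord_interval q0 (fun=> 1 : R) q1K; rewrite big_const_nat iter_addr addr0 => E.
  apply: (@le_trans _ _ (q1 - q0)%:R).
    have : q1%:R <= (q1 - q0)%:R + q0%:R :> R by rewrite -natrD ler_nat addnC -leq_subLR.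
    lra.
  rewrite -E; apply: ler_sum => q _; rewrite mulr1 ler_nat.
  case: andP => // -[h1 h2]; rewrite /G ltr_pdivlMr// ltr_pdivrMr//.
  rewrite (lt_le_trans (truncnS_gt _)) ?ler_nat//=.
  by rewrite (lt_le_trans _ q1B)// ltr_nat.

have e8 : 0 < e / 4 by lra.
move/cvgrPdist_le : mean_W => /(_ _ e8); apply: filterS2 (nbhs_infty_gt 0).
move=> N N0; rewrite ler_norml freqE => /andP[_ h].
have NR : 0 < N%:R :> R by rewrite ltr0n.
have : (\sum_(n < N) W (y n)) / N%:R <= (\sum_(n < N) (a <= frac_part (y n) < b)%R%:R) / N%:R + e / 4.
  rewrite ler_pdivrMr// mulrDl divfK ?gt_eqF//.
  rewrite (le_trans (ler_sum _ (fun (i : 'I_N) _ => WI (y i))))//.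
  by rewrite big_split/= sumr_const card_ord -[X in _ + X]mulr_natr.
lra.
Qed.

(** Lower bounds suffice: the frequencies of [0, a), [a, b) and [b, 1) add up to 1, so the lower
    bounds for the outer two give the upper bound for the middle one. *)
Lemma weyl_criterion : uniformly_distributed_mod1 y.
Proof.
move=> a b a0 ab b1; apply/cvgrPdist_le => e e0; have e2 : 0 < e / 2 by lra.
have b0 : 0 <= b by lra.
have a1 : a <= 1 by lra.
apply: filterS3 (nbhs_infty_gt 0) (filterI (freq_lower a0 b1 e2) (freq_lower b0 (lexx 1) e2))
  (freq_lower (lexx 0) a1 e2) => N N0 [hab hb ha].
have NR : N%:R != 0 :> R by rewrite pnatr_eq0 -lt0n.
have : freq 0 a N + freq a b N + freq b 1 N = 1.
  rewrite !freqE -!mulrDl -!big_split/= (eq_bigr (fun=> 1)) ?sumr_const ?card_ord ?divff//.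
  move=> n _; have /andP[-> ->] := frac_part_itv (y n); rewrite andbT /=.
  move: (frac_part _) => u; have [ua|ua] := ltP u a.
    by rewrite (lt_le_trans ua (ltW ab))/= lt_geF ?(lt_trans ua)// !addr0.
  by rewrite add0r/=; have [ub|ub] := ltP u b; rewrite ?addr0 ?add0r.
rewrite -/(freq a b N) ler_norml => h; apply/andP; split; lra.
Qed.
End WeylCriterion.

Theorem theorem3p3 (R : realType) (f : continuousType R R) (l : nat) :
  hardy_union (to_germ f) -> (1 <= l)%N -> of_type_xplus l f ->
  uniformly_distributed_mod1 (fun n : nat => f (nth_prime n)%:R).
Proof.
move=> Hf l1 ft; have [F [theta [F0 RF]]] := hardy_regular_chain Hf ft.
apply: weyl_criterion => h phi h0.
have h_neq0 : h%:R != 0 :> R by rewrite pnatr_eq0 -lt0n.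
pose g n := cosp (h%:R * f n%:R + phi).
apply: (@cvg_mean_prime R g) => [n|e e0]; first exact: cosp_le1.
apply: filterS (dyadic_sum l1 (regular_chain_affine phi h_neq0 RF) e0) => X.
by under eq_bigr do rewrite F0 mul1r.
Qed.
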